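(* There exists an absolute constant $c>0$ such that the following holds. Let $S\subset\mathbf{Z}$ be finite and $M(S)=\max_{s\in S}|s|$. Let $g(t)=\sum_{n=0}^N a_n\cos nt$ be a cosine polynomial with coefficients $a_n\in S$. Then the number $Z(g)$ of roots of $g$ satisfies $$Z(g)\geqslant\left(\frac{c}{1+\log M(S)}\right)\frac{\log\log|g(0)|}{\log\log\log|g(0)|}.$$
   Context: $Z(g)$ denotes the number of zeros of $g$ in $[0,2\pi]$. $\mathbf{Z}$ is the set of integers and $\log$ is the natural logarithm. The constant $c$ does not depend on $S$, $N$ or $g$.
   Formalization: The inequality is proved only when its right-hand side is at least 1; as written it is false, since a constant g = K > e^e with S = {K} has no roots while the right-hand side is positive for every c > 0. *)

(* Defs.v *)
From mathcomp Require Import all_boot all_order all_algebra finmap.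
From mathcomp Require Import all_classical all_reals all_analysis.
Set Implicit Arguments.
Unset Strict Implicit.
Unset Printing Implicit Defensive.
Import Order.TTheory GRing.Theory Num.Theory.
Local Open Scope classical_set_scope.
Local Open Scope ring_scope.

Definition max_abs (S : {fset int}) : nat := (\max_(s <- S) `|s|)%N.

Definition cosine_poly (R : realType) (N : nat) (a : nat -> int) (t : R) : R :=
  \sum_(0 <= n < N.+1) (a n)%:~R * cos (n%:R * t).

(* Distinct zeros, counted without multiplicity; +oo if there are infinitely
   many of them. *)
Definition num_zeros (R : realType) (g : R -> R) : \bar R :=
  counting [set t : R | 0 <= t <= 2 * pi /\ g t = 0].

(* [v] stands for |g(0)|. The value is junk, namely 0, for integers v <= 2,
   where the iterated logarithms are not all defined: the library sets ln to 0
   on nonpositive numbers and the inverse of 0 to 0. *)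
Definition zeros_bound (R : realType) (c : R) (S : {fset int}) (v : R) : R :=
  c / (1 + ln (max_abs S)%:R) * (ln (ln v) / ln (ln (ln v))).

(* Main.v *)
Require Import Defs.
From HB Require Import structures.
From mathcomp Require Import all_boot all_order all_algebra all_field finmap.
From mathcomp Require Import perm complex.
From mathcomp Require Import all_classical all_reals all_analysis.
From mathcomp Require Import zify ring lra.
Set Implicit Arguments.
Unset Strict Implicit.
Unset Printing Implicit Defensive.
Import Order.TTheory GRing.Theory Num.Theory.
Local Open Scope ring_scope.

(** Let k be the number of sign changes of g, as a polynomial in cos t, and M
    the bound on its coefficients. Taking logarithms twice, it is enough to
    bound |g(0)| by 2 ^ (E ^ C), where E = ((k + 2) (M + 1)) ^ (k + 1).

    Read g as an even integer sequence x on Z. Multiplication of g by 2 cos t -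
    z is the operator x (n + 1) + x (n - 1) - z x n. The product over the sign
    changes z makes g keep one sign; we multiply further by the squares of the
    factors 2 cos t - (w + 1/w), where w runs over the roots of unity of bounded
    order for which w + 1/w is close to a sign change. Wherever the resulting
    sequence b is tiny on a long interval, x is periodic there (pigeonhole and
    integrality) and its spectrum consists of such roots of unity (Cramer's
    rule). Hence b vanishes exactly there, and the sequence c obtained from x by
    the squared factors with w <> 1 alone is constant there, equal to 0 or not
    small.

    As b is the coefficient sequence of a nonnegative polynomial, its L1 norm is
    b 0, and the Davenport-Cohen lower bound for L1 norms bounds the size of the
    support of b. So c is a step function with a bounded number of steps, and
    its polynomial has the sign changes of g. Some wide range of scales t
    contains no sign change; averaging against differences of the kernels ((1 +
    cos t) / 2) ^ n at these scales shows that smoothing c at some scale and at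
    a much larger one give nearly the same result. A long nonzero stretch of c
    would make the smoothed sequence cross continuously the forbidden gap of the
    values of c, so c has a bounded number of nonzero coefficients, which bounds
    g(0). *)

(** * Linear recurrences and Cramer's rule *)

(** The sign changes are arbitrary reals [z], so the operator that they define may make a periodic
    integer sequence tiny without annihilating it: [w + 1/w] can be close to [z] and still differ
    from it. The extra factors turn such tiny values into exact zeros. They enter squared so that no
    sign is disturbed, and [w = 1] is left out of [c] because [2 * cos t - 2] vanishes at [t = 0]
    and would erase g(0). They are few, because the numbers [w + 1/w] of bounded order are well
    separated; the order is bounded because a rational recurrence with a primitive root of order n
    has degree at least [totient n]. Only one exponential in E is lost. The windows of O(k) integers
    of size O(M) number E ^ O(1), and so do the inverses of all thresholds. The Davenport-Cohen
    iteration runs E ^ O(1) times and multiplies lengths by a fixed factor each time, so the support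
    of [b] may reach 2 ^ (E ^ O(1)). The scales form a geometric progression with a ratio of that
    size and E ^ O(1) terms, so the last bound has the same shape. *)

Section Action.
Variable V : comNzRingType.
Implicit Types (p q : {poly V}) (x y : nat -> V).

(* ['X] acts as the shift. *)
Definition act q x (n : nat) : V := \sum_(i < size q) q`_i * x (n + i)%N.

Lemma act_wide q x n k : (size q <= k)%N ->
  act q x n = \sum_(i < k) q`_i * x (n + i)%N.
Proof.
move=> hk; rewrite /act (big_ord_widen k (fun i => q`_i * x (n + i)%N)) //.
rewrite big_mkcond; apply: eq_bigr => i _; case: ltnP => // h.
by rewrite nth_default ?mul0r.
Qed.

Lemma eq_act q x y : x =1 y -> act q x =1 act q y.
Proof. by move=> e n; apply: eq_bigr => i _; rewrite e. Qed.

Lemma act0p x n : act 0 x n = 0.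
Proof. by rewrite /act size_poly0 big_ord0. Qed.

Lemma actC (c : V) x n : act c%:P x n = c * x n.
Proof.
by rewrite (@act_wide _ _ _ 1) ?size_polyC_leq1 // big_ord1 coefC addn0.
Qed.

Lemma act1p x n : act 1 x n = x n.
Proof. by rewrite /act size_poly1 big_ord1 coefC mul1r addn0. Qed.

Lemma actD p q x n : act (p + q) x n = act p x n + act q x n.
Proof.
pose k := maxn (size p) (size q).
rewrite !(@act_wide _ _ _ k) ?leq_maxl ?leq_maxr ?(leq_trans (size_polyD _ _)) //.
by rewrite -big_split; apply: eq_bigr => i _; rewrite coefD mulrDl.
Qed.

Lemma actX x n : act 'X x n = x n.+1.
Proof.
by rewrite /act size_polyX big_ord_recl big_ord1 !coefX mul0r add0r mul1r addn1.
Qed.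

Lemma actCM (c : V) q x n : act (c%:P * q) x n = c * act q x n.
Proof.
rewrite (@act_wide _ _ _ (size q)); last first.
  by rewrite mul_polyC size_scale_leq.
by rewrite mulr_sumr; apply: eq_bigr => i _; rewrite coefCM mulrA.
Qed.

Lemma actMX q x n : act (q * 'X) x n = act q x n.+1.
Proof.
rewrite (@act_wide _ _ _ (size q).+1); last first.
  by rewrite (leq_trans (size_polyMleq _ _)) // size_polyX addn2.
rewrite big_ord_recl coefMX mul0r add0r.
by apply: eq_bigr => i _; rewrite coefMX /= addnS.
Qed.

Lemma actM p q x n : act (p * q) x n = act p (act q x) n.
Proof.
elim/poly_ind: p n => [|p c IH] n; first by rewrite mul0r !act0p.
by rewrite mulrDl !actD actCM actC mulrAC !actMX IH.
Qed.

Lemma act_shift q x n k : act q (fun i => x (i + k)%N) n = act q x (n + k)%N.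
Proof. by apply: eq_bigr => i _; rewrite addnAC. Qed.

Lemma act_Xsub (c : V) x n : act ('X - c%:P) x n = x n.+1 - c * x n.
Proof. by rewrite -polyCN actD actX actC mulNr. Qed.

End Action.

Lemma act_map (U V : comNzRingType) (f : {rmorphism U -> V})
  (q : {poly U}) (x : nat -> U) n :
  act (map_poly f q) (f \o x) n = f (act q x n).
Proof.
rewrite (@act_wide _ _ _ _ (size q)) ?size_poly // /act rmorph_sum.
by apply: eq_bigr => i _; rewrite coef_map rmorphM.
Qed.

Lemma norm_det_le (C : numFieldType) n (M : 'M[C]_n) (A : C) :
  (forall i j, `|M i j| <= A) -> `|\det M| <= n`!%:R * A ^+ n.
Proof.
move=> hM; apply: le_trans (ler_norm_sum _ _ _) _.
have -> : n`!%:R * A ^+ n = \sum_(s : 'S_n) A ^+ n.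
  by rewrite sumr_const card_Sn mulr_natl.
apply: ler_sum => s _; rewrite normrM normrX normrN1 expr1n mul1r normr_prod.
rewrite -[X in _ <= _ ^+ X]card_ord -prodr_const.
by apply: ler_prod => i _; rewrite normr_ge0 hM.
Qed.

(* If [M] had full column rank, Cramer's rule would bound the last coordinate
   of [y] by the small entries of [M y], the determinant being a nonzero integer. *)
Lemma small_image_kernel (C : numFieldType) (s d : nat) (M : 'M[int]_(d, s.+1))
    (y : 'cV[C]_s.+1) (A eps : C) :
  (forall i j, `|M i j|%:~R <= A) -> 1 <= `|y ord_max 0| ->
  (forall i, `|(map_mx intr M *m y) i 0| <= eps) ->
  eps * (s.+1`!%:R * A ^+ s) < 1 ->
  exists2 q : 'cV[rat]_s.+1, q != 0 & map_mx intr M *m q = 0.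
Proof.
move=> hA hy heps hlt; set Mq : 'M[rat]_(d, s.+1) := map_mx intr M.
have [full|] := boolP (row_full Mq); last first.
  have -> : row_full Mq = row_free Mq^T by rewrite /row_free mxrank_tr.
  rewrite -kermx_eq0 => /rowV0Pn[v /sub_kermxP hv nz].
  exists v^T; first by apply: contraNneq nz => h; rewrite -(trmxK v) h trmx0.
  by apply: trmx_inj; rewrite trmx_mul trmxK trmx0.
exfalso.
pose f := fullrankfun full; pose B : 'M[int]_s.+1 := rowsub f M.
have detB : \det B != 0.
  have := fullrowsub_unit full; rewrite unitmxE unitfE.
  have -> : rowsub f Mq = map_mx intr B by apply/matrixP => i j; rewrite !mxE.
  by rewrite det_map_mx intr_eq0.
pose BC : 'M[C]_s.+1 := map_mx intr B.
pose u := BC *m y.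
have hu i : `|u i 0| <= eps.
  have := heps (f i); rewrite !mxE => h; rewrite (le_trans _ h) //.
  by rewrite le_eqVlt; apply/orP; left; apply/eqP; congr `|_|; apply: eq_bigr => j _; rewrite !mxE.
have eq1 : \adj BC *m u = \det BC *: y by rewrite mulmxA mul_adj_mx mul_scalar_mx.
have /(congr1 (fun v : 'cV[C]_s.+1 => `|v ord_max 0|)) := eq1.
rewrite [in RHS]mxE normrM => eq2.
have A0 : 0 <= A.
  by apply: le_trans (hA (f ord0) ord0); rewrite ler0z.
have e0 : 0 <= eps by apply: le_trans (hu ord0).
have : `|\det BC| * `|y ord_max 0| <= eps * (s.+1`!%:R * A ^+ s).
  rewrite -eq2 mxE; apply: le_trans (ler_norm_sum _ _ _) _.
  have -> : eps * (s.+1`!%:R * A ^+ s) = \sum_(j < s.+1) ((s`!%:R * A ^+ s) * eps).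
    rewrite sumr_const card_ord factS natrM -[RHS]mulr_natl; ring.
  apply: ler_sum => j _; rewrite normrM ler_pM //.
  rewrite mxE /cofactor normrM normrX normrN1 expr1n mul1r.
  apply: norm_det_le => i k; rewrite !mxE.
  by rewrite -intr_norm hA.
apply/negP; rewrite -real_ltNge; last 2 first.
- by rewrite ger0_real // mulr_ge0 // mulr_ge0 // exprn_ge0.
- by rewrite realM // normr_real.
apply: lt_le_trans hlt _.
rewrite -[X in X <= _]mulr1 ler_pM //.
by rewrite det_map_mx -intr_norm ler1z -gtz0_ge1 normr_gt0.
Qed.

(** The rows of [M] are the windows of length [s.+1] that start within one period, so [M] times the
    coefficients of [y] lists the values of [act y]. A rational kernel vector is a recurrence no
    longer than [y]. *)
Lemma small_act_annihilated (C : numFieldType) (d s : nat) (x : nat -> int)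
    (y : {poly C}) (A eps : C) :
  (0 < d)%N -> (forall n, x (n + d)%N = x n) -> (forall n, `|x n|%:~R <= A) ->
  size y = s.+1 -> y \is monic ->
  (forall n, `|act y (intr \o x) n| <= eps) ->
  eps * (s.+1`!%:R * A ^+ s) < 1 ->
  exists q : {poly rat}, [/\ q != 0, (size q <= s.+1)%N & forall n, act q (intr \o x) n = 0].
Proof.
move=> d0 per hA sy my heps hlt.
pose M : 'M[int]_(d, s.+1) := \matrix_(i, j) x (i + j)%N.
pose yv : 'cV[C]_s.+1 := \col_j y`_j.
have hk : forall i : 'I_d, (map_mx intr M *m yv) i 0 = act y (intr \o x) i.
  move=> i; rewrite mxE /act sy; apply: eq_bigr => j _.
  by rewrite !mxE mulrC.
case: (@small_image_kernel C s d M yv A eps) => //.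
- by move=> i j; rewrite mxE.
- by rewrite mxE /= -[s]/(s.+1.-1) -sy -lead_coefE (monicP my) normr1.
- by move=> i; rewrite hk.
move=> v nz hv; exists (\poly_(j < s.+1) v (inord j) 0); split.
- apply: contraNneq nz => h; apply/eqP/matrixP => i j; rewrite [j]ord1 [RHS]mxE.
  have := congr1 (fun q : {poly rat} => q`_i) h.
  by rewrite coef_poly ltn_ord coef0 inord_val.
- exact: size_poly.
move=> n.
have pern k m : x (m + k * d)%N = x m.
  by elim: k => [|k IH]; rewrite ?addn0 // mulSn addnCA addnC per.
have lt : (n %% d < d)%N by rewrite ltn_mod.
have := congr1 (fun w : 'cV[rat]_d => w (Ordinal lt) 0) hv.
rewrite [in LHS]mxE [in RHS]mxE => <-.
rewrite (@act_wide _ _ _ _ s.+1) ?size_poly //.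
apply: eq_bigr => j _; rewrite coef_poly ltn_ord inord_val !mxE mulrC /=.
by rewrite {1}(divn_eq n d) -addnA addnC pern.
Qed.

(** * Roots of unity *)

(** Multiplicativity reduces it to prime powers, where [p <= (p - 1) ^ 2] as soon as [p >= 3]. With
    the next lemma, which pays a factor 2 for the powers of 2, it turns the degree of a rational
    polynomial into a bound on the orders of its roots of unity. *)
Lemma odd_leq_sqr_totient n : odd n -> (n <= totient n ^ 2)%N.
Proof.
elim/ltn_ind: n => n IH on.
have [->//|n1] := eqVneq n 1%N.
have n0 : (0 < n)%N by case: n on {IH n1}.
have pp : prime (pdiv n) by rewrite pdiv_prime // ltn_neqAle eq_sym n1.
set p := pdiv n in pp.
have [m cop def_n] := pfactor_coprime pp n0.
have e0 : (0 < logn p n)%N by rewrite logn_gt0 mem_primes pp n0 pdiv_dvd.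
set e := logn p n in def_n e0.
have p3 : (2 < p)%N.
  rewrite ltn_neqAle prime_gt1 // andbT; apply: contraTneq on => h.
  by have := pdiv_dvd n; rewrite -/p -h dvdn2.
have om : odd m by move: on; rewrite def_n oddM => /andP[].
have mn : (m < n)%N.
  by rewrite [X in (_ < X)%N]def_n -{1}[m]muln1 ltn_pmul2l ?odd_gt0 // -(exp1n e) ltn_exp2r // prime_gt1.
have hm := IH m mn om.
rewrite {1}def_n [in totient _]def_n totient_coprime; last by rewrite coprime_sym coprime_pexpl.
rewrite totient_pfactor // expnMn leq_mul // expnMn.
rewrite -{1}(prednK e0) expnS leq_mul //.
  by move: p3; case: p {pp cop def_n e0 e} => [|[|[|p]]] //= _; rewrite expnS expn1; nia.
by rewrite -expnM leq_pexp2l ?prime_gt0 //; lia.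
Qed.

Lemma leq_double_sqr_totient n : (n <= 2 * totient n ^ 2)%N.
Proof.
have [->//|n0] := posnP n.
have [m cop def_n] := pfactor_coprime (isT : prime 2) n0.
have om : odd m by rewrite -coprime2n.
have hm := odd_leq_sqr_totient om.
set e := logn 2 n in def_n.
case: (posnP e) => [e0|e0].
  by rewrite def_n e0 muln1; apply: leq_trans hm _; rewrite leq_pmull.
rewrite {1}def_n [in totient _]def_n totient_coprime; last by rewrite coprime_sym coprime_pexpl.
rewrite totient_pfactor // expnMn /= mul1n mulnCA leq_mul //.
by rewrite -{1}(prednK e0) expnS leq_pmul2l // -expnM leq_pexp2l //; lia.
Qed.

Lemma root_Cyclotomic_prim (C : numClosedFieldType) n (w : C) :
  n.-primitive_root w -> root (map_poly intr 'Phi_n) w.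
Proof.
move=> pw; have n0 := prim_order_gt0 pw.
have : root (map_poly intr ('X^n - 1 : {poly int})) w.
  by rewrite rmorphB /= map_polyXn rmorph1 /root !hornerE (prim_expr_order pw) subrr.
rewrite -prod_Cyclotomic // rmorph_prod /root horner_prod prodf_seq_eq0.
move=> /hasP[d]; rewrite -dvdn_divisors // => dn /=; rewrite -/(root _ _) => rd.
suff : (n %| d)%N by move=> nd; have /eqP <- : d == n by rewrite eqn_dvd dn.
have d0 := dvdn_gt0 n0 dn.
rewrite (prim_order_dvd pw).
have : root (map_poly intr ('X^d - 1 : {poly int})) w.
  rewrite -prod_Cyclotomic // rmorph_prod /root horner_prod prodf_seq_eq0.
  by apply/hasP; exists d; rewrite -?dvdn_divisors.
by rewrite rmorphB /= map_polyXn rmorph1 /root !hornerE subr_eq0.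
Qed.

(** The degree of the minimal polynomial of a primitive root is taken from [algC]. So the common
    root [w] is traded, through the gcd over [rat], for a common root [z] in [algC], again primitive
    of order [n]. *)
Lemma totient_lt_size_rat_poly (C : numClosedFieldType) n (w : C) (m : {poly rat}) :
  n.-primitive_root w -> m != 0 -> root (map_poly ratr m) w ->
  (totient n < size m)%N.
Proof.
move=> pw m0 rm.
have rP := root_Cyclotomic_prim pw.
pose P : {poly rat} := map_poly intr 'Phi_n.
have PC (F : numFieldType) : map_poly intr 'Phi_n = map_poly (ratr : rat -> F) P.
  rewrite -map_poly_comp; apply: eq_map_poly => z /=; by rewrite ratr_int.
have ncop : ~~ coprimep P m.
  apply/negP => cop.
  have : coprimep (map_poly (ratr : rat -> C) P) (map_poly ratr m) by rewrite coprimep_map.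
  move=> /coprimep_root => /(_ w); rewrite -PC => /(_ rP).
  by rewrite -/(root _ _) rm.
pose g := gcdp P m.
have : size (map_poly (ratr : rat -> algC) g) != 1%N by rewrite size_map_poly.
move=> /closed_rootP[z rz].
have zP : root (map_poly (ratr : rat -> algC) P) z.
  by move: rz; rewrite -!dvdp_XsubCl => /dvdp_trans; apply; rewrite dvdp_map dvdp_gcdl.
have zm : root (map_poly (ratr : rat -> algC) m) z.
  by move: rz; rewrite -!dvdp_XsubCl => /dvdp_trans; apply; rewrite dvdp_map dvdp_gcdr.
have n0 := prim_order_gt0 pw.
have [z0 pz0] := C_prim_root_exists n0.
have pz : n.-primitive_root z.
  move: zP; rewrite -PC (Cintr_Cyclotomic pz0) root_cyclotomic //.
have [r [er _] hr] := minCpolyP z.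
have := hr m; rewrite zm => /esym /dvdp_leq => /(_ m0).
rewrite -(size_map_poly (ratr : {rmorphism rat -> algC}) r) -er (minCpoly_cyclotomic pz).
by rewrite size_cyclotomic.
Qed.

Lemma norm_unity_root (C : numDomainType) N (z : C) :
  z ^+ N = 1 -> (0 < N)%N -> `|z| = 1.
Proof.
move=> zN N0; apply/eqP.
by rewrite -(pexpr_eq1 N0 (normr_ge0 z)) -normrX zN normr1.
Qed.

(* The powers of [z] sum to 0, so their distances to 1 sum to at least [N]. *)
Lemma unity_root_dist1 (C : numClosedFieldType) N (z : C) :
  (0 < N)%N -> z ^+ N = 1 -> z != 1 -> 1 <= N%:R * `|z - 1|.
Proof.
move=> N0 zN z1.
have nz : `|z| = 1.
  exact: norm_unity_root zN N0.
have sum0 : \sum_(i < N) z ^+ i = 0.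
  have := subrX1 z N; rewrite zN subrr => /esym/eqP; rewrite mulf_eq0 subr_eq0.
  by rewrite (negbTE z1) => /eqP.
have hi i : `|z ^+ i - 1| <= i%:R * `|z - 1|.
  rewrite subrX1 normrM mulrC ler_wpM2r //.
  apply: le_trans (ler_norm_sum _ _ _) _.
  under eq_bigr do rewrite normrX nz expr1n.
  by rewrite sumr_const card_ord.
have : N%:R <= N%:R * (N%:R * `|z - 1|).
  have {1}-> : (N%:R : C) = `|\sum_(i < N) (z ^+ i - 1)|.
    by rewrite sumrB sum0 sub0r normrN sumr_const card_ord normr_nat.
  apply: le_trans (ler_norm_sum _ _ _) _.
  rewrite [X in _ <= X]mulr_natl -[X in _ *+ X]card_ord -sumr_const.
  apply: ler_sum => i _; apply: le_trans (hi i) _.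
  by rewrite ler_wpM2r // ler_nat ltnW.
by rewrite -{1}[N%:R]mulr1 ler_pM2l // ltr0n.
Qed.

Definition twoRe (C : fieldType) (w : C) := w + w^-1.

(** Up to a factor of norm 1 the difference is [(w / w' - 1) * (w * w' - 1)], and [unity_root_dist1]
    applies to both [w / w'] and [w * w'], whose orders divide [n * n']. *)
Lemma twoRe_sep (C : numClosedFieldType) n n' (w w' : C) :
  w ^+ n = 1 -> w' ^+ n' = 1 -> (0 < n)%N -> (0 < n')%N -> twoRe w != twoRe w' ->
  1 <= ((n * n') ^ 2)%:R * `|twoRe w - twoRe w'|.
Proof.
move=> wn wn' n0 n0' ne.
have w0 : w != 0 by apply: contra_eq_neq wn => ->; rewrite expr0n (gtn_eqF n0) eq_sym oner_eq0.
have w0' : w' != 0 by apply: contra_eq_neq wn' => ->; rewrite expr0n (gtn_eqF n0') eq_sym oner_eq0.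
have nw : `|w| = 1 by exact: norm_unity_root wn n0.
have nw' : `|w'| = 1 by exact: norm_unity_root wn' n0'.
have fac : twoRe w - twoRe w' = w^-1 * ((w * w'^-1 - 1) * (w * w' - 1)).
  by rewrite /twoRe; field; rewrite w0 w0'.
have := ne; rewrite -subr_eq0 fac !mulf_eq0 invr_eq0 (negbTE w0) /= negb_or !subr_eq0.
case/andP => h1 h2.
rewrite !normrM normfV nw invr1 mul1r.
have e1 : (w * w'^-1) ^+ (n * n') = 1.
  by rewrite exprMn exprVn exprM wn expr1n mul1r mulnC exprM wn' expr1n invr1.
have e2 : (w * w') ^+ (n * n') = 1.
  by rewrite exprMn exprM wn expr1n mul1r mulnC exprM wn' expr1n.
have nn : (0 < n * n')%N by rewrite muln_gt0 n0.
have := mulr_ege1 (unity_root_dist1 nn e1 h1) (unity_root_dist1 nn e2 h2).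
by rewrite natrX; rewrite mulrACA -expr2.
Qed.

(** * Runs on which a recurrence nearly holds *)

Lemma leq_fact m n : (m <= n)%N -> (m`! <= n`!)%N.
Proof.
move/subnK <-; elim: (n - m)%N => // k IH.
by rewrite addSn factS (leq_trans IH) // leq_pmull.
Qed.

Lemma ex_least (P : nat -> Prop) : (exists n, P n) ->
  exists n, P n /\ forall m, P m -> (n <= m)%N.
Proof.
case=> n Pn; have ex : exists n, `[< P n >] by exists n; apply/asboolP.
case: (ex_minnP ex) => k /asboolP Pk hk; exists k; split=> // m Pm.
by apply: hk; apply/asboolP.
Qed.

Lemma act_zero (V : comNzRingType) (q : {poly V}) (x : nat -> V) n :
  (forall i, x i = 0) -> act q x n = 0.
Proof. by move=> h; rewrite /act big1 // => i _; rewrite h mulr0. Qed.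

Lemma minimal_annihilator (F : fieldType) (x : nat -> F) (q0 : {poly F}) :
  q0 != 0 -> (forall n, act q0 x n = 0) ->
  exists m, [/\ m \is monic, forall n, act m x n = 0 &
    forall q, (forall n, act q x n = 0) -> m %| q].
Proof.
move=> nz0 h0.
pose P k := exists q : {poly F}, [/\ q != 0, size q = k & forall n, act q x n = 0].
have [k [[m [nzm sm hm]] hmin]] : exists k, P k /\ forall l, P l -> (k <= l)%N.
  by apply: ex_least; exists (size q0), q0.
have lc0 : lead_coef m != 0 by rewrite lead_coef_eq0.
exists ((lead_coef m)^-1 *: m); split.
- by rewrite monicE lead_coefZ mulVf.
- by move=> n; rewrite -mul_polyC actCM hm mulr0.
move=> q hq; rewrite dvdpZl ?invr_eq0 //.
apply: contraT => nd; have := hmin (size (q %% m)).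
suff Pm : P (size (q %% m)) by move/(_ Pm); rewrite -sm leqNgt ltn_modp nzm.
exists (q %% m); split=> // n.
have := hq n; rewrite {1}(divp_eq q m) actD actM act_zero ?add0r //.
Qed.

Lemma actXn (V : comNzRingType) k (x : nat -> V) n : act 'X^k x n = x (n + k)%N.
Proof.
elim: k n => [|k IH] n; first by rewrite expr0 act1p addn0.
by rewrite exprSr actMX IH addSnnS.
Qed.

Lemma norm_act_prod_XsubC (C : numFieldType) (l : seq C) (b : nat -> C) (e : C) n :
  (forall v, v \in l -> `|v| = 1) -> (forall i, `|b i| <= e) ->
  `|act (\prod_(v <- l) ('X - v%:P)) b n| <= 2 ^+ size l * e.
Proof.
move=> hl hb; elim: l hl n => [|v l IH] hl n.
  by rewrite big_nil act1p /= expr0 mul1r.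
rewrite big_cons actM act_Xsub exprS -mulrA mulr_natl mulr2n.
apply: le_trans (ler_normB _ _) _; rewrite normrM (hl v) ?mem_head // mul1r.
by apply: lerD; apply: IH => w wl; apply: hl; rewrite inE wl orbT.
Qed.

Lemma act_geom (V : comNzRingType) (p : {poly V}) (u : nat -> V) (w : V) n :
  (forall i, u i.+1 = w * u i) -> act p u n = p.[w] * u n.
Proof.
move=> hu; rewrite horner_coef mulr_suml; apply: eq_bigr => i _.
rewrite -mulrA; congr (_ * _).
elim: (val i) => [|k IH]; first by rewrite addn0 mul1r.
by rewrite addnS hu IH exprS mulrA.
Qed.

Section Periodic.
Variables (C : numClosedFieldType) (A d K : nat) (x : nat -> int) (p : {poly C}).
Variables (delta eta : C).
Hypotheses (A0 : (0 < A)%N) (d0 : (0 < d)%N).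
Hypothesis (per : forall n, x (n + d)%N = x n).
Hypothesis (bnd : forall n, (`|x n| <= A)%N).
Hypotheses (mp : p \is monic) (sp : size p = K.+1).
Hypothesis hp : forall n, `|act p (intr \o x) n| <= delta.
Hypothesis hdelta : delta * (2 ^+ K * (K.+1`!%:R * A%:R ^+ K)) < eta.
Hypothesis eta1 : eta <= 1.

Let delta0 : 0 <= delta. Proof. exact: le_trans (hp 0). Qed.

Let bndC n : `|x n|%:~R <= A%:R :> C.
Proof. by rewrite -[A%:R]/((A%:Z)%:~R) ler_int -abszE lez_nat. Qed.

(* The [rs] are the roots of the minimal rational recurrence of [x]. Dividing it
   by ['X - w] leaves a geometric sequence of ratio [w], which the last clause
   keeps from being small; so [p.[w]] must be. *)
Lemma periodic_spectrum : exists rs : seq C,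
  [/\ uniq rs, (size rs <= K)%N,
    forall w, w \in rs -> `|p.[w]| < eta /\ exists n, (0 < n <= 2 * K ^ 2)%N /\ w ^+ n = 1,
    forall n, act (\prod_(w <- rs) ('X - w%:P)) (intr \o x) n = 0 &
    forall (y : {poly C}) (eps : C), y \is monic -> (size y <= size rs)%N ->
      eps * (K.+1`!%:R * A%:R ^+ K) < 1 ->
      ~ (forall n, `|act y (intr \o x) n| <= eps)].
Proof.
have AK (k : nat) (e : C) : (k <= K)%N -> 0 <= e -> e * (K.+1`!%:R * A%:R ^+ K) < 1 ->
    e * (k.+1`!%:R * A%:R ^+ k) < 1.
  move=> kK e0; apply: le_lt_trans; rewrite ler_wpM2l // -!natrX -!natrM ler_nat.
  by rewrite leq_mul // ?leq_pexp2l // leq_fact.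
have small1 : delta * (K.+1`!%:R * A%:R ^+ K) < 1.
  apply: le_lt_trans (lt_le_trans hdelta eta1); rewrite ler_wpM2l //.
  rewrite ler_peMl // ?exprn_ege1 ?ler1n // mulr_ge0 // exprn_ge0 //.
have [q0 [nz0 sq0 hq0]] := small_act_annihilated d0 per bndC sp mp hp small1.
have [m [mm hm mmin]] := minimal_annihilator nz0 hq0.
have sm : (size m <= K.+1)%N by apply: leq_trans (dvdp_leq nz0 (mmin _ hq0)) sq0.
pose mC := map_poly (ratr : rat -> C) m.
have hmC n : act mC (intr \o x) n = 0.
  rewrite (@eq_act _ _ _ (ratr \o (intr \o x))); last by move=> i /=; rewrite ratr_int.
  by rewrite act_map hm rmorph0.
(* Because of the period [d], the roots of the minimal recurrence are simple roots of unity. *)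
have mX : m %| 'X^d - 1.
  apply: mmin => n; rewrite actD actXn -polyC1 -polyCN actC /= per.
  by rewrite mulN1r subrr.
have mCX : mC %| 'X^d - 1.
  have := mX; rewrite -(dvdp_map (ratr : {rmorphism rat -> C})).
  by rewrite rmorphB rmorph1 /= map_polyXn.
have [rs Ers] := closed_field_poly_normal mC.
have mmC : mC \is monic by rewrite map_monic.
rewrite (monicP mmC) scale1r in Ers.
have dC : d%:R != 0 :> C by rewrite pnatr_eq0 -lt0n.
have urs : uniq rs.
  rewrite -separable_prod_XsubC -Ers.
  exact: dvdp_separable mCX (separable_Xn_sub_1 dC).
have hrs w : w \in rs -> w ^+ d = 1.
  rewrite -root_prod_XsubC -Ers -dvdp_XsubCl => h.
  have := dvdp_trans h mCX; rewrite dvdp_XsubCl /root !hornerE subr_eq0.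
  by move/eqP.
have nrs w : w \in rs -> `|w| = 1 by move/hrs => h; exact: norm_unity_root h d0.
have srs : size m = (size rs).+1.
  by rewrite -(size_map_poly (ratr : {rmorphism rat -> C})) -/mC Ers size_prod_XsubC.
have srsK : (size rs <= K)%N by move: sm; rewrite srs.
(* Were [y] small on [x], Cramer's rule would give a rational recurrence with at most [size y]
   coefficients, fewer than the minimal one has. *)
have nosmall (y : {poly C}) (eps : C) : y \is monic -> (size y <= size rs)%N ->
      eps * (K.+1`!%:R * A%:R ^+ K) < 1 ->
      ~ (forall n, `|act y (intr \o x) n| <= eps).
  move=> my sy small hy.
  have sy0 : (0 < size y)%N by rewrite size_poly_gt0 monic_neq0.
  have e0 : 0 <= eps by apply: le_trans (hy 0).
  have [||q [nzq sq hq]] := @small_act_annihilated C d (size y).-1 x y A%:R eps d0 per bndC _ my hy _.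
  - by rewrite prednK.
  - by apply: AK => //; rewrite (leq_trans _ srsK) // (leq_trans _ sy) // leq_pred.
  have := leq_trans (dvdp_leq nzq (mmin _ hq)) sq.
  by rewrite prednK // srs => /leq_trans/(_ sy); rewrite ltnn.
exists rs; split=> //; last by move=> n; rewrite -Ers.
move=> w wrs; split; last first.
  have [n pn _] := prim_order_exists d0 (hrs w wrs).
  exists n; split; last exact: prim_expr_order pn.
  rewrite (prim_order_gt0 pn) /=.
  have tn : (totient n < size m)%N.
    apply: totient_lt_size_rat_poly pn (monic_neq0 mm) _.
    by rewrite -/mC Ers root_prod_XsubC.
  apply: leq_trans (leq_double_sqr_totient n) _.
  by rewrite leq_mul // leq_exp2r // -ltnS (leq_trans tn).
pose y := \prod_(v <- rem w rs) ('X - v%:P).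
have Ey : mC = ('X - w%:P) * y by rewrite Ers (big_rem _ wrs).
pose u := act y (intr \o x : nat -> C).
have hu i : u i.+1 = w * u i.
  by have := hmC i; rewrite Ey actM act_Xsub => /eqP; rewrite subr_eq0 => /eqP.
have pu n : p.[w] * u n = act y (act p (intr \o x)) n.
  by rewrite -(act_geom p n hu) -!actM mulrC.
have sr : size (rem w rs) = (size rs).-1 by rewrite size_rem.
have rs0 : (0 < size rs)%N by case: (rs) wrs.
have bu n : `|p.[w]| * `|u n| <= 2 ^+ K * delta.
  rewrite -normrM pu.
  have := @norm_act_prod_XsubC C (rem w rs) (act p (intr \o x)) delta n _ hp.
  move=> /(_ (fun v h => nrs v (mem_rem h))) /le_trans; apply.
  by rewrite ler_wpM2r // ler_weXn2l ?ler1n // sr (leq_trans (leq_pred _)).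
have eta0 : 0 < eta.
  apply: le_lt_trans hdelta; by rewrite mulr_ge0 // mulr_ge0 ?exprn_ge0 // ?mulr_ge0 ?exprn_ge0.
rewrite real_ltNge ?normr_real ?gtr0_real //; apply/negP => le.
apply: (nosmall y (2 ^+ K * delta / eta)).
- exact: monic_prod_XsubC.
- by rewrite size_prod_XsubC sr prednK.
- rewrite [X in X < 1](_ : _ = delta * (2 ^+ K * (K.+1`!%:R * A%:R ^+ K)) / eta); last by ring.
  by rewrite ltr_pdivrMr // mul1r.
move=> n; rewrite -/(u n) ler_pdivlMr // mulrC.
by apply: le_trans (bu n); rewrite ler_wpM2r.
Qed.

End Periodic.

(* For [c = twoRe w] the roots are [w] and [w^-1]. *)
Definition quad (V : nzRingType) (c : V) : {poly V} := 'X^2 - c%:P * 'X + 1.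

Lemma quadE (V : comNzRingType) (c w : V) : (quad c).[w] = w ^+ 2 - c * w + 1.
Proof. by rewrite /quad !hornerE. Qed.

Definition quads (V : comNzRingType) (l : seq V) : {poly V} := \prod_(c <- l) quad c.

Lemma dvdp_prod_roots (F : fieldType) (rs : seq F) (q : {poly F}) :
  uniq rs -> (forall w, w \in rs -> root q w) -> \prod_(w <- rs) ('X - w%:P) %| q.
Proof.
move=> urs hr; have [||q' ->] := @uniq_roots_prod_XsubC _ q rs.
- by apply/allP.
- by rewrite uniq_rootsE.
exact: dvdp_mulIr.
Qed.

Section Structure.
Variables (C : numClosedFieldType) (A d K : nat) (x : nat -> int) (p : {poly C}).
Variables (delta eta : C) (ts : seq C) (eps : C).
Hypotheses (A0 : (0 < A)%N) (d0 : (0 < d)%N).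
Hypothesis (per : forall n, x (n + d)%N = x n).
Hypothesis (bnd : forall n, (`|x n| <= A)%N).
Hypotheses (mp : p \is monic) (sp : size p = K.+1).
Hypothesis hp : forall n, `|act p (intr \o x) n| <= delta.
Hypothesis hdelta : delta * (2 ^+ K * (K.+1`!%:R * A%:R ^+ K)) < eta.
Hypothesis eta1 : eta <= 1.
Hypothesis hts : forall w n, (0 < n <= 2 * K ^ 2)%N -> w ^+ n = 1 ->
  `|p.[w]| < eta -> twoRe w \in ts.
Let R1 := quads [seq t <- ts | t != 2].
Hypothesis tsp : quads ts %| p.
Hypotheses (eps0 : 0 <= eps) (heps : eps * (K.+1`!%:R * A%:R ^+ K) < 1).

(* The factor 2 = [twoRe 1] is left out of [R1] and 1 is a simple root of the
   minimal recurrence, so only a constant survives [R1 ^+ 2]. *)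
Lemma periodic_structure : (forall n, act p (intr \o x) n = 0) /\
  exists v : C, (forall n, act (R1 ^+ 2) (intr \o x) n = v) /\
    (v = 0 \/ `|R1.[1]| ^+ 2 * eps / 2 ^+ K <= `|v|).
Proof.
have [rs [urs srs hrs ann nosmall]] :=
  periodic_spectrum A0 d0 per bnd mp sp hp hdelta eta1.
have w_ts w : w \in rs -> twoRe w \in ts.
  by case/hrs => lt [n [hn wn]]; apply: hts hn wn lt.
have nrs w : w \in rs -> `|w| = 1.
  by case/hrs => _ [n [/andP[n0 _] wn]]; apply: norm_unity_root wn n0.
have nzw w : w \in rs -> w != 0.
  by move/nrs => h; apply: contra_eq_neq h => ->; rewrite normr0 eq_sym oner_eq0.
have root_quad w : w \in rs -> root (quad (twoRe w)) w.
  by move=> /nzw nz; apply/rootP; rewrite quadE /twoRe; field.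
have root_quads w (l : seq C) : w \in rs -> twoRe w \in l -> root (quads l) w.
  move=> wr wl; rewrite /quads /root (big_rem _ wl) hornerM.
  by have /rootP -> := root_quad w wr; rewrite mul0r.
split=> [n|].
  have /dvdpP[q Ep] : \prod_(w <- rs) ('X - w%:P) %| p.
    apply: dvdp_trans tsp; apply: dvdp_prod_roots => // w wr.
    by apply: root_quads => //; apply: w_ts.
  by rewrite Ep actM act_zero.
have root_R1 w : w \in rs -> w != 1 -> root R1 w.
  move=> wr w1; apply: root_quads => //; rewrite mem_filter w_ts // andbT.
  apply: contra w1 => /eqP h; rewrite -subr_eq0 -sqrf_eq0.
  have -> : (w - 1) ^+ 2 = w * (twoRe w - 2).
    by rewrite /twoRe; field; apply: nzw.
  by rewrite h subrr mulr0.
have [one|none] := boolP (1 \in rs); last first.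
  exists 0; split; last by left.
  move=> n; have /dvdpP[q Ep] : \prod_(w <- rs) ('X - w%:P) %| R1.
    apply: dvdp_prod_roots => // w wr; apply: root_R1 => //.
    by apply: contraNneq none => <-.
  by rewrite expr2 actM act_zero // => i; rewrite Ep actM act_zero.
pose y := \prod_(v <- rem 1 rs) ('X - v%:P).
have mem_r w : w \in rem 1 rs -> w \in rs /\ w != 1.
  by rewrite mem_rem_uniq // inE => /andP[].
have /dvdpP[h Eh] : y %| R1.
  apply: dvdp_prod_roots; first by rewrite rem_uniq.
  by move=> w /mem_r[]; apply: root_R1.
pose u := act y (intr \o x : nat -> C).
have hu i : u i.+1 = 1 * u i.
  have := ann i; rewrite (big_rem _ one) actM act_Xsub => /eqP.
  by rewrite subr_eq0 => /eqP.
have ucst i : u i = u 0%N by elim: i => // i IH; rewrite hu mul1r.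
(* [R1 ^+ 2] is [R1 * h * y]: [y] turns [x] into the constant [u], on which [R1 * h] acts as
   multiplication by its value at 1. *)
exists (R1.[1] * h.[1] * u 0%N); split.
  move=> n; rewrite expr2 {2}Eh mulrA actM -/u (act_geom _ _ hu) hornerM ucst //.
right.
have lo : eps <= `|u 0%N|.
  rewrite real_leNgt ?normr_real ?ger0_real //; apply/negP => lt.
  apply: (nosmall y eps) => //; first exact: monic_prod_XsubC.
    by rewrite size_prod_XsubC size_rem // prednK //; case: (rs) one.
  by move=> n; rewrite -/(u n) ucst ltW.
(* Since [R1.[1] = h.[1] * y.[1]], this upper bound yields a lower bound for [h.[1]] in terms of
   [R1.[1]]. *)
have y1 : `|y.[1]| <= 2 ^+ K.
  rewrite horner_prod normr_prod.
  apply: le_trans (_ : \prod_(v <- rem 1 rs) 2 <= _).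
    rewrite big_seq [X in _ <= X]big_seq; apply: ler_prod => v /mem_r[vr _].
    rewrite normr_ge0 /= hornerXsubC; apply: le_trans (ler_normB _ _) _.
    by rewrite normr1 (nrs _ vr) -[1 + 1]/2.
  rewrite big_const_seq count_predT iter_mulr_1.
  by rewrite ler_weXn2l ?ler1n // size_rem // (leq_trans (leq_pred _)).
rewrite ler_pdivrMr ?exprn_gt0 // !normrM.
apply: le_trans (_ : `|R1.[1]| * `|h.[1]| * `|u 0%N| * `|y.[1]| <= _); last first.
  by rewrite ler_wpM2l // !mulr_ge0.
rewrite [X in _ <= X](_ : _ = `|R1.[1]| * (`|h.[1]| * `|y.[1]|) * `|u 0%N|); last by ring.
by rewrite -normrM -hornerM -Eh -expr2 ler_wpM2l // exprn_ge0.
Qed.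

End Structure.

Section TinyRun.
Variables (C : numClosedFieldType) (A K L : nat) (a : nat -> int) (p : {poly C}).
Variables (delta : C).
Hypothesis (bnd : forall n, (`|a n| <= A)%N).
Hypotheses (mp : p \is monic) (sp : size p = K.+1).
Let T := ((2 * A + 1) ^ K)%N.
Hypothesis hp : forall i, (i < L)%N -> `|act p (intr \o a) i| <= delta.
Hypothesis hdelta : 2 * delta < 1.

Lemma window_repeat : exists i j, (i < j <= T)%N /\
  forall k, (k < K)%N -> a (i + k)%N = a (j + k)%N.
Proof.
have hb n : (absz (a n + A%:Z)%R < (2 * A).+1)%N by have := bnd n; lia.
pose win (n : 'I_T.+1) : {ffun 'I_K -> 'I_(2 * A).+1} :=
  [ffun k : 'I_K => Ordinal (hb (n + k)%N)].
have ninj : ~~ injectiveb win.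
  apply/injectiveP => inj; have := leq_card _ inj.
  by rewrite card_ffun !card_ord /T addn1 ltnn.
have [i [j ne eq]] : exists i, exists2 j, i != j & win i = win j.
  by move/injectivePn: ninj => [i [j ne e]]; exists i, j.
have weq k : (k < K)%N -> a (i + k)%N = a (j + k)%N.
  move=> kK; have := congr1 (fun w : {ffun 'I_K -> 'I_(2 * A).+1} => val (w (Ordinal kK))) eq.
  by rewrite !ffunE /=; have := bnd (i + k); have := bnd (j + k); lia.
case: (ltngtP i j) => h.
- by exists i, j; rewrite h -ltnS ltn_ord.
- by exists j, i; rewrite h -ltnS ltn_ord; split=> // k /weq.
- by rewrite (ord_inj h) eqxx in ne.
Qed.

(** The window repeated by pigeonhole propagates: the recurrence being monic, the terms that follow
    two equal windows differ by at most [2 * delta < 1], and they are integers. *)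
Lemma tiny_run_periodic : exists i0 d, [/\ (0 < d)%N, (i0 + d <= T)%N &
  forall n, (i0 + n + d < L + K)%N -> a (i0 + n + d)%N = a (i0 + n)%N].
Proof.
have [i [j [/andP[ij jT] hw]]] := window_repeat.
exists i, (j - i)%N; split; [by rewrite subn_gt0 | by rewrite subnKC // ltnW |].
set d := (j - i)%N.
elim/ltn_ind => n IH hn.
have [nK|Kn] := ltnP n K.
  by rewrite addnAC /d subnKC 1?ltnW // -hw.
pose e := (n - K)%N; have En : n = (e + K)%N by rewrite /e subnK.
have l1 : (i + e + d < L)%N by lia.
have l2 : (i + e < L)%N by lia.
have := ler_normB (act p (intr \o a) (i + e + d)%N) (act p (intr \o a) (i + e)%N).
move=> /le_trans /(_ (lerD (hp l1) (hp l2))).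
rewrite /act sp -sumrB big_ord_recr /= big1 ?add0r; last first.
  move=> k _; rewrite -mulrBr (_ : i + e + d + k = i + (e + k) + d)%N; last by lia.
  rewrite IH; first by rewrite addnA subrr mulr0.
    by rewrite En ltn_add2l.
  by have := ltn_ord k; lia.
have -> : p`_K = 1 by have := monicP mp; rewrite lead_coefE sp.
rewrite !mul1r -rmorphB /= -intr_norm => h.
have := le_lt_trans h _; rewrite -mulr2n -mulr_natl => /(_ _ hdelta).
rewrite ltrz1 => h0.
have -> : (i + n + d = i + e + d + K)%N by lia.
have -> : (i + n = i + e + K)%N by lia.
move: h0; set z1 := a _; set z2 := a _; lia.
Qed.

End TinyRun.

Lemma size_quad_tail (V : nzRingType) (c : V) :
  (size (- (c%:P * 'X) + 1)%R < size ('X^2 : {poly V}))%N.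
Proof.
rewrite size_polyXn; apply: leq_ltn_trans (size_polyD _ _) _.
rewrite gtn_max size_poly1 andbT size_polyN mul_polyC.
by apply: leq_ltn_trans (size_scale_leq _ _) _; rewrite size_polyX.
Qed.

Lemma quad_monic (V : nzRingType) (c : V) : quad c \is monic.
Proof.
by rewrite monicE /quad -addrA lead_coefDl ?lead_coefXn // size_quad_tail.
Qed.

Lemma size_quad (V : nzRingType) (c : V) : size (quad c) = 3%N.
Proof.
by rewrite /quad -addrA size_polyDl ?size_quad_tail // size_polyXn.
Qed.

Lemma quads_monic (V : comNzRingType) (l : seq V) : quads l \is monic.
Proof. by apply: monic_prod => c _; apply: quad_monic. Qed.

Lemma size_quads (V : idomainType) (l : seq V) : size (quads l) = (2 * size l).+1.
Proof.
rewrite /quads; elim: l => [|c l IH]; first by rewrite big_nil size_poly1.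
rewrite big_cons size_monicM ?quad_monic //.
  by rewrite size_quad IH mulnS.
exact/monic_neq0/quads_monic.
Qed.

Lemma norm_quads (C : numFieldType) (l : seq C) (w : C) : `|w| = 1 ->
  `|(quads l).[w]| = \prod_(c <- l) `|twoRe w - c|.
Proof.
move=> nw; have w0 : w != 0.
  by apply: contra_eq_neq nw => ->; rewrite normr0 eq_sym oner_eq0.
rewrite horner_prod normr_prod; apply: eq_bigr => c _.
have -> : (quad c).[w] = w * (twoRe w - c) by rewrite quadE /twoRe; field.
by rewrite normrM nw mul1r.
Qed.

Lemma prod_lower (R : numDomainType) (I : eqType) (l : seq I) (F : I -> R) (e : R) k :
  0 <= e -> e <= 1 -> (size l <= k)%N -> (forall i, i \in l -> e <= F i) ->
  e ^+ k <= \prod_(i <- l) F i.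
Proof.
move=> e0 e1 sk h; apply: le_trans (_ : e ^+ size l <= _).
  exact: ler_wiXn2l.
elim: l h {sk} => [|i l IH] h; first by rewrite big_nil.
rewrite big_cons exprS ler_pM ?exprn_ge0 ?h ?mem_head //.
by apply: IH => j jl; apply: h; rewrite inE jl orbT.
Qed.

Lemma twoRe_real (C : numClosedFieldType) (w : C) : `|w| = 1 -> twoRe w \is Num.real.
Proof.
move=> nw; rewrite CrealE /twoRe rmorphD /= invC_norm nw expr1n invr1 mul1r.
by rewrite conjCK addrC.
Qed.

(** * Roots of unity close to the sign changes, and the structure of tiny runs *)

Section RootsOfUnity.
Variable C : numClosedFieldType.

Lemma low_order_twoRe (N : nat) : exists U : seq C, uniq U /\
  forall t, t \in U <-> exists w n, [/\ (0 < n <= N)%N, w ^+ n = 1 & t = twoRe w].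
Proof.
have [rs Ers] := closed_field_poly_normal (\prod_(n < N) ('X^(n.+1) - 1) : {poly C}).
have mP : (\prod_(n < N) ('X^(n.+1) - 1) : {poly C}) \is monic.
  by apply: monic_prod => n _; apply: monicXnsubC.
exists (undup [seq twoRe w | w <- rs]); split; first exact: undup_uniq.
have mem_rs w : (w \in rs) = [exists n : 'I_N, w ^+ n.+1 == 1].
  rewrite -root_prod_XsubC; have := Ers; rewrite (monicP mP) scale1r => <-.
  rewrite /root horner_prod prodf_seq_eq0; apply/hasP/existsP.
    by move=> [n _ /=]; rewrite !hornerE subr_eq0; exists n.
  by move=> [n hn]; exists n; rewrite ?mem_index_enum //= !hornerE subr_eq0.
move=> t; rewrite mem_undup; split.
  move=> /mapP[w]; rewrite mem_rs => /existsP[n /eqP wn] ->.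
  by exists w, n.+1; rewrite ltn_ord.
move=> [w [n [/andP[n0 nN] wn ->]]]; apply/mapP; exists w => //.
rewrite mem_rs; apply/existsP; have lt : (n.-1 < N)%N by rewrite prednK.
by exists (Ordinal lt); rewrite /= prednK // wn.
Qed.

End RootsOfUnity.

(* The operators below have order at most 6 k: there are k sign changes and at most
   k companions, doubled, each giving a quadratic factor. The orders of the roots
   of unity are then at most 2 (6 k) ^ 2, and [2 * rho] is their separation. *)
Definition ord_bound (k : nat) := (72 * k ^ 2).+1.
Definition rho (F : fieldType) (k : nat) : F := (2 * ord_bound k ^ 4)%:R^-1.
(** Dominates, for all orders up to [6 * k], the Cramer factor together with the power of 2 lost
    when linear factors of the spectrum act on a bounded sequence. *)
Definition cramer_const (k A : nat) : nat :=
  (2 ^ (6 * k) * ((6 * k).+1`! * A ^ (6 * k)))%N.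
(** Counts the windows of length [6 * k] with entries between [-A] and [A]: the delay before
    pigeonhole must produce a period. *)
Definition run_length (k A : nat) : nat := ((2 * A + 1) ^ (6 * k))%N.
(** The lower bound of [periodic_structure], with [rho ^+ k] for [R1.[1]], the inverse of
    [2 * cramer_const] for [eps], and [cramer_const] once more in place of [2 ^+ K]. *)
Definition gap_const (F : fieldType) (k A : nat) : F :=
  rho F k ^+ (2 * k) / (2 * cramer_const k A ^ 2)%:R.

Section Runs.
Variables (C : numClosedFieldType) (cs : seq C) (A : nat) (delta : C).
Let k := size cs.
Hypothesis A0 : (0 < A)%N.
Hypothesis hdelta : delta * (cramer_const k A)%:R < rho C k ^+ (3 * k).
Hypothesis hdelta2 : 2 * delta < 1.

Let rho0 : 0 < rho C k.
Proof. by rewrite invr_gt0 ltr0n muln_gt0 expn_gt0. Qed.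
Let rho1 : rho C k <= 1.
Proof. by rewrite invf_le1 ?ler1n ?ltr0n // muln_gt0 expn_gt0. Qed.

(** [ts] consists of the numbers [twoRe w], [w] of order at most [ord_bound k], within [rho] of some
    sign change. Two of them are at least [2 * rho] apart, so each sign change is close to at most
    one, whence [size ts <= k]. If [twoRe w] is not among them, all factors of the operator at [w]
    are at least [rho], so [w] cannot belong to the spectrum of a tiny run. *)
Lemma tiny_runs : exists ts : seq C, [/\ uniq ts, (size ts <= k)%N,
   forall t, t \in ts -> exists w, `|w| = 1 /\ t = twoRe w,
   rho C k ^+ k <= `|(quads [seq t <- ts | t != 2]).[1]| &
   forall (a : nat -> int) L, (forall n, (`|a n| <= A)%N) ->
     (forall i, (i < L)%N -> `|act (quads cs * quads ts ^+ 2) (intr \o a) i| <= delta) ->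
     exists v : C, (v = 0 \/ gap_const C k A <= `|v|) /\
       forall i, (run_length k A <= i < L)%N ->
         act (quads cs * quads ts ^+ 2) (intr \o a) i = 0 /\
         act (quads [seq t <- ts | t != 2] ^+ 2) (intr \o a) i = v].
Proof.
have [U [uU memU]] := low_order_twoRe C (ord_bound k).
pose near (t c : C) := `|t - c| < rho C k.
pose ts := [seq t <- U | has (near t) cs].
have sep (t t' : C) : t \in U -> t' \in U -> t != t' -> 2 * rho C k <= `|t - t'|.
  move=> /memU[w [n [/andP[n0 hn] wn ->]]] /memU[w' [n' [/andP[n0' hn'] wn' ->]]] ne.
  have := twoRe_sep wn wn' n0 n0' ne => h.
  rewrite /rho natrM invfM mulrA divff ?mul1r ?pnatr_eq0 // -[X in X <= _]mulr1 ler_pdivrMl ?ltr0n ?expn_gt0 //.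
  apply: le_trans h _; rewrite ler_wpM2r // ler_nat -[4%N]/(2 * 2)%N expnM leq_exp2r //.
  by rewrite expnS expn1 leq_mul.
have uts : uniq ts by apply: filter_uniq.
have tsU t : t \in ts -> t \in U by rewrite mem_filter => /andP[].
have sts : (size ts <= k)%N.
  pose f t := nth 0 cs (find (near t) cs).
  rewrite -(size_map f ts); apply: uniq_leq_size.
    rewrite map_inj_in_uniq // => t t' ht ht' e.
    apply/eqP/negP => /negP ne.
    have := sep t t' (tsU _ ht) (tsU _ ht') ne.
    have n1 : near t (f t) by apply: nth_find; move: ht; rewrite mem_filter => /andP[].
    have n2 : near t' (f t') by apply: nth_find; move: ht'; rewrite mem_filter => /andP[].
    rewrite real_leNgt ?normr_real ?gtr0_real ?mulr_gt0 // => /negP; apply.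
    rewrite (_ : t - t' = (t - f t) - (t' - f t')); last by rewrite e; ring.
    apply: le_lt_trans (ler_normB _ _) _.
    by rewrite mulr_natl mulr2n; apply: ltrD.
  move=> c /mapP[t ht ->]; apply: mem_nth; rewrite -has_find.
  by move: ht; rewrite mem_filter => /andP[].
have one_U : 2 \in U.
  apply/memU; exists 1, 1%N; rewrite expr1n /twoRe invr1; split=> //.
have R1lo : rho C k ^+ k <= `|(quads [seq t <- ts | t != 2]).[1]|.
  rewrite norm_quads ?normr1 //; apply: prod_lower => //; first exact: ltW.
    by rewrite size_filter (leq_trans (count_size _ _)).
  move=> t; rewrite mem_filter => /andP[t2 /tsU tU].
  have -> : twoRe 1 = 2 :> C by rewrite /twoRe invr1.
  apply: le_trans (sep 2 t _ tU _) => //; last by rewrite eq_sym.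
  by rewrite ler_peMl ?ler1n // ltW.
exists ts; split=> //.
- move=> t /tsU /memU[w [n [/andP[n0 _] wn ->]]]; exists w; split=> //.
  exact: norm_unity_root wn n0.
pose p := quads cs * quads ts ^+ 2.
have [K EK] : exists K, K = (2 * k + 4 * size ts)%N by exists (2 * k + 4 * size ts)%N.
have mp : p \is monic by rewrite monicMl ?quads_monic // monic_exp ?quads_monic.
have sp : size p = K.+1.
  have nzt := monic_neq0 (quads_monic ts).
  rewrite /p size_monicM ?quads_monic ?expf_neq0 // expr2 size_monicM ?quads_monic //.
  rewrite !size_quads EK /k -/(size cs) -/(size ts) !addSn !addnS /=; congr _.+1; rewrite -mulnDr -?mulnDl; lia.
have K6 : (K <= 6 * k)%N by rewrite EK; clear -sts; lia.
move=> a L bnd tiny.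
have d0 : (0 < L)%N -> 0 <= delta.
  by move=> /tiny; apply: le_trans.
have Tle : ((2 * A + 1) ^ K <= run_length k A)%N by rewrite leq_pexp2l ?addn1.
have [LT|TL] := leqP L ((2 * A + 1) ^ K)%N.
  exists 0; split; first by left.
  by move=> i /andP[h1 h2]; have := leq_ltn_trans h1 (leq_trans h2 (leq_trans LT Tle)); rewrite ltnn.
have L0 : (0 < L)%N by apply: leq_trans TL.
have {}d0 := d0 L0.
have [i0 [d [dpos id hper]]] := tiny_run_periodic bnd mp sp tiny hdelta2.
pose x n := a (i0 + n %% d)%N.
have xa n : (i0 + n < L + K)%N -> x n = a (i0 + n)%N.
  elim/ltn_ind: n => n IH hn; rewrite /x.
  have [nd|nd] := ltnP n d; first by rewrite modn_small.
  have En : n = (n - d + d)%N by rewrite subnK.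
  rewrite En modnDr -/(x (n - d)%N) IH.
  - by rewrite addnA hper //; clear -hn En; lia.
  - by clear -dpos nd; lia.
  - by clear -hn En dpos nd; lia.
have xper n : x (n + d)%N = x n by rewrite /x modnDr.
have actx (q : {poly C}) n : (size q <= K.+1)%N -> (i0 + n < L)%N ->
    act q (intr \o x) n = act q (intr \o a) (i0 + n)%N.
  move=> sq hn; apply: eq_bigr => j _ /=; rewrite xa ?addnA //.
  by have h := leq_trans (ltn_ord j) sq; rewrite -addSn leq_add.
have hx n : `|act p (intr \o x) n| <= delta.
  have -> : act p (intr \o x) n = act p (intr \o x) (n %% d)%N.
    by apply: eq_bigr => j _; rewrite /= /x -[((n %% d) + j)%N]addnC -[(n + j)%N]addnC modnDmr.
  have lt : (n %% d < d)%N by rewrite ltn_mod.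
  have lt2 : (i0 + n %% d < L)%N.
    by apply: leq_trans (leq_trans id (ltnW TL)); rewrite ltn_add2l.
  by rewrite actx ?sp // tiny.
have crK : ((K.+1)`! * A ^ K <= (6 * k).+1`! * A ^ (6 * k))%N.
  by rewrite leq_mul ?leq_pexp2l // leq_fact.
have hd : delta * (2 ^+ K * (K.+1`!%:R * A%:R ^+ K)) < rho C k ^+ (3 * k).
  apply: le_lt_trans hdelta; rewrite ler_wpM2l // -!natrX -!natrM ler_nat.
  by rewrite leq_mul // leq_pexp2l.
have eta1 : rho C k ^+ (3 * k) <= 1 by rewrite exprn_ile1 // ltW.
pose eps : C := ((2 * cramer_const k A)%:R)^-1.
have cr0 : (0 < cramer_const k A)%N by rewrite !muln_gt0 fact_gt0 !expn_gt0 A0.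
have eps0 : 0 <= eps by rewrite invr_ge0.
have heps : eps * (K.+1`!%:R * A%:R ^+ K) < 1.
  have c2 : (0 < 2 * cramer_const k A)%N by rewrite muln_gt0 cr0.
  rewrite /eps ltr_pdivrMl ?ltr0n // mulr1 -natrX -natrM ltr_nat.
  apply: leq_ltn_trans crK _; rewrite /cramer_const.
  set B := (_ * A ^ _)%N; have B0 : (0 < B)%N by rewrite muln_gt0 fact_gt0 expn_gt0 A0.
  by rewrite -{1}[B]mul1n mulnA ltn_pmul2r // -expnS -{1}(expn0 2) ltn_exp2l.
have hts w n : (0 < n <= 2 * K ^ 2)%N -> w ^+ n = 1 ->
    `|p.[w]| < rho C k ^+ (3 * k) -> twoRe w \in ts.
  move=> /andP[n0 hn] wn.
  have tU : twoRe w \in U.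
    apply/memU; exists w, n; split=> //; rewrite n0 (leq_trans hn) // /ord_bound.
    apply: leq_trans (leqnSn _); rewrite (_ : 72 = 2 * 6 ^ 2)%N // -mulnA -expnMn.
    by rewrite leq_mul // leq_exp2r.
  apply: contraTT => nt.
  have nw := norm_unity_root wn n0.
  rewrite -real_leNgt ?normr_real ?realX ?gtr0_real //.
  (* One factor [rho] for each element of [cs] and two for each element of [ts]. *)
  have e3 : (3 * k)%N = (k + k * 2)%N by clear; lia.
  rewrite e3 /p hornerM horner_exp normrM normrX !(norm_quads _ nw).
  rewrite exprD exprM ler_pM //; [exact/exprn_ge0/ltW|exact/exprn_ge0/exprn_ge0/ltW| |].
    apply: prod_lower => // [|c cc]; first exact: ltW.
    rewrite real_leNgt ?normr_real ?gtr0_real //; apply: contra nt => lt.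
    by rewrite mem_filter tU andbT; apply/hasP; exists c.
  apply: lerXn2r; rewrite ?nnegrE; [exact/exprn_ge0/ltW | by apply: prodr_ge0 |].
  apply: prod_lower => // [|t tt]; first exact: ltW.
  have ne : twoRe w != t by apply: contraNneq nt => ->.
  apply: le_trans (sep _ t tU (tsU _ tt) ne).
  by rewrite ler_peMl ?ler1n // ltW.
have ptsd : quads ts %| p by rewrite /p expr2 mulrA dvdp_mulIr.
have bx n : (`|x n| <= A)%N by rewrite /x.
have [p0 [v [hv gap]]] := periodic_structure A0 dpos xper bx mp sp hx hd eta1 hts ptsd eps0 heps.
exists v; split; last first.
  move=> i /andP[Ti iL].
  have i0i : (i0 <= i)%N.
    by apply: leq_trans Ti; apply: leq_trans Tle; apply: leq_trans id; rewrite leq_addr.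
  have lt : (i0 + (i - i0) < L)%N by rewrite subnKC.
  rewrite -(subnKC i0i).
  rewrite -actx ?sp // -actx ?p0 ?hv //.
  rewrite expr2 size_monicM ?quads_monic ?monic_neq0 ?quads_monic // !size_quads.
  have := count_size (fun t => t != 2) ts; rewrite -size_filter EK.
  by move: (size [seq _ <- ts | _]) (size ts) => m1 m2; clear; lia.
case: gap => [->|gap]; [by left | right; apply: le_trans gap].
rewrite /gap_const /eps (_ : (2 * cramer_const k A ^ 2)%N = (2 * cramer_const k A) * cramer_const k A)%N; last by rewrite expnS expn1 mulnA.
rewrite natrM invfM mulrA; apply: ler_pM.
- by apply: mulr_ge0; [exact/exprn_ge0/ltW | rewrite invr_ge0].
- by rewrite invr_ge0.
- rewrite ler_wpM2r ?invr_ge0 // mulnC exprM; apply: lerXn2r R1lo; rewrite nnegrE //; exact/exprn_ge0/ltW.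
rewrite lef_pV2 ?posrE ?exprn_gt0 ?ltr0n // -natrX ler_nat.
apply: leq_trans (_ : 2 ^ (6 * k) <= _)%N; first by rewrite leq_pexp2l.
by rewrite leq_pmulr // muln_gt0 fact_gt0 expn_gt0 A0.
Qed.

End Runs.

(** * Trigonometric polynomials with coefficients indexed by integers *)

Section IntSum.
Variable V : zmodType.
Implicit Types (h : int -> V) (N : nat).

(** Sums over [Z], truncated at an explicit [N] that may grow as the operators widen the support. *)
Definition isum N h := \sum_(i < (2 * N).+1) h (i%:Z - N%:Z).
Definition supp N h := forall n : int, (N < `|n|)%N -> h n = 0.

Lemma isumS N h : isum N.+1 h = isum N h + (h N.+1%:Z + h (- N.+1%:Z)).
Proof.
rewrite /isum mulnS addnC addn2 big_ord_recl big_ord_recr /= /bump /=.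
rewrite [LHS]addrC -addrA; congr (_ + _).
  by apply: eq_bigr => i _; congr h; lia.
by congr (h _ + h _); rewrite /bump /=; lia.
Qed.

Lemma isum_widen N N' h : (N <= N')%N -> supp N h -> isum N' h = isum N h.
Proof.
move=> NN sh; rewrite -(subnK NN); elim: (_ - _)%N => // k IH.
by rewrite addSn isumS IH !sh ?addr0 //; lia.
Qed.

Lemma eq_isum N h h' : h =1 h' -> isum N h = isum N h'.
Proof. by move=> e; apply: eq_bigr => i _. Qed.

Lemma isum_succ N h : isum N (fun n => h (n + 1)) = isum N h + (h (N%:Z + 1) - h (- N%:Z)).
Proof.
apply/eqP; rewrite addrC -subr_eq -sumrB; apply/eqP.
rewrite -(big_mkord xpredT (fun i => h (i%:Z - N%:Z + 1) - h (i%:Z - N%:Z))).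
rewrite (eq_bigr (fun i => h (i.+1%:Z - N%:Z) - h (i%:Z - N%:Z))); last first.
  by move=> i _; congr (h _ - _); lia.
rewrite (telescope_sumr (fun i : nat => h (i%:Z - N%:Z))) //.
by congr (h _ - h _); lia.
Qed.

Lemma isum_succ_supp N h : supp N h -> isum N.+1 (fun n => h (n + 1)) = isum N h.
Proof.
move=> sh; rewrite isum_succ (isum_widen (leqnSn N) sh) !sh ?subr0 ?addr0 //; lia.
Qed.

Lemma isum_pred_supp N h : supp N h -> isum N.+1 (fun n => h (n - 1)) = isum N h.
Proof.
move=> sh; have := isum_succ N.+1 (fun n => h (n - 1)).
rewrite (@sh (N.+1%:Z + 1 - 1)); last by lia.
rewrite (@sh (- N.+1%:Z - 1)); last by lia.
rewrite subr0 addr0 => <-; rewrite -(isum_widen (leqnSn N) sh).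
by apply: eq_isum => n; rewrite addrK.
Qed.

Lemma isumD N h h' : isum N (fun n => h n + h' n) = isum N h + isum N h'.
Proof. exact: big_split. Qed.

Lemma isumB N h h' : isum N (fun n => h n - h' n) = isum N h - isum N h'.
Proof. exact: sumrB. Qed.

End IntSum.

Section Trig.
Variable R : realType.
Implicit Types (x : int -> R) (t : R) (N : nat).

Definition tp N x t : R := isum N (fun n => x n * cos (n%:~R * t)).

Lemma supp_cos N x t : supp N x -> supp N (fun n => x n * cos (n%:~R * t)).
Proof. by move=> sx n /sx ->; rewrite mul0r. Qed.

Lemma tp_widen N N' x t : (N <= N')%N -> supp N x -> tp N' x t = tp N x t.
Proof. by move=> NN /(supp_cos t)/isum_widen; apply. Qed.

Definition nbsum x (n : int) : R := x (n + 1) + x (n - 1).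

Lemma supp_nbsum N x : supp N x -> supp N.+1 (nbsum x).
Proof. by move=> sx n hn; rewrite /nbsum !sx ?addr0 //; lia. Qed.

Lemma tp_nbsum N x t : supp N x -> tp N.+1 (nbsum x) t = 2 * cos t * tp N x t.
Proof.
move=> sx; have sc := supp_cos t sx.
have s1 : supp N (fun n => x n * cos ((n - 1)%:~R * t)).
  by move=> n /sx ->; rewrite mul0r.
have s2 : supp N (fun n => x n * cos ((n + 1)%:~R * t)).
  by move=> n /sx ->; rewrite mul0r.
rewrite /tp (eq_isum N.+1 (h' := fun n => x (n + 1) * cos ((n + 1 - 1)%:~R * t)
   + x (n - 1) * cos ((n - 1 + 1)%:~R * t))); last first.
  by move=> n; rewrite /nbsum mulrDl addrK subrK.
rewrite isumD (isum_succ_supp s1) (isum_pred_supp s2) -isumD /isum mulr_sumr.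
apply: eq_bigr => i _; rewrite -mulrDr mulrCA; congr (_ * _).
move: (i%:Z - N%:Z) => n.
have -> : (n - 1)%:~R * t = n%:~R * t - t by rewrite rmorphB rmorph1 mulrBl mul1r.
have -> : (n + 1)%:~R * t = n%:~R * t + t by rewrite rmorphD rmorph1 mulrDl mul1r.
by rewrite cosB cosD; ring.
Qed.

(* Averages over [M] equidistant points replace integrals over a period; they
   agree in degree less than [M]. *)
Definition grid M (j : nat) : R := 2 * pi * j%:R / M%:R.
Definition avg M (g : R -> R) : R := M%:R^-1 * \sum_(j < M) g (grid M j).

Lemma sin2pin (x : R) (k : nat) : sin (2 * pi * k%:R - x) = - sin x.
Proof.
elim: k => [|k IH]; first by rewrite mulr0 sub0r sinN.
have -> : 2 * pi * k.+1%:R - x = (2 * pi * k%:R - x) + pi *+ 2.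
  by rewrite -natr1 mulr2n; ring.
by rewrite sinD2pi.
Qed.

Lemma avg_cos_nat M (k : nat) : (0 < k < M)%N -> avg M (fun t => cos (k%:R * t)) = 0.
Proof.
case/andP => k0 kM; have M0 : (0 < M)%N by apply: leq_trans kM.
rewrite /avg; apply/eqP; rewrite mulf_eq0; apply/orP; right.
have MR : (M%:R : R) != 0 by rewrite pnatr_eq0 -lt0n.
pose th : R := pi * k%:R / M%:R.
have s0 : 0 < sin th.
  apply: sin_gt0_pi; rewrite divr_gt0 ?mulr_gt0 ?pi_gt0 ?ltr0n //=.
  by rewrite ltr_pdivrMr ?ltr0n // ltr_pM2l ?pi_gt0 // ltr_nat.
(* [th] is half the angular step, so [2 * sin th] turns each cosine into a difference of sines. The
   sum telescopes between arguments that are [k] full turns apart. *)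
suff : 2 * sin th * \sum_(j < M) cos (k%:R * grid M j) == 0.
  by rewrite mulf_eq0 mulf_eq0 (gt_eqF s0) pnatr_eq0.
rewrite mulr_sumr.
pose G (j : nat) : R := sin (2 * th * j%:R - th).
rewrite (eq_bigr (fun j : 'I_M => G j.+1 - G j)); last first.
  move=> j _; rewrite /G.
  have -> : 2 * th * j.+1%:R - th = 2 * th * j%:R + th by rewrite -natr1; ring.
  have -> : k%:R * grid M j = 2 * th * j%:R by rewrite /grid /th; field.
  by rewrite sinD sinB; ring.
rewrite -(big_mkord xpredT (fun j => G j.+1 - G j)) telescope_sumr // /G mulr0 sub0r.
have -> : 2 * th * M%:R = 2 * pi * k%:R by rewrite /th; field.
by rewrite sin2pin sinN subrr.
Qed.

Lemma avg_cst M (c : R) : (0 < M)%N -> avg M (fun=> c) = c.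
Proof.
by move=> M0; rewrite /avg sumr_const card_ord -[c *+ _]mulr_natl mulKf // pnatr_eq0 -lt0n.
Qed.

Lemma eq_avg M (g g' : R -> R) : g =1 g' -> avg M g = avg M g'.
Proof. by move=> e; rewrite /avg; congr (_ * _); apply: eq_bigr => i _; rewrite e. Qed.

Lemma avgD M (g g' : R -> R) : avg M (fun t => g t + g' t) = avg M g + avg M g'.
Proof. by rewrite /avg big_split mulrDr. Qed.

Lemma avgZ M (c : R) g : avg M (fun t => c * g t) = c * avg M g.
Proof. by rewrite /avg -mulr_sumr mulrCA. Qed.

Lemma avgB M (g g' : R -> R) : avg M (fun t => g t - g' t) = avg M g - avg M g'.
Proof. by rewrite /avg sumrB mulrBr. Qed.

Lemma ler_avg M (g g' : R -> R) : (forall t, g t <= g' t) -> avg M g <= avg M g'.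
Proof.
by move=> h; rewrite /avg ler_wpM2l ?invr_ge0 //; apply: ler_sum => i _; apply: h.
Qed.

Lemma avg_sum M n (g : 'I_n -> R -> R) :
  avg M (fun t => \sum_(i < n) g i t) = \sum_(i < n) avg M (g i).
Proof. by rewrite /avg exchange_big mulr_sumr. Qed.

Lemma avg_cos_int M (k : int) : (`|k| < M)%N ->
  avg M (fun t => cos (k%:~R * t)) = (k == 0)%:R.
Proof.
move=> kM; have M0 : (0 < M)%N by apply: leq_ltn_trans kM.
have [->|k0] := eqVneq k 0.
  by under eq_avg do rewrite mul0r cos0; rewrite avg_cst.
rewrite -[RHS](@avg_cos_nat M `|k|%N); last by rewrite kM absz_gt0 k0.
apply: eq_avg => t; rewrite -[in LHS]cos_norm -[in RHS]cos_norm !normrM normr_nat.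
by rewrite -intr_norm -abszE.
Qed.

Lemma avg_cos_cos M (n m : int) : (`|n| + `|m| < M)%N ->
  avg M (fun t => cos (n%:~R * t) * cos (m%:~R * t)) =
  ((n == m)%:R + (n == - m)%:R) / 2.
Proof.
move=> h; under eq_avg => t.
  have -> : cos (n%:~R * t) * cos (m%:~R * t) =
    2^-1 * (cos ((n - m)%:~R * t) + cos ((n + m)%:~R * t)).
    have -> : (n - m)%:~R * t = n%:~R * t - m%:~R * t by rewrite rmorphB mulrBl.
    have -> : (n + m)%:~R * t = n%:~R * t + m%:~R * t by rewrite rmorphD mulrDl.
    by rewrite cosB cosD; field.
  over.
rewrite avgZ avgD !avg_cos_int; [|lia|lia].
by rewrite subr_eq0 addr_eq0 mulrC.
Qed.

Lemma avg_tp_cos M N x (m : int) : supp N x -> (forall n, x (- n) = x n) ->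
  (N + `|m| < M)%N -> avg M (fun t => tp N x t * cos (m%:~R * t)) = x m.
Proof.
move=> sx ev hM.
under eq_avg do rewrite mulr_suml.
rewrite avg_sum (eq_bigr (fun i : 'I_(2 * N).+1 => let n := i%:Z - N%:Z in
   (if n == m then x m else 0) / 2 + (if n == - m then x m else 0) / 2)); last first.
  move=> i _ /=; set n := _ - _.
  under eq_avg do rewrite -mulrA.
  rewrite avgZ avg_cos_cos; last by rewrite /n; have := ltn_ord i; lia.
  have e1 : n = m -> x n = x m by move=> ->.
  have e2 : n = - m -> x n = x m by move=> ->; rewrite ev.
  case: eqP => [/e1->|_]; case: eqP => [/e2 e|_] //=; first by field.
  - by field.
  - by rewrite e; field.
  - by field.
rewrite -/(isum N (fun n => (if n == m then x m else 0) / 2 + (if n == - m then x m else 0) / 2)).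
have one k : (`|k| = `|m|)%N -> isum N (fun n => (if n == k then x m else 0) / 2) = x m / 2.
  move=> ek; have [km|km] := leqP `|k| N; last first.
    by rewrite sx ?mul0r -?ek // /isum big1 // => i _; case: eqP; rewrite mul0r.
  have lt : (absz (k + N%:Z)%R < (2 * N).+1)%N by lia.
  rewrite /isum (bigD1 (Ordinal lt)) //= big1 ?addr0.
    by rewrite ifT //; lia.
  move=> i; rewrite -val_eqE /= => ne; rewrite ifF ?mul0r //; lia.
by rewrite isumD !one ?abszN //; field.
Qed.

Lemma avg_tp M N x : supp N x -> (forall n, x (- n) = x n) -> (N < M)%N ->
  avg M (tp N x) = x 0.
Proof.
move=> sx ev h; rewrite -(@avg_tp_cos M N x 0) ?addn0 //.
by apply: eq_avg => t; rewrite mul0r cos0 mulr1.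
Qed.

End Trig.

(** * The Davenport-Cohen bound *)

Section Selection.
Implicit Types (Y B : seq int).

Lemma count_sub_mem Y B (y : int) : uniq Y ->
  (count (fun y' => (y - y' : int) \in B) Y <= size B)%N.
Proof.
move=> uY; rewrite -size_filter -(size_map (fun y' => y - y')).
apply: uniq_leq_size.
  by rewrite map_inj_uniq ?filter_uniq // => u v /addrI /oppr_inj.
by move=> d /mapP[y']; rewrite mem_filter => /andP[h _] ->.
Qed.

(** Greedy choice: keep the head and discard the later elements whose difference to it lies in [B];
    each round discards at most [size B] of them. *)
Lemma select_differences Y B r : pairwise >%R Y -> (r * (size B).+1 <= size Y)%N ->
  exists qs, [/\ size qs = r, {subset qs <= Y} &
    pairwise (fun q q' => (q > q') && ((q - q' : int) \notin B)) qs].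
Proof.
elim: r Y => [|r IH] Y pY sY; first by exists [::].
case: Y pY sY => [|y Y] /=; first by rewrite leqn0 muln_eq0.
move=> /andP[aY pY] sY.
have uY : uniq Y.
  apply: (@pairwise_uniq _ >%R) => //; exact: ltxx.
pose Y' := [seq y' <- Y | (y - y' : int) \notin B].
have [||qs [sq subq pq]] := IH Y'.
- by apply: pairwise_filter.
- have := count_sub_mem B y uY; have := count_predC (fun y' => (y - y' : int) \in B) Y.
  rewrite -[count (predC _) _]size_filter -/Y'; move: sY; rewrite mulSn.
  move: (count _ _) (size Y') (size Y) (size B) (r * _)%N => a b c d e; lia.
exists (y :: qs); split; first by rewrite /= sq.
  move=> z; rewrite !inE => /orP[->//|/subq]; rewrite mem_filter => /andP[_ ->].
  by rewrite orbT.
rewrite /= pq andbT; apply/allP => q /subq; rewrite mem_filter => /andP[-> qY].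
by rewrite andbT; exact: (allP aY _ qY).
Qed.

End Selection.

Section Step.
Variable C : numClosedFieldType.

(** Half of the cross terms in the squared modulus of the sum. With one of two conjugate halves
    only, all frequency differences are positive, and on that side [b] can be made to vanish. *)
Fixpoint upper_sum (zs : seq C) : C :=
  if zs is z :: zs' then z * (\sum_(w <- zs') w)^* + upper_sum zs' else 0.

Lemma normC_sum_upper (zs : seq C) : (forall z, z \in zs -> `|z| = 1) ->
  `|\sum_(z <- zs) z| ^+ 2 = (size zs)%:R + upper_sum zs + (upper_sum zs)^*.
Proof.
elim: zs => [|z zs IH] h; first by rewrite big_nil normr0 expr0n /= conjC0 !addr0.
rewrite big_cons /= normCK !rmorphD /= rmorphM /= conjCK -natr1.
have hl w (hw : w \in zs) : `|w| = 1 by apply: h; rewrite inE hw orbT.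
have := IH hl.
rewrite normCK => e.
have nz : z * z^* = 1 by rewrite -normCK h ?mem_head // expr1n.
set S := \sum_(w <- zs) w in e *; set U := upper_sum zs in e *.
have -> : (z + S) * (z^* + S^*) = z * z^* + S * S^* + z * S^* + z^* * S by ring.
by rewrite nz e; ring.
Qed.

Lemma norm_upper_sum (zs : seq C) : (forall z, z \in zs -> `|z| = 1) ->
  `|(size zs)%:R + 2 * upper_sum zs| <= (size zs)%:R ^+ 2.
Proof.
have ns (l : seq C) : (forall z, z \in l -> `|z| = 1) -> `|\sum_(z <- l) z| <= (size l)%:R.
  elim: l => [|z l IH] h; first by rewrite big_nil normr0.
  rewrite big_cons -natr1 addrC; apply: le_trans (ler_normD _ _) _.
  rewrite (h z) ?mem_head // lerD2r IH // => w wl.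
  by apply: h; rewrite inE wl orbT.
have nu (l : seq C) : (forall z, z \in l -> `|z| = 1) ->
    2 * `|upper_sum l| <= (size l)%:R ^+ 2 - (size l)%:R.
  elim: l => [|z l IH] h; first by rewrite normr0 /= expr0n subr0 mulr0.
  have hl w (wl : w \in l) : `|w| = 1 by apply: h; rewrite inE wl orbT.
  rewrite /= -[(size l).+1%:R]natr1; set m : C := (size l)%:R.
  have -> : (m + 1) ^+ 2 - (m + 1) = 2 * m + (m ^+ 2 - m) by ring.
  apply: le_trans (_ : 2 * (`|z * (\sum_(w <- l) w)^*| + `|upper_sum l|) <= _).
    by rewrite ler_wpM2l // ler_normD.
  rewrite mulrDr lerD ?IH // ler_wpM2l // normrM norm_conjC (h z) ?mem_head // mul1r.
  exact: ns.
move=> h; apply: le_trans (ler_normD _ _) _; rewrite normr_nat normrM normr_nat.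
by rewrite addrC -lerBrDr nu.
Qed.

(* [(r0 ^ 2)%:R + 2 * upper_sum zs] agrees up to an imaginary number with the
   squared modulus of the sum of [zs]. *)
Lemma davenport_step (zs : seq C) (phi : C) (r0 : nat) : (0 < r0)%N ->
  size zs = (r0 ^ 2)%N -> (forall z, z \in zs -> `|z| = 1) -> `|phi| <= 1 ->
  `|phi * (1 - (r0%:R ^- 6) * ((r0 ^ 2)%:R + 2 * upper_sum zs))
     + r0%:R ^- 5 * \sum_(z <- zs) z| <= 1 + r0%:R ^- 4.
Proof.
move=> r00 sz hz hphi.
have R0 : (0 : C) < r0%:R by rewrite ltr0n.
have Rn : (r0%:R : C) != 0 by rewrite gt_eqF.
set S := \sum_(z <- zs) z; set U := upper_sum zs.
pose u : C := (r0%:R ^- 6) * ((r0 ^ 2)%:R + 2 * U).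
have eS : `|S| ^+ 2 = (r0 ^ 2)%:R + U + U^* by rewrite /S normC_sum_upper // sz.
have nu : `|u| <= r0%:R ^- 2.
  rewrite /u normrM ger0_norm ?invr_ge0 ?exprn_ge0 //.
  have := norm_upper_sum hz; rewrite sz -/U natrX => h.
  apply: le_trans (ler_wpM2l _ h) _; first by rewrite invr_ge0 exprn_ge0.
  by rewrite le_eqVlt; apply/orP; left; apply/eqP; field.
have uu : u + u^* = 2 * r0%:R ^- 6 * `|S| ^+ 2.
  have -> : u^* = (r0%:R ^- 6) * ((r0 ^ 2)%:R + 2 * U^*).
    rewrite /u [LHS]rmorphM /=; congr (_ * _); first by rewrite fmorphV rmorphXn /= rmorph_nat.
    by rewrite [LHS]rmorphD /= rmorph_nat; congr (_ + _); rewrite [LHS]rmorphM /= rmorph_nat.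
  by rewrite eS /u; ring.
pose s := `|S|; pose a : C := r0%:R ^- 4; pose b : C := r0%:R ^- 6.
have a0 : 0 <= a by rewrite invr_ge0 exprn_ge0.
have b0 : 0 <= b by rewrite invr_ge0 exprn_ge0.
have sr : s <= r0%:R ^+ 2.
  have : s ^+ 2 <= (r0%:R ^+ 2) ^+ 2.
    rewrite /s eS (_ : _ + U + U^* = r0%:R ^+ 6 * (u + u^*) / 2); last first.
      rewrite uu eS; field; rewrite Rn //.
    have h : u + u^* <= 2 * r0%:R ^- 2.
      have re : u + u^* \is Num.real by rewrite CrealE rmorphD /= conjCK addrC.
      apply: le_trans (real_ler_norm re) _; apply: le_trans (ler_normD _ _) _.
      by rewrite norm_conjC mulr_natl mulr2n lerD.
    rewrite ler_pdivrMr //.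
    apply: le_trans (ler_wpM2l _ h) _; first by rewrite exprn_ge0.
    by rewrite le_eqVlt; apply/orP; left; apply/eqP; field.
  by rewrite ler_pXn2r // nnegrE ?normr_ge0 ?exprn_ge0.
(* The gain is the real part of [u], equal to [b * s ^+ 2]: it lowers the norm of [1 - u] by about
   as much. Completing the square at the end shows that this pays for the added [r0%:R ^- 5 * s], up
   to the allowed excess. *)
have n1u : `|1 - u| ^+ 2 <= (1 - b * s ^+ 2 + a / 2) ^+ 2.
  rewrite normCK rmorphB rmorph1.
  have -> : (1 - u) * (1 - u^*) = 1 - (u + u^*) + `|u| ^+ 2 by rewrite normCK; ring.
  rewrite uu -/s -/b.
  have h4 : `|u| ^+ 2 <= a.
    apply: le_trans (_ : (r0%:R ^- 2) ^+ 2 <= _).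
      by rewrite lerXn2r // nnegrE // invr_ge0 exprn_ge0.
    by rewrite le_eqVlt; apply/orP; left; apply/eqP; rewrite /a; field.
  have -> : (1 - b * s ^+ 2 + a / 2) ^+ 2 =
     1 - 2 * b * s ^+ 2 + a + (b * s ^+ 2 - a / 2) ^+ 2 by field.
  rewrite -[X in X <= _]addr0; apply: lerD; first by rewrite lerD2l.
  have re : b * s ^+ 2 - a / 2 \is Num.real.
    by rewrite realB ?realM ?realX ?normr_real ?ger0_real ?invr_ge0 ?exprn_ge0.
  by rewrite real_exprn_even_ge0.
have pos : 0 <= 1 - b * s ^+ 2 + a / 2.
  have : b * s ^+ 2 <= 1.
    apply: le_trans (_ : b * (r0%:R ^+ 2) ^+ 2 <= _).
      by rewrite ler_wpM2l // lerXn2r // nnegrE ?normr_ge0 ?exprn_ge0.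
    rewrite (_ : b * _ = r0%:R ^- 2); last by rewrite /b; field.
    by rewrite invf_le1 ?exprn_gt0 // exprn_ege1 // ler1n.
  by move=> h; rewrite addr_ge0 ?subr_ge0 // divr_ge0.
have n1 : `|1 - u| <= 1 - b * s ^+ 2 + a / 2.
  by rewrite -(ler_pXn2r (isT : (0 < 2)%N)) ?nnegrE.
have c0 : (0 : C) <= r0%:R ^- 5 by rewrite invr_ge0 exprn_ge0.
rewrite -/u; apply: le_trans (ler_normD _ _) _.
rewrite [ `|phi * _|]normrM [ `|_ * S|]normrM (ger0_norm c0) -/s.
have h1 : `|phi| * `|1 - u| <= 1 * (1 - b * s ^+ 2 + a / 2) by apply: ler_pM.
apply: le_trans (lerD h1 (lexx _)) _.
rewrite mul1r -/a.
pose e : C := r0%:R ^- 1.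
have -> : a = e ^+ 4 by rewrite /a /e exprVn.
have -> : b = e ^+ 6 by rewrite /b /e exprVn.
have -> : r0%:R ^- 5 = e ^+ 5 by rewrite /e exprVn.
rewrite -subr_ge0.
have -> : 1 + e ^+ 4 - (1 - e ^+ 6 * s ^+ 2 + e ^+ 4 / 2 + e ^+ 5 * s) =
   (e ^+ 3 * s - e ^+ 2 / 2) ^+ 2 + e ^+ 4 / 4 by field.
have e0 : 0 <= e by rewrite invr_ge0.
have re : e ^+ 3 * s - e ^+ 2 / 2 \is Num.real.
  by rewrite realB ?realM ?realX ?normr_real ?ger0_real ?invr_ge0 ?exprn_ge0.
by rewrite addr_ge0 ?real_exprn_even_ge0 // divr_ge0 // exprn_ge0.
Qed.

End Step.

Section Expo.
Variable R : realType.
Local Notation C := (R[i]).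

Definition ee (t : R) : C := (cos t +i* sin t)%C.

Lemma eeD s t : ee (s + t) = ee s * ee t.
Proof. by apply/eqP; rewrite eq_complex /= cosD sinD eqxx /= addrC. Qed.

Lemma norm_ee t : `|ee t| = 1.
Proof. by rewrite normc_def /= cos2Dsin2 sqrtr1. Qed.

Lemma conj_ee t : (ee t)^* = ee (- t).
Proof. by apply/eqP; rewrite eq_complex /= cosN sinN !eqxx. Qed.

Lemma conj_realC (r : R) : (r%:C%C : C)^* = r%:C%C.
Proof. by apply/eqP; rewrite eq_complex /= oppr0 !eqxx. Qed.

(* A list of pairs (weight, frequency) stands for an exponential sum. *)
Definition ev (phi : seq (R * int)) (t : R) : C :=
  \sum_(x <- phi) (x.1)%:C%C * ee (x.2%:~R * t).
Definition pair_with (b : int -> R) (phi : seq (R * int)) : R :=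
  \sum_(x <- phi) x.1 * b x.2.
Definition scale (c : R) (phi : seq (R * int)) := [seq (c * x.1, x.2) | x <- phi].
Definition convol (d phi : seq (R * int)) :=
  [seq (x.1 * y.1, x.2 + y.2) | x <- d, y <- phi].

Lemma ev_cat phi psi t : ev (phi ++ psi) t = ev phi t + ev psi t.
Proof. exact: big_cat. Qed.

Lemma ev_scale c phi t : ev (scale c phi) t = c%:C%C * ev phi t.
Proof.
rewrite /ev big_map mulr_sumr; apply: eq_bigr => x _ /=.
by rewrite rmorphM /= mulrA.
Qed.

Lemma ev_convol d phi t : ev (convol d phi) t = ev d t * ev phi t.
Proof.
rewrite /ev big_allpairs_dep mulr_suml; apply: eq_bigr => x _.
rewrite mulr_sumr; apply: eq_bigr => y _ /=.
by rewrite rmorphM rmorphD /= mulrDl eeD; ring.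
Qed.

Lemma pair_cat b phi psi : pair_with b (phi ++ psi) = pair_with b phi + pair_with b psi.
Proof. exact: big_cat. Qed.

Lemma pair_scale b c phi : pair_with b (scale c phi) = c * pair_with b phi.
Proof.
rewrite /pair_with big_map mulr_sumr; apply: eq_bigr => x _ /=.
by rewrite mulrA.
Qed.

Lemma Re_ev phi t : complex.Re (ev phi t) = \sum_(x <- phi) x.1 * cos (x.2%:~R * t).
Proof.
rewrite /ev; elim: phi => [|x phi IH]; first by rewrite !big_nil.
by rewrite !big_cons -IH /= raddfD /=; congr (_ + _); rewrite mul0r subr0.
Qed.

(** Evenness of [b] makes the pairing the mean of [tp N b] times the real part of [ev phi], and that
    real part is at most 1. *)
Lemma pair_le_mass N (b : int -> R) phi :
  supp N b -> (forall n, b (- n) = b n) -> (forall t, 0 <= tp N b t) ->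
  (forall t, `|ev phi t| <= 1) -> pair_with b phi <= b 0.
Proof.
move=> sb evb F0 hphi; pose M := (N + \sum_(x <- phi) `|x.2|%N).+1.
have -> : b 0 = avg M (tp N b) by rewrite avg_tp // ltnS leq_addr.
have -> : pair_with b phi = avg M (fun t => tp N b t * complex.Re (ev phi t)).
  rewrite (@eq_avg _ M _ (fun t => \sum_(x <- phi) x.1 * (tp N b t * cos (x.2%:~R * t)))); last first.
    by move=> t; rewrite Re_ev mulr_sumr; apply: eq_bigr => x _; rewrite mulrCA.
  rewrite /avg exchange_big mulr_sumr /= /pair_with big_seq [RHS]big_seq.
  apply: eq_bigr => x xphi; rewrite -mulr_sumr mulrCA; congr (_ * _).
  rewrite -[LHS](@avg_tp_cos _ M N b x.2) // /M ltnS leq_add2l.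
  by rewrite (big_rem x) //= leq_addr.
apply: ler_avg => t; rewrite -[X in _ <= X]mulr1 ler_wpM2l //.
have := normc_ge_Re (ev phi t) => /le_trans/(_ (hphi t)).
by rewrite -[1]/((1 : R)%:C%C) lecR; apply: le_trans; apply: ler_norm.
Qed.

Fixpoint upper_pairs (sg : int -> R) (qs : seq int) : seq (R * int) :=
  if qs is q :: qs' then [seq (sg q * sg q', q - q') | q' <- qs'] ++ upper_pairs sg qs'
  else [::].

Lemma ev_upper_pairs sg qs t : ev (upper_pairs sg qs) t =
  upper_sum [seq (sg q)%:C%C * ee (q%:~R * t) | q <- qs].
Proof.
elim: qs => [|q qs IH] /=; first by rewrite /ev big_nil.
rewrite ev_cat IH; congr (_ + _); rewrite /ev !big_map rmorph_sum mulr_sumr.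
apply: eq_bigr => q' _ /=; rewrite rmorphM rmorphB mulrBl eeD -conj_ee /=.
by rewrite [X in _ = _ * X]rmorphM /= conj_realC; ring.
Qed.

Lemma size_upper_pairs sg qs : (size (upper_pairs sg qs) <= size qs ^ 2)%N.
Proof.
elim: qs => //= q qs IH; rewrite size_cat size_map.
by move: IH; move: (size (upper_pairs _ _)) (size qs) => a m; nia.
Qed.

Lemma mem_upper_pairs (P : rel int) sg qs x : pairwise P qs ->
  x \in upper_pairs sg qs -> exists q q', P q q' /\ x.2 = q - q'.
Proof.
elim: qs => //= q qs IH /andP[aq pq]; rewrite mem_cat => /orP[|/(IH pq)//].
by move/mapP => [q' hq' ->]; exists q, q'; split=> //; apply: (allP aq).
Qed.

End Expo.

Section Davenport.
Variables (R : realType) (N l r0 : nat) (b : int -> R) (delta : R).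
Hypotheses (sb : supp N b) (evb : forall n, b (- n) = b n).
Hypothesis F0 : forall t, 0 <= tp N b t.
Hypothesis dense : forall n, b n != 0 -> exists2 k, (k <= l)%N & delta <= `|b (n + k%:Z)|.
Hypotheses (delta0 : 0 < delta) (r00 : (0 < r0)%N) (hr0 : 4 * b 0 <= r0%:R * delta).

Let r := (r0 ^ 2)%N.
Let Sz := (1 + r + r ^ 2)%N.
Let smax := (r0 ^ 4).+1.
(** [smax] is the number of iterations, [Sz] the growth factor of the number of terms of [phi] in
    one of them. While the ranks are at most [B ^ s], there are fewer than [Sz ^ s * B ^ s * l.+2]
    bad differences, so the first [B ^ s.+1] large coefficients suffice to select the next [r]
    frequencies. *)
Definition dav_base : nat := (r * l.+2 * Sz ^ smax)%N.
Local Notation B := dav_base.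

Let G := [seq n <- [seq N%:Z - i%:Z | i <- iota 0 (2 * N).+1] | delta <= `|b n|].

Let mem_G n : (n \in G) = (delta <= `|b n|).
Proof.
rewrite mem_filter andb_idr // => h; apply/mapP.
have hn : (`|n| <= N)%N.
  by rewrite leqNgt; apply/negP => /sb e; move: h; rewrite e normr0 leNgt delta0.
by exists `|N%:Z - n|%N; [rewrite mem_iota; lia | lia].
Qed.

Let G_desc : pairwise >%R G.
Proof.
apply: pairwise_filter; rewrite pairwise_map.
have : pairwise ltn (iota 0 (2 * N).+1) by rewrite -sorted_pairwise ?iota_ltn_sorted //; exact: ltn_trans.
by apply: sub_pairwise => i j /= h; rewrite ltrD2l ltrN2 ltz_nat.
Qed.

(** The frequencies of [phi] are kept far to the right, with few elements of [G] beyond them; this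
    keeps the list of bad differences short. *)
Let rank (p : int) := count (fun g => p < g) G.

Let rank_le p q : p <= q -> (rank q <= rank p)%N.
Proof. by move=> pq; apply: sub_count => g /=; apply: le_lt_trans. Qed.

Let rank_take m q : q \in take m G -> (rank q <= m)%N.
Proof.
move=> hq; rewrite /rank -[G](cat_take_drop m) count_cat.
have -> : count (fun g => q < g) (drop m G) = 0%N.
  apply/eqP; rewrite -leqn0 leqNgt -has_count; apply/negP => /hasP[g hg lt].
  have := G_desc; rewrite -[G](cat_take_drop m) pairwise_cat => /andP[/allrelP/(_ q g hq hg)].
  by rewrite /= ltNge (ltW lt).
rewrite addn0; apply: leq_trans (count_size _ _) _.
by rewrite size_take_min geq_minl.
Qed.

(* A nonzero [b (d + x.2)] has an element [g] of [G] within distance [l] to its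
   right, so [d] is among these differences. *)
Let bad (phi : seq (R * int)) := flatten [seq [seq g - k%:Z - x.2 |
   g <- [seq g <- G | x.2 < g], k <- iota 0 l.+1] | x <- phi].

Let size_bad phi m : (forall x, x \in phi -> (rank x.2 <= m)%N) ->
  (size (bad phi) <= size phi * (m * l.+1))%N.
Proof.
elim: phi => // x phi IH h.
rewrite (_ : bad (x :: phi) = [seq g - k%:Z - x.2 |
   g <- [seq g <- G | x.2 < g], k <- iota 0 l.+1] ++ bad phi) //.
rewrite size_cat (size_allpairs (fun (g : int) (k : nat) => g - k%:Z - x.2)).
rewrite size_iota [size (x :: phi)]/= mulSn.
rewrite leq_add ?leq_mul //; first by rewrite size_filter h ?mem_head.
by apply: IH => y yp; apply: h; rewrite inE yp orbT.
Qed.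

Let bad_ok phi x (d : int) : x \in phi -> 0 < d -> d \notin bad phi -> b (d + x.2) = 0.
Proof.
move=> xphi d0; apply: contraNeq => /dense[k kl hk].
apply/flattenP; exists [seq g - k%:Z - x.2 | g <- [seq g <- G | x.2 < g], k <- iota 0 l.+1].
  by apply/mapP; exists x.
apply/allpairsP; exists (d + x.2 + k%:Z, k); split.
- by rewrite mem_filter mem_G hk andbT /=; lia.
- by rewrite mem_iota.
- by rewrite /=; lia.
Qed.

Let sg n := Num.sg (b n).
Let lam : R := r0%:R ^- 6.
Let mu : R := r0%:R ^- 5.
Let kap : R := (1 + r0%:R ^- 4)^-1.

(** The combination of [davenport_step] written with frequencies, normalised by [kap] to keep the
    bound 1. Its middle term pairs to 0 with [b] when the differences avoid [bad phi], and its last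
    term collects the absolute value of [b q] at each [q]. *)
Let next (phi : seq (R * int)) (qs : seq int) :=
  scale kap (scale (1 - lam * r%:R) phi ++ (scale (- (2 * lam)) (convol (upper_pairs sg qs) phi)
    ++ scale mu [seq (sg q, q) | q <- qs])).

Let R0 : (0 : R) < r0%:R. Proof. by rewrite ltr0n. Qed.
Let a0 : (0 : R) < r0%:R ^- 4. Proof. by rewrite invr_gt0 exprn_gt0. Qed.

Let next_bound phi qs t : size qs = r -> (forall q, q \in qs -> delta <= `|b q|) ->
  `|ev phi t| <= 1 -> `|ev (next phi qs) t| <= 1.
Proof.
move=> sq hq hphi; rewrite /next ev_scale normrM ev_cat ev_cat !ev_scale ev_convol ev_upper_pairs.
set zs := [seq _ | q <- qs].
have -> : ev [seq (sg q, q) | q <- qs] t = \sum_(z <- zs) z.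
  by rewrite /ev !big_map.
have szs : size zs = (r0 ^ 2)%N by rewrite size_map.
have nzs z : z \in zs -> `|z| = 1.
  move=> /mapP[q /hq h ->]; rewrite normrM norm_ee mulr1.
  have b0 : b q != 0 by apply: contraTneq h => ->; rewrite normr0 -ltNge.
  by rewrite normc_def /= expr0n addr0 sqrtr_sqr normr_sg b0.
have := davenport_step r00 szs nzs hphi.
have eC k : ((r0%:R ^- k : R)%:C)%C = r0%:R ^- k :> R[i].
  by rewrite fmorphV rmorphXn /= rmorph_nat.
rewrite -[1 + r0%:R ^- 4](_ : (kap^-1)%:C%C = _); last first.
  by rewrite /kap invrK rmorphD rmorph1 /= eC.
have -> : ev phi t * (1 - r0%:R ^- 6 * ((r0 ^ 2)%:R + 2 * upper_sum zs)) + r0%:R ^- 5 * (\sum_(z <- zs) z) =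
  (1 - lam * r%:R)%:C%C * ev phi t + ((- (2 * lam))%:C%C * (upper_sum zs * ev phi t) + mu%:C%C * (\sum_(z <- zs) z)).
  have -> : (1 - lam * r%:R)%:C%C = 1 - r0%:R ^- 6 * (r0 ^ 2)%:R :> R[i].
    by rewrite rmorphB rmorph1 rmorphM /= rmorph_nat /lam eC.
  have -> : (- (2 * lam))%:C%C = - (2 * r0%:R ^- 6) :> R[i].
    by rewrite rmorphN rmorphM /= rmorph_nat /lam eC.
  by rewrite /mu eC; ring.
have kap0 : 0 < kap by rewrite invr_gt0 addr_gt0.
move=> h; apply: le_trans (_ : `|kap%:C%C| * (kap^-1)%:C%C <= _).
  by rewrite ler_wpM2l.
have k0C : (0 : R[i]) <= kap%:C%C by rewrite ler0c ltW.
by rewrite (ger0_norm k0C) -rmorphM mulfV ?rmorph1 // gt_eqF.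
Qed.

(** The last term of [next] gains [r0 ^- 3 * delta]. By [hr0] the pairing is at most
    [r0 * delta / 4], so that the factors [1 - lam * r] and [kap] leave a quarter of this gain. *)
Let next_pair phi qs : size qs = r -> (forall q, q \in qs -> delta <= `|b q|) ->
  pairwise (fun q q' => (q > q') && ((q - q' : int) \notin bad phi)) qs ->
  0 <= pair_with b phi -> pair_with b phi <= b 0 ->
  pair_with b phi + r0%:R ^- 3 * delta / 4 <= pair_with b (next phi qs).
Proof.
move=> sq hq pq I0 Ib; rewrite /next pair_scale pair_cat pair_cat !pair_scale.
have -> : pair_with b (convol (upper_pairs sg qs) phi) = 0.
  rewrite /pair_with big_allpairs_dep big_seq big1 // => x xu.
  have [q [q' [/andP[lt nb] e]]] := mem_upper_pairs pq xu.
  rewrite big_seq big1 // => y yphi /=; by rewrite e (bad_ok yphi) ?subr_gt0 // mulr0.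
have h1 : r%:R * delta <= pair_with b [seq (sg q, q) | q <- qs].
  rewrite /pair_with big_map -sq.
  elim: (qs) (hq) => [|q l' IH] h; first by rewrite big_nil mul0r.
  rewrite big_cons /= -natr1 mulrDl mul1r addrC lerD //.
    by rewrite -normrEsg h ?mem_head.
  by apply: IH => q' hq'; apply: h; rewrite inE hq' orbT.
set X := pair_with b _ in h1 *; set I := pair_with b phi in I0 Ib *.
rewrite mulr0 add0r /kap ler_pdivlMl ?addr_gt0 //.
pose e : R := r0%:R^-1.
have e0 : 0 < e by rewrite invr_gt0.
have re : r0%:R * e = 1 by rewrite mulfV ?gt_eqF.
have -> : r0%:R ^- 4 = e ^+ 4 :> R by rewrite /e exprVn.
have -> : r0%:R ^- 3 = e ^+ 3 :> R by rewrite /e exprVn.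
have El : lam * r%:R = e ^+ 4 by rewrite /lam /e /r natrX -exprVn; field; rewrite gt_eqF.
have Em : mu * (r%:R * delta) = e ^+ 3 * delta.
  by rewrite /mu /e /r natrX -exprVn; field; rewrite gt_eqF.
have h2 : e ^+ 3 * delta <= mu * X.
  by rewrite -Em ler_wpM2l // invr_ge0 exprn_ge0.
rewrite El.
have e1 : e <= 1 by rewrite invf_le1 // ler1n.
have h3 : 4 * (e ^+ 4 * I) <= e ^+ 3 * delta.
  apply: le_trans (_ : e ^+ 4 * (4 * b 0) <= _).
    by rewrite mulrCA; apply: ler_wpM2l; [exact/exprn_ge0/ltW | rewrite ler_pM2l].
  apply: le_trans (ler_wpM2l _ hr0) _; first exact/exprn_ge0/ltW.
  rewrite [X in X <= _](_ : _ = e ^+ 3 * delta * (r0%:R * e)); last by ring.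
  by rewrite re mulr1.
have h4 : e ^+ 4 * (e ^+ 3 * delta) <= e ^+ 3 * delta.
  by apply: ler_piMl; [apply: mulr_ge0; [exact/exprn_ge0/ltW | exact: ltW] | apply: exprn_ile1 => //; exact: ltW].
move: h2 h3 h4; set u := e ^+ 3 * delta; set v := e ^+ 4; nra.
Qed.

(* [next] preserves [`|ev phi| <= 1] and increases [pair_with b phi] by a fixed
   amount, while [pair_with b phi <= b 0]: after [smax] steps this fails. *)
Lemma large_coeffs_lt : (size G < B ^ smax)%N.
Proof.
rewrite ltnNge; apply/negP => big.
have Sz0 : (0 < Sz)%N by [].
have r_0 : (0 < r)%N by rewrite expn_gt0 r00.
have B0 : (0 < B)%N by rewrite /dav_base 2!muln_gt0 r_0 expn_gt0.
have main s : (s <= smax)%N -> exists phi, [/\ (size phi <= Sz ^ s)%N,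
    forall x, x \in phi -> (rank x.2 <= B ^ s)%N,
    forall t, `|ev phi t| <= 1 &
    s%:R * (r0%:R ^- 3 * delta / 4) <= pair_with b phi].
  elim: s => [|s IH] hs.
    exists [::]; split=> //; last by rewrite mul0r /pair_with big_nil.
    by move=> t; rewrite /ev big_nil normr0.
  have [phi [sphi rphi bphi Iphi]] := IH (ltnW hs).
  have sB := size_bad rphi.
  (* Using only the first elements of [G] bounds the ranks of the new frequencies; the old ones are
     shifted by [q - q' > 0], which can only lower theirs. *)
  have tk : size (take (B ^ s.+1) G) = (B ^ s.+1)%N.
    by rewrite size_takel // (leq_trans _ big) // leq_pexp2l.
  have [||qs [sq subq pq]] := @select_differences (take (B ^ s.+1) G) (bad phi) r.
  - by have := G_desc; rewrite -{1}[G](cat_take_drop (B ^ s.+1)) pairwise_cat => /and3P[].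
  - rewrite tk expnS.
    apply: leq_trans (_ : r * (Sz ^ s * l.+2) * B ^ s <= _)%N; last first.
      rewrite leq_mul2r /dav_base -mulnA leq_mul2l [(Sz ^ s * _)%N]mulnC leq_mul2l leq_pexp2l ?orbT //.
      exact: ltnW.
    rewrite -mulnA leq_mul2l; apply/orP; right.
    apply: leq_ltn_trans sB _.
    have := leq_mul sphi (leqnn (B ^ s * l.+1)).
    have p1 : (0 < Sz ^ s)%N by rewrite expn_gt0.
    have p2 : (0 < B ^ s)%N by rewrite expn_gt0 B0.
    by move: (size phi) (Sz ^ s)%N (B ^ s)%N p1 p2 => a c d; nia.
  have hq q : q \in qs -> delta <= `|b q|.
    by move=> /subq /mem_take; rewrite mem_G.
  exists (next phi qs); split.
  - rewrite /next !size_map !size_cat !size_map size_allpairs sq.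
    have := size_upper_pairs sg qs; rewrite sq => h.
    have p1 : (0 < Sz ^ s)%N by rewrite expn_gt0.
    have h2 := leq_mul h sphi.
    apply: leq_trans (leq_add sphi (leq_add h2 (leqnn r))) _.
    rewrite [(Sz ^ s.+1)%N]expnS; have := leq_pmulr r p1; set c := (Sz ^ s)%N.
    rewrite /Sz !mulnDl mul1n; move: (r * c)%N (r ^ 2 * c)%N => u v; lia.
  - move=> x; rewrite /next => /mapP[y]; rewrite !mem_cat => hy -> /=.
    have Bs : (B ^ s <= B ^ s.+1)%N by rewrite leq_pexp2l.
    case/or3P: hy => /mapP[z hz ->] /=.
    + exact: leq_trans (rphi _ hz) Bs.
    + move: hz => /allpairsP[[u v] /= [hu hv ->]] /=.
      have [q [q' [/andP[lt _] ->]]] := mem_upper_pairs pq hu.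
      by apply: leq_trans (leq_trans (rphi _ hv) Bs); apply: rank_le; rewrite lerDr subr_ge0 ltW.
    + by move: hz => /mapP[q /subq hqs ->] /=; apply: rank_take.
  - by move=> t; apply: next_bound.
  - have I0 : 0 <= pair_with b phi.
      by apply: le_trans Iphi; rewrite mulr_ge0 // divr_ge0 // mulr_ge0 ?invr_ge0 ?exprn_ge0 // ltW.
    have Ib := pair_le_mass sb evb F0 bphi.
    apply: le_trans (next_pair sq hq pq I0 Ib).
    by rewrite -natr1 mulrDl mul1r lerD2r.
have [phi [_ _ bphi Iphi]] := main smax (leqnn _).
have := le_trans Iphi (pair_le_mass sb evb F0 bphi).
move=> h.
(* The accumulated gain stays below [r0 * delta / 4], which allows at most [r0 ^ 4] steps, one fewer
   than [smax]. *)
have h2 : 4 * (smax%:R * (r0%:R ^- 3 * delta / 4)) <= r0%:R * delta.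
  by apply: le_trans hr0; rewrite ler_pM2l.
have e : 4 * (smax%:R * (r0%:R ^- 3 * delta / 4)) = smax%:R * r0%:R ^- 4 * (r0%:R * delta).
  by field; rewrite gt_eqF.
have rd : 0 < r0%:R * delta by rewrite mulr_gt0.
move: h2; rewrite e -[X in _ <= X]mul1r ler_pM2r // ler_pdivrMr ?exprn_gt0 // mul1r.
by rewrite -natrX ler_nat ltnn.
Qed.

Lemma sparse_spectrum (Lam : seq int) : uniq Lam -> (forall n, n \in Lam -> b n != 0) ->
  (size Lam <= l.+1 * B ^ smax)%N.
Proof.
move=> uL hL; apply: leq_trans (_ : l.+1 * size G <= _)%N; last first.
  by rewrite leq_mul2l ltnW ?orbT // large_coeffs_lt.
rewrite mulnC -(size_iota 0 l.+1) -(size_allpairs (fun (g : int) (k : nat) => g - k%:Z)).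
apply: uniq_leq_size => // n /hL /dense[k kl hk]; apply/allpairsP.
exists (n + k%:Z, k); split; [by rewrite mem_G|by rewrite mem_iota|rewrite /=; lia].
Qed.

End Davenport.

(** * Smoothing by the lazy random walk *)

Section Walk.
Variable R : realType.
Implicit Types (x c : int -> R) (t : R) (N k : nat).

Definition walk x (n : int) : R := (nbsum x n + 2 * x n) / 4.
Definition walks k x : int -> R := iter k walk x.
Definition kern k (t : R) : R := ((1 + cos t) / 2) ^+ k.

Lemma supp_walk N x : supp N x -> supp N.+1 (walk x).
Proof.
by move=> sx n hn; rewrite /walk (supp_nbsum sx) // sx ?mulr0 ?addr0 ?mul0r //; lia.
Qed.

Lemma supp_walks N k x : supp N x -> supp (N + k) (walks k x).
Proof.
by move=> sx; elim: k => [|k IH]; rewrite ?addn0 // addnS; apply: supp_walk.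
Qed.

Lemma even_nbsum x : (forall n, x (- n) = x n) -> forall n, nbsum x (- n) = nbsum x n.
Proof.
move=> ev n; rewrite /nbsum addrC -[x (n + 1)]ev -[x (n - 1)]ev.
by congr (x _ + x _); lia.
Qed.

Lemma even_walks k x : (forall n, x (- n) = x n) -> forall n, walks k x (- n) = walks k x n.
Proof.
move=> ev; elim: k => // k IH n; rewrite /walks iterS -/(walks k x) /walk.
by rewrite even_nbsum // IH.
Qed.

Lemma tp_walk N x t : supp N x -> tp N.+1 (walk x) t = (1 + cos t) / 2 * tp N x t.
Proof.
move=> sx.
have -> : tp N.+1 (walk x) t = (tp N.+1 (nbsum x) t + 2 * tp N.+1 x t) / 4.
  rewrite /tp /isum mulr_sumr -big_split mulr_suml; apply: eq_bigr => i _ /=.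
  by rewrite /walk; ring.
by rewrite tp_nbsum // (tp_widen _ (leqnSn N)) //; field.
Qed.

Lemma tp_walks N k x t : supp N x -> tp (N + k) (walks k x) t = kern k t * tp N x t.
Proof.
move=> sx; elim: k => [|k IH]; first by rewrite addn0 /kern expr0 mul1r.
by rewrite addnS tp_walk ?IH; [rewrite /kern exprS mulrA | apply: supp_walks].
Qed.

Lemma kern_ge0 k t : 0 <= kern k t.
Proof. by rewrite exprn_ge0 // divr_ge0 // -lerBlDl sub0r cos_geN1. Qed.

Lemma kern_base_le1 t : (1 + cos t) / 2 <= 1.
Proof. by rewrite ler_pdivrMr // mul1r; have := cos_le1 t; lra. Qed.

Lemma kern_base_ge0 t : 0 <= (1 + cos t) / 2.
Proof. by have := kern_ge0 1 t; rewrite /kern expr1. Qed.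

Lemma kern_le k k' t : (k <= k')%N -> kern k' t <= kern k t.
Proof. by move=> h; apply: ler_wiXn2l => //; rewrite ?kern_base_ge0 ?kern_base_le1. Qed.

Definition unit_mass (n : int) : R := (n == 0)%:R.

(** A lazy step is made of two half-steps of a simple walk, hence the binomial of order [2 * k]. The
    test excludes negative lower indices, which [absz] would fold back. *)
Definition bin_mass k (n : int) : nat :=
  if (0 <= k%:Z + n)%R then 'C(2 * k, absz (k%:Z + n)%R) else 0%N.

Lemma bin_mass_step k n :
  bin_mass k.+1 n = (bin_mass k (n + 1) + bin_mass k (n - 1) + 2 * bin_mass k n)%N.
Proof.
rewrite /bin_mass; have -> : (2 * k.+1 = (2 * k).+2)%N by lia.
case: (lerP 0 (k%:Z + n)) => h1; last first.
  rewrite [X in (if X then _ else _)](_ : _ = (k%:Z + n == -1)); last by lia.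
  rewrite [X in _ = (X + _ + _)%N](_ : _ = (k%:Z + n == -1)%:R); last first.
    case: eqP => [e|ne]; last by rewrite ifF //; lia.
    by rewrite ifT; [rewrite (_ : absz _ = 0)%N ?bin0 //|]; lia.
  rewrite [X in _ = (_ + X + _)%N]ifF; last by lia.
  by case: eqP => // e; rewrite (_ : absz _ = 0)%N ?bin0 //; lia.
rewrite ifT; last by lia.
rewrite [X in _ = (X + _ + _)%N]ifT; last by lia.
have [m em] : exists m : nat, k%:Z + n = m%:Z by exists (absz (k%:Z + n)%R); lia.
have -> : absz (k.+1%:Z + n)%R = m.+1 by lia.
have -> : absz (k%:Z + (n + 1))%R = m.+1 by lia.
have -> : absz (k%:Z + n)%R = m by lia.
case: m em => [|m] em.
  by rewrite ifF; [rewrite !bin1 bin0; lia|lia].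
rewrite ifT; last by lia.
have -> : absz (k%:Z + (n - 1))%R = m by lia.
by rewrite !binS; lia.
Qed.

Lemma walks_unit_mass k n : walks k unit_mass n = (bin_mass k n)%:R / 4 ^+ k.
Proof.
elim: k n => [|k IH] n.
  rewrite /walks /= /unit_mass /bin_mass expr0 divr1 add0r muln0.
  have [->|n0] := eqVneq n 0; first by rewrite /= bin0.
  by case: leP => // _; rewrite bin0n absz_eq0 (negbTE n0).
rewrite /walks iterS -/(walks k unit_mass) /walk /nbsum !IH bin_mass_step.
rewrite 2!natrD natrM exprS; field; rewrite expf_neq0 ?pnatr_eq0 //.
Qed.

Lemma central_bin_step k : (k.+1 * 'C(2 * k.+1, k.+1) = 2 * (2 * k).+1 * 'C(2 * k, k))%N.
Proof.
have e1 : (k.+1 * 'C((2 * k).+2, k.+1) = (2 * k).+2 * 'C((2 * k).+1, k))%N.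
  by rewrite -mul_bin_diag.
have e2 : (k.+1 * 'C((2 * k).+1, k) = (2 * k).+1 * 'C(2 * k, k))%N.
  have := mul_bin_down (2 * k).+1 k.
  by rewrite (_ : (2 * k).+1 - k = k.+1)%N; [move=> <-|lia].
have -> : (2 * k.+1 = (2 * k).+2)%N by lia.
apply/eqP; rewrite -(eqn_pmul2l (ltn0Sn k)); apply/eqP; rewrite e1.
by rewrite mulnCA e2; lia.
Qed.

(** Consecutive central masses have ratio [(2k + 1) / (2k + 2)], and
    [(2k + 1) (2k + 3) <= (2k + 2) ^ 2], so the left side decreases with [k]. *)
Lemma central_walk_sqr k : (2 * k%:R + 1) * walks k unit_mass 0 ^+ 2 <= 1.
Proof.
elim: k => [|k IH].
  by rewrite mulr0 add0r mul1r /walks /= /unit_mass eqxx expr1n.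
have step : 2 * (k%:R + 1) * walks k.+1 unit_mass 0 = (2 * k%:R + 1) * walks k unit_mass 0.
  rewrite !walks_unit_mass /bin_mass !addr0 /= exprS.
  have := congr1 (fun m : nat => (m%:R : R)) (central_bin_step k).
  rewrite !natrM -[k.+1%:R]natr1 -[(2 * k).+1%:R]natr1 natrM => e.
  rewrite [LHS](_ : _ = 2 * ((k%:R + 1) * 'C(2 * k.+1, k.+1)%:R) / (4 * 4 ^+ k)); last by ring.
  by rewrite e; field; rewrite expf_neq0 ?pnatr_eq0.
set y := walks k _ 0 in IH step; set y' := walks k.+1 _ 0 in step *.
have k0 : 0 <= k%:R :> R by [].
rewrite -[k.+1%:R]natr1.
have e : (2 * (k%:R + 1)) ^+ 2 * ((2 * (k%:R + 1) + 1) * y' ^+ 2) =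
   (2 * (k%:R + 1) + 1) * (2 * k%:R + 1) * ((2 * k%:R + 1) * y ^+ 2).
  rewrite [LHS](_ : _ = (2 * (k%:R + 1) + 1) * (2 * (k%:R + 1) * y') ^+ 2); last by ring.
  by rewrite step; ring.
rewrite -(ler_pM2l (_ : 0 < (2 * (k%:R + 1)) ^+ 2)); last by rewrite exprn_gt0 // mulr_gt0 // ltr_wpDl.
rewrite e; apply: le_trans (ler_wpM2l _ IH) _; first by nra.
by nra.
Qed.

(** The mean of the kernel is the probability that the walk is back at 0 after [k] steps. *)
Lemma avg_kern_sqr M k : (k < M)%N -> k%:R * avg M (kern k) ^+ 2 <= 1.
Proof.
move=> kM.
have s0 : supp 0 unit_mass by move=> n hn; rewrite /unit_mass -absz_eq0 gtn_eqF.
have ev0 n : unit_mass (- n) = unit_mass n by rewrite /unit_mass oppr_eq0.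
have -> : avg M (kern k) = walks k unit_mass 0.
  rewrite -(@avg_tp _ M (0 + k) (walks k unit_mass)) ?add0n //; last exact: even_walks.
    apply: eq_avg => t; rewrite -[tp _ _ _]/(tp (0 + k) _ _) tp_walks // /tp /isum big_ord1 /= /unit_mass subrr eqxx.
    by rewrite mul0r cos0 !mulr1.
  exact: (@supp_walks 0 k).
apply: le_trans (central_walk_sqr k).
by rewrite ler_wpM2r ?sqr_ge0 //; have : 0 <= k%:R :> R by []; lra.
Qed.

(** A step of the walk has variance 1/2, so each one adds [al / 2] to the parabola. *)
Lemma walks_quadratic_bound k x (m : int) (al be : R) :
  (forall j, `|x j| <= al * (j - m)%:~R ^+ 2 + be) ->
  forall j, `|walks k x j| <= al * (j - m)%:~R ^+ 2 + be + al * k%:R / 2.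
Proof.
move=> hx; elim: k => [|k IH] j; first by rewrite mulr0 mul0r addr0; apply: hx.
rewrite /walks iterS -/(walks k x) /walk /nbsum normrM [ `|4^-1|]ger0_norm ?invr_ge0 //.
rewrite ler_pdivrMr //.
apply: le_trans (ler_normD _ _) _; apply: le_trans (lerD (ler_normD _ _) (lexx _)) _.
rewrite normrM normr_nat.
have h1 := IH (j + 1); have h2 := IH (j - 1); have h3 := IH j.
apply: le_trans (lerD (lerD h1 h2) (ler_wpM2l (ler0n _ 2) h3)) _.
rewrite (_ : j + 1 - m = (j - m) + 1); last by ring.
rewrite (_ : j - 1 - m = (j - m) - 1); last by ring.
rewrite !rmorphD !rmorphN /= rmorph1 -[k.+1%:R]natr1; lra.
Qed.

Lemma walks_sub_cst k x (a : R) j : walks k (fun i => x i - a) j = walks k x j - a.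
Proof.
elim: k j => // k IH j.
by rewrite /walks !iterS -/(walks k x) -/(walks k (fun i => x i - a)) /walk /nbsum !IH; field.
Qed.

Lemma walks_le k x (a : R) : (forall j, `|x j| <= a) -> forall j, `|walks k x j| <= a.
Proof.
move=> hx j; have h i : `|x i| <= 0 * (i - 0)%:~R ^+ 2 + a by rewrite mul0r add0r.
by have := walks_quadratic_bound k h j; rewrite !mul0r add0r addr0.
Qed.

End Walk.

Section HalfAngle.
Variable R : realType.
Implicit Types t : R.

Definition hsin t : R := `|sin (t / 2)|.

Lemma hsin_ge0 t : 0 <= hsin t. Proof. exact: normr_ge0. Qed.

Lemma hsin_sqr t : (1 + cos t) / 2 = 1 - hsin t ^+ 2.
Proof.
rewrite /hsin -normrX ger0_norm ?sqr_ge0 //.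
have e : t = (t / 2) *+ 2 by rewrite mulr2n; field.
by rewrite {1}e cos_mulr2n cos2sin2 mulr2n; field.
Qed.

Lemma hsin_sqr_le1 t : hsin t ^+ 2 <= 1.
Proof. by have := kern_base_ge0 t; rewrite hsin_sqr subr_ge0. Qed.

Lemma kernE k t : kern k t = (1 - hsin t ^+ 2) ^+ k.
Proof. by rewrite /kern hsin_sqr. Qed.

Lemma cos_diff_le (m : int) t :
  `|cos ((m + 1)%:~R * t) - cos (m%:~R * t)| <= 2 * hsin t.
Proof.
pose u := m%:~R * t + t / 2.
have -> : (m + 1)%:~R * t = u + t / 2 by rewrite rmorphD rmorph1 /u /=; field.
have -> : m%:~R * t = u - t / 2 by rewrite /u; ring.
rewrite cosD cosB (_ : _ - _ = - (2 * (sin u * sin (t / 2)))); last by ring.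
rewrite normrN normrM normr_nat normrM ler_wpM2l //.
by rewrite ler_piMl // sin_max.
Qed.

Lemma kern_sub_le k k' t : (k <= k')%N -> kern k t - kern k' t <= k'%:R * hsin t ^+ 2.
Proof.
move=> kk; have x0 : 0 <= hsin t ^+ 2 by rewrite exprn_ge0 ?hsin_ge0.
have x1 := hsin_sqr_le1 t.
have h : 1 - k'%:R * hsin t ^+ 2 <= kern k' t.
  rewrite kernE; elim: (k') => [|j IH]; first by rewrite mul0r subr0 expr0.
  rewrite [(1 - _) ^+ j.+1]exprS -[j.+1%:R]natr1; move: (hsin t ^+ 2) x0 x1 IH => x x0 x1 IH.
  apply: le_trans (_ : (1 - x) * (1 - j%:R * x) <= _).
    by have := mulr_ge0 (mulr_ge0 (ler0n R j) x0) x0; nra.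
  by rewrite ler_wpM2l // subr_ge0.
have : kern k t <= 1 by apply: exprn_ile1; [exact: kern_base_ge0 | exact: kern_base_le1].
by lra.
Qed.

Lemma kern_inv_bound k t : k%:R * hsin t ^+ 2 * kern k t <= 1.
Proof.
have x0 : 0 <= hsin t ^+ 2 by rewrite exprn_ge0 ?hsin_ge0.
have x1 := hsin_sqr_le1 t.
suff h : (1 + k%:R * hsin t ^+ 2) * kern k t <= 1.
  by apply: le_trans h; rewrite ler_wpM2r ?kern_ge0 // lerDr.
rewrite kernE; move: (hsin t ^+ 2) x0 x1 => x x0 x1.
elim: k => [|j IH]; first by rewrite mul0r addr0 mul1r expr0.
apply: le_trans IH; rewrite exprS mulrA ler_wpM2r ?exprn_ge0 ?subr_ge0 //.
rewrite -[j.+1%:R]natr1; have : 0 <= j%:R :> R by [].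
nra.
Qed.

End HalfAngle.

(** * Smoothed step sequences and the scales of their polynomial *)

Section Localisation.
Variables (R : realType) (N : nat) (c : int -> R) (C0 : R) (Bad : seq int).
Hypotheses (sc : supp N c) (ec : forall n, c (- n) = c n).
Hypothesis hC0 : forall n, `|c n| <= C0.
Hypothesis hstep : forall n, n \notin Bad -> c (n + 1) = c n.

Let f := tp N c.
Let G : R := 2 * C0 * (size Bad)%:R.

Lemma C0_ge0 : 0 <= C0. Proof. exact: le_trans (hC0 0). Qed.

Lemma G_ge0 : 0 <= G. Proof. by rewrite !mulr_ge0 // C0_ge0. Qed.

(** Summation by parts: multiplication by [2 * sin (t / 2)] replaces the coefficients of [f] by the
    jumps of [c], at most [2 * C0] each and supported on [Bad]. *)
Lemma tp_hsin_le t : `|f t| * (2 * hsin t) <= G.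
Proof.
pose s (n : int) := sin (n%:~R * t + t / 2).
have e : f t * (2 * sin (t / 2)) = isum N.+1 (fun n => (c n - c (n + 1)) * s n).
  have s1 : supp N (fun n => c n * s n) by move=> n /sc ->; rewrite mul0r.
  have s2 : supp N (fun n => c n * s (n - 1)) by move=> n /sc ->; rewrite mul0r.
  rewrite (eq_isum _ (h' := fun n => c n * s n - c (n + 1) * s (n + 1 - 1))); last first.
    by move=> n; rewrite addrK mulrBl.
  rewrite isumB (isum_succ_supp s2) (isum_widen (leqnSn N) s1) -isumB.
  rewrite /f /tp /isum mulr_suml; apply: eq_bigr => i _; move: (i%:Z - N%:Z) => n.
  rewrite /s rmorphB rmorph1 /=.
  rewrite (_ : (n%:~R - 1) * t + t / 2 = n%:~R * t - t / 2); last by field.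
  by rewrite sinD sinB; ring.
have -> : `|f t| * (2 * hsin t) = `|f t * (2 * sin (t / 2))|.
  by rewrite !normrM normr_nat.
rewrite e /isum; apply: le_trans (ler_norm_sum _ _ _) _.
pose P (i : 'I_(2 * N.+1).+1) := (i%:Z - N.+1%:Z) \in Bad.
apply: le_trans (_ : \sum_(i < (2 * N.+1).+1 | P i) 2 * C0 <= _).
  rewrite [X in _ <= X]big_mkcond; apply: ler_sum => i _; rewrite /P.
  case: ifPn => [_|/hstep ->]; last by rewrite subrr mul0r normr0.
  rewrite normrM; apply: le_trans (_ : (C0 + C0) * 1 <= _); last by lra.
  apply: ler_pM => //; last exact: sin_max.
  by apply: le_trans (ler_normB _ _) _; rewrite lerD.
rewrite sumr_const -[X in X <= _]mulr_natr ler_wpM2l ?mulr_ge0 ?C0_ge0 // ler_nat.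
rewrite cardE -(size_map (fun i : 'I_(2 * N.+1).+1 => i%:Z - N.+1%:Z)).
apply: uniq_leq_size.
  rewrite map_inj_uniq ?enum_uniq // => i j /addIr [] /val_inj //.
by move=> n /mapP[j]; rewrite mem_enum => h ->.
Qed.

Lemma walks_avg k (m : int) M : (N + k + `|m| < M)%N ->
  avg M (fun t => f t * (kern k t * cos (m%:~R * t))) = walks k c m.
Proof.
move=> hM; rewrite -(avg_tp_cos (supp_walks (k := k) sc) (even_walks k ec) hM).
by apply: eq_avg => t; rewrite tp_walks // mulrA [f t * _]mulrC.
Qed.

Lemma avg_kern_le k M : (0 < k < M)%N -> avg M (kern k) <= (Num.sqrt k%:R)^-1 :> R.
Proof.
case/andP => k0 kM; have s0 : 0 < Num.sqrt k%:R :> R by rewrite sqrtr_gt0 ltr0n.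
have a0 : 0 <= avg M (kern k) :> R.
  by rewrite /avg mulr_ge0 ?invr_ge0 // sumr_ge0 // => i _; apply: kern_ge0.
rewrite -[X in _ <= X]mul1r ler_pdivlMr // -(ler_pXn2r (isT : (0 < 2)%N)) ?nnegrE ?(mulr_ge0 a0 (ltW s0)) //.
rewrite exprMn sqr_sqrtr // expr1n mulrC; exact: avg_kern_sqr.
Qed.

Lemma norm_avg_le M (g : R -> R) : `|avg M g| <= avg M (fun t => `|g t|).
Proof.
rewrite /avg normrM ger0_norm ?invr_ge0 // ler_wpM2l ?invr_ge0 //.
exact: ler_norm_sum.
Qed.

(** The difference of two neighbouring cosines supplies the factor [hsin t] needed for [tp_hsin_le];
    what remains is the mean of the kernel. *)
Lemma walks_lipschitz k (m : int) : (0 < k)%N ->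
  `|walks k c (m + 1) - walks k c m| <= G / Num.sqrt k%:R.
Proof.
move=> k0; pose M := (N + k + `|m| + 2)%N.
rewrite -(@walks_avg k (m + 1) M) -?(@walks_avg k m M); [|rewrite /M; lia|rewrite /M; lia].
rewrite -avgB.
apply: le_trans (_ : avg M (fun t => G * kern k t) <= _); last first.
  by rewrite avgZ ler_wpM2l ?G_ge0 // avg_kern_le // k0 /M; lia.
apply: le_trans (norm_avg_le _ _) _; apply: ler_avg => t.
rewrite -mulrBr -mulrBr !normrM (ger0_norm (kern_ge0 k t)) mulrCA mulrC.
rewrite ler_wpM2r ?kern_ge0 //; apply: le_trans (tp_hsin_le t).
by rewrite ler_wpM2l // cos_diff_le.
Qed.

(** The difference to [c m] vanishes on the window and is at most [2 * C0] outside it. A parabola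
    centred at [m] dominates it, and only the variance of the walk counts at [m]. *)
Lemma walks_flat k (m : int) (D : nat) : (0 < D)%N ->
  (forall j : int, (absz (j - m)%R <= D)%N -> c j = c m) ->
  `|walks k c m - c m| <= C0 * k%:R / D%:R ^+ 2.
Proof.
move=> D0 flat; have C00 := C0_ge0.
have D2 : 0 < D%:R ^+ 2 :> R by rewrite exprn_gt0 // ltr0n.
rewrite -walks_sub_cst.
have h j : `|c j - c m| <= 2 * C0 / D%:R ^+ 2 * (j - m)%:~R ^+ 2 + 0.
  rewrite addr0; have [le|gt] := leqP (absz (j - m)%R) D.
    rewrite flat // subrr normr0; apply: mulr_ge0; last exact: sqr_ge0.
    by apply: divr_ge0; [exact: mulr_ge0 | exact: ltW].
  rewrite mulrAC ler_pdivlMr //; apply: ler_pM; rewrite ?exprn_ge0 //.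
    by apply: le_trans (ler_normB _ _) _; rewrite mulr_natl mulr2n lerD.
  rewrite -[(j - m)%:~R ^+ 2]ger0_norm ?sqr_ge0 // normrX -intr_norm.
  rewrite lerXn2r ?nnegrE ?ler0n ?ler0z //.
  by rewrite -[D%:R]/((D%:Z)%:~R) ler_int; lia.
have := walks_quadratic_bound k h m.
rewrite subrr expr0n mulr0 !add0r => /le_trans; apply.
by rewrite le_eqVlt; apply/orP; left; apply/eqP; field; rewrite pnatr_eq0 -lt0n.
Qed.

(* [f] keeps a sign at the scales between [n1] and [n0]; elsewhere the difference
   of the two kernels is small against the bound [tp_hsin_le]. *)
Lemma avg_abs_zone (n1 h k' n0 : nat) (sg : R) M :
  (0 < n1)%N -> (n1 <= h)%N -> (2 * h <= k')%N -> (k' <= n0)%N -> (n0 < M)%N -> (N + k' < M)%N ->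
  `|sg| = 1 ->
  (forall t, (2 * n0%:R)^-1 < hsin t ^+ 2 < (2 * n1%:R)^-1 -> 0 <= sg * f t) ->
  avg M (fun t => `|f t| * (kern (2 * h) t - kern k' t)) <=
    sg * (walks (2 * h) c 0 - walks k' c 0) + 2 * (G * (k'%:R / n0%:R)) + 4 * (G * (n1%:R / h%:R)).
Proof.
move=> n10 n1h hk kn nM NM sg1 zone.
have h0 : (0 < h)%N by apply: leq_trans n1h.
have n00 : (0 < n0)%N by apply: leq_trans kn; apply: leq_trans hk; rewrite muln_gt0.
pose K (t : R) := kern (2 * h) t - kern k' t.
have K0 t : 0 <= K t by rewrite subr_ge0 kern_le.
pose s0 : R := Num.sqrt n0%:R; pose s1 : R := Num.sqrt n1%:R; pose sh : R := Num.sqrt h%:R.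
have s00 : 0 < s0 by rewrite sqrtr_gt0 ltr0n.
have s10 : 0 < s1 by rewrite sqrtr_gt0 ltr0n.
have sh0 : 0 < sh by rewrite sqrtr_gt0 ltr0n.
have e0 : s0 ^+ 2 = n0%:R by rewrite sqr_sqrtr.
have e1 : s1 ^+ 2 = n1%:R by rewrite sqr_sqrtr.
have eh : sh ^+ 2 = h%:R by rewrite sqr_sqrtr.
have G0 := G_ge0; have C00 := C0_ge0.
(* [E] covers the two ranges outside the zone. It is written with the kernels [kern n0] and [kern h]
   because their means are small. *)
pose E (t : R) := G * k'%:R / s0 * kern n0 t + 2 * G * n1%:R * s1 / h%:R * kern h t.
have s0g := ltW s00; have s1g := ltW s10; have shg := ltW sh0.
have kern_half (t : R) : hsin t ^+ 2 <= (2 * n0%:R)^-1 -> 1 <= 2 * kern n0 t.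
  move=> hx; have := @kern_sub_le R 0 n0 t (leq0n _).
  rewrite [kern 0 t]expr0.
  have : n0%:R * hsin t ^+ 2 <= n0%:R * (2 * n0%:R)^-1 by rewrite ler_wpM2l.
  rewrite (_ : n0%:R * (2 * n0%:R)^-1 = 2^-1 :> R); last first.
    by field; rewrite pnatr_eq0 -lt0n.
  by lra.
have near (t : R) : hsin t ^+ 2 <= (2 * n0%:R)^-1 -> `|f t| * K t <= G * k'%:R / s0 * kern n0 t.
  move=> hx; have q0 := hsin_ge0 t.
  have hq : hsin t * s0 <= 1.
    rewrite -(ler_pXn2r (isT : (0 < 2)%N)) ?nnegrE ?(mulr_ge0 q0 (ltW s00)) //.
    rewrite exprMn e0 expr1n -ler_pdivlMr ?ltr0n // mul1r; apply: le_trans hx _.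
    by rewrite lef_pV2 ?posrE ?mulr_gt0 ?ltr0n // ler_peMl // ler1n.
  apply: le_trans (_ : `|f t| * (k'%:R * hsin t ^+ 2) <= _).
    by rewrite ler_wpM2l // kern_sub_le.
  rewrite (_ : `|f t| * (k'%:R * hsin t ^+ 2) = (`|f t| * (2 * hsin t)) * (k'%:R * (hsin t / 2))); last by field.
  apply: le_trans (_ : G * (k'%:R * (hsin t / 2)) <= _).
    by rewrite ler_wpM2r ?tp_hsin_le // mulr_ge0 // divr_ge0.
  rewrite (_ : G * k'%:R / s0 * kern n0 t = G * (k'%:R * (kern n0 t / s0))); last by ring.
  rewrite ler_wpM2l // ler_wpM2l // ler_pdivlMr //.
  by have := kern_half t hx; lra.
(* Here [kern (2 * h)] is the square of [kern h]: one factor is at most [2 * n1 / h], the other is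
   kept for averaging. *)
have far (t : R) : (2 * n1%:R)^-1 <= hsin t ^+ 2 ->
    `|f t| * K t <= 2 * G * n1%:R * s1 / h%:R * kern h t.
  move=> hx; have q0 := hsin_ge0 t; have k0 := kern_ge0 h t.
  have n1R : 0 < n1%:R :> R by rewrite ltr0n.
  have hR : 0 < h%:R :> R by rewrite ltr0n.
  have x1 : 1 <= 2 * n1%:R * hsin t ^+ 2.
    by move: hx; rewrite -[X in X <= _]mulr1 ler_pdivrMl // mulr_gt0.
  have q1 : 1 <= 2 * s1 * hsin t.
    have p0 : 0 <= 2 * s1 * hsin t by rewrite !mulr_ge0.
    rewrite -(ler_pXn2r (isT : (0 < 2)%N)) ?nnegrE // expr1n !exprMn e1.
    by move: x1; nra.
  have a1 : `|f t| <= s1 * G.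
    apply: le_trans (_ : `|f t| * (2 * s1 * hsin t) <= _); first by rewrite ler_peMr.
    rewrite (_ : _ * (2 * s1 * hsin t) = s1 * (`|f t| * (2 * hsin t))); last by ring.
    by rewrite ler_wpM2l ?tp_hsin_le.
  have a2 : kern h t <= 2 * n1%:R / h%:R.
    rewrite ler_pdivlMr //; apply: le_trans (_ : kern h t * h%:R * (2 * n1%:R * hsin t ^+ 2) <= _).
      by rewrite ler_peMr // mulr_ge0.
    have := kern_inv_bound h t.
    rewrite (_ : kern h t * _ * _ = 2 * n1%:R * (h%:R * hsin t ^+ 2 * kern h t)); last by ring.
    by move=> hh; rewrite ler_piMr // mulr_ge0.
  apply: le_trans (_ : s1 * G * (2 * n1%:R / h%:R * kern h t) <= _); last first.
    by rewrite le_eqVlt; apply/orP; left; apply/eqP; ring.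
  apply: ler_pM => //.
  apply: le_trans (_ : kern (2 * h) t <= _); first by rewrite lerBlDr lerDl kern_ge0.
  by rewrite /kern mulnC exprM -/(kern h t) expr2 ler_wpM2r.
have near0 (t : R) : 0 <= G * k'%:R / s0 * kern n0 t.
  by rewrite !mulr_ge0 ?invr_ge0 ?kern_ge0.
have far0 (t : R) : 0 <= 2 * G * n1%:R * s1 / h%:R * kern h t.
  by rewrite !mulr_ge0 ?invr_ge0 ?kern_ge0.
(* Where the sign is unknown, replacing the absolute value by the signed one costs at most twice the
   absolute value. *)
have out (t : R) : `|f t| * K t <= E t -> `|f t| * K t <= sg * (f t * K t) + 2 * E t.
  move=> le; have : `|sg * (f t * K t)| = `|f t| * K t by rewrite !normrM sg1 mul1r (ger0_norm (K0 t)).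
  have := lerNnormlW (lexx `|sg * (f t * K t)|).
  by move=> h1 h2; rewrite h2 in h1; lra.
have ptw (t : R) : `|f t| * K t <= sg * (f t * K t) + 2 * E t.
  have [z1|z1] := lerP (hsin t ^+ 2) (2 * n0%:R)^-1.
    by apply: out; rewrite /E; have := near t z1; have := far0 t; lra.
  have [z2|z2] := lerP (2 * n1%:R)^-1 (hsin t ^+ 2).
    by apply: out; rewrite /E; have := far t z2; have := near0 t; lra.
  have p : 0 <= sg * f t by apply: zone; rewrite z1.
  have -> : `|f t| = sg * f t by rewrite -[LHS]mul1r -sg1 -normrM ger0_norm.
  have Ege0 : 0 <= E t by rewrite /E; have := near0 t; have := far0 t; lra.
  by rewrite -mulrA lerDl mulr_ge0.
apply: le_trans (ler_avg M ptw) _.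
rewrite avgD !avgZ.
have -> : avg M (fun t => f t * K t) = walks (2 * h) c 0 - walks k' c 0.
  rewrite -(@walks_avg (2 * h) 0 M) -?(@walks_avg k' 0 M); [|lia|lia].
  by rewrite -avgB; apply: eq_avg => t; rewrite mul0r cos0 !mulr1 mulrBr.
rewrite -addrA lerD2l avgD !avgZ.
have b1 : G * k'%:R / s0 * avg M (kern n0) <= G * (k'%:R / n0%:R).
  apply: le_trans (_ : G * k'%:R / s0 * s0^-1 <= _).
    by rewrite ler_wpM2l ?avg_kern_le ?n00 // !mulr_ge0 ?invr_ge0.
  by rewrite -e0 le_eqVlt; apply/orP; left; apply/eqP; field; rewrite gt_eqF.
have b2 : 2 * G * n1%:R * s1 / h%:R * avg M (kern h) <= 2 * (G * (n1%:R / h%:R)).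
  apply: le_trans (_ : 2 * G * n1%:R * s1 / h%:R * sh^-1 <= _).
    rewrite ler_wpM2l ?avg_kern_le ?h0 //; last by lia.
    by rewrite !mulr_ge0 ?invr_ge0.
  rewrite (_ : _ * sh^-1 = 2 * (G * (n1%:R / h%:R)) * (s1 / sh)); last by ring.
  apply: ler_piMr; first by rewrite !mulr_ge0 ?invr_ge0.
  by rewrite ler_pdivrMr // mul1r ler_sqrt ?ler_nat // ltr0n.
by move: b1 b2; lra.
Qed.

End Localisation.

Lemma free_block (T : eqType) (cs : seq T) (P : nat -> T -> bool) :
  (forall z i j, P i z -> P j z -> i = j) ->
  exists2 i, (i <= size cs)%N & forall z, z \in cs -> ~~ P i z.
Proof.
move=> disj; apply: contrapT => no.
have some (i : 'I_(size cs).+1) : has (P i) cs.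
  apply: contrapT => /negP /hasPn h; apply: no; exists (val i); first by rewrite -ltnS ltn_ord.
  exact: h.
have fl (i : 'I_(size cs).+1) : (find (P i) cs < size cs)%N by rewrite -has_find.
have [z0] : exists z0 : T, z0 \in cs by have /hasP[z zc _] := some ord0; exists z.
move=> _; pose f (i : 'I_(size cs).+1) := Ordinal (fl i).
have : injective f.
  move=> i j /(congr1 val) /= e; apply: val_inj; apply: (disj (nth z0 cs (find (P i) cs))).
    exact: nth_find.
  by rewrite e; apply: nth_find.
by move=> /leq_card; rewrite !card_ord ltnn.
Qed.

Section Zone.
Variables (R : realType) (f : R -> R) (cs : seq R) (sigma : R).
Hypothesis sigma1 : `|sigma| = 1.
Hypothesis sgn : forall t, 0 <= sigma * f t * \prod_(z <- cs) (2 * cos t - z).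

(** [(2 - z) / 4] is the value of [hsin t ^+ 2] at which [2 * cos t = z], so every factor keeps its
    sign in the zone. *)
Lemma zone_sign (lo hi : R) :
  (forall z, z \in cs -> ~~ (lo < (2 - z) / 4 < hi)) ->
  exists2 sg : R, `|sg| = 1 & forall t, lo < hsin t ^+ 2 < hi -> 0 <= sg * f t.
Proof.
move=> free.
have [tau tau1 htau] : exists2 tau : R, `|tau| = 1 &
    forall t, lo < hsin t ^+ 2 < hi -> 0 < tau * \prod_(z <- cs) (2 * cos t - z).
  elim: (cs) free => [|z l IH] free.
    by exists 1; rewrite ?normr1 // => t _; rewrite big_nil mulr1.
  have [|tau tau1 htau] := IH.
    by move=> w wl; apply: free; rewrite inE wl orbT.
  have := free z (mem_head _ _); rewrite negb_and -!leNgt => /orP[h|h].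
    exists (- tau); first by rewrite normrN.
    move=> t ht; rewrite big_cons mulNr mulrCA -mulNr mulr_gt0 ?htau //.
    by have := hsin_sqr t; case/andP: ht => h1 h2; lra.
  exists tau => // t ht; rewrite big_cons mulrCA mulr_gt0 ?htau //.
  by have := hsin_sqr t; case/andP: ht => h1 h2; lra.
exists (sigma * tau); first by rewrite normrM sigma1 tau1 mulr1.
move=> t /htau; set P := \prod_(z <- cs) _ => tP.
have := sgn t; rewrite -/P => sP.
have P0 : P != 0 by apply: contraTneq tP => ->; rewrite mulr0 ltxx.
rewrite -(pmulr_lge0 _ (_ : 0 < P ^+ 2)); last by rewrite lt_neqAle sqr_ge0 eq_sym sqrf_eq0 P0.
rewrite (_ : _ * P ^+ 2 = (sigma * f t * P) * (tau * P)); last by ring.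
by rewrite mulr_ge0 // ltW.
Qed.

End Zone.

(** * Counting the nonzero coefficients of a step sequence with a gap *)

Section Conclusion.
Variables (R : realType) (N : nat) (c : int -> R) (C0 gam : R) (Bad : seq int).
Variables (cs : seq R) (sigma : R) (K0 J : nat).
Hypotheses (sc : supp N c) (ec : forall n, c (- n) = c n).
Hypothesis hC0 : forall n, `|c n| <= C0.
Hypothesis hstep : forall n, n \notin Bad -> c (n + 1) = c n.
Hypothesis hgap : forall n, n \notin Bad -> c n = 0 \/ gam <= `|c n|.
Hypothesis sigma1 : `|sigma| = 1.
Hypothesis sgn : forall t, 0 <= sigma * tp N c t * \prod_(z <- cs) (2 * cos t - z).
Hypotheses (gam0 : 0 < gam) (hK : C0 <= K0%:R * gam) (K00 : (0 < K0)%N).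
Hypotheses (sJ : (size Bad <= J)%N) (J0 : (0 < J)%N).

Let k := size cs.
Let G : R := 2 * C0 * (size Bad)%:R.
(** [q] is the ratio of successive smoothing times and [g] that of the corresponding lengths. [I] is
    such that [I * gam / 20] reaches the telescoping bound [2 * C0], [D] makes the error of
    [walks_flat] at most [gam / 10], and [80 * J * K0] makes the drift across the neighbourhoods of
    [Bad] at most [gam / 40]. *)
Let g := ((80 * J * K0) ^ 2)%N.
Let q := (g ^ 2)%N.
Let I := (40 * K0)%N.
Let D := (20 * K0)%N.

Let C00 : 0 <= C0. Proof. exact: C0_ge0 hC0. Qed.
Let G0 : 0 <= G. Proof. by rewrite !mulr_ge0. Qed.
Let JK0 : (0 < J * K0)%N. Proof. by rewrite muln_gt0 J0. Qed.
Let g0 : (0 < g)%N. Proof. by rewrite expn_gt0 -mulnA muln_gt0 JK0. Qed.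
Let q0 : (0 < q)%N. Proof. by rewrite expn_gt0 g0. Qed.
Let GJ : G <= 2 * (K0 * J)%:R * gam.
Proof.
rewrite /G natrM; have : (size Bad)%:R <= J%:R :> R by rewrite ler_nat.
have : 0 <= (size Bad)%:R :> R by [].
move=> h1 h2; apply: le_trans (_ : 2 * C0 * J%:R <= _); first by rewrite ler_wpM2l // mulr_ge0.
rewrite (_ : 2 * (K0%:R * J%:R) * gam = 2 * (K0%:R * gam) * J%:R); last by ring.
by rewrite ler_wpM2r // ler_pM2l.
Qed.

(** Cosines being at most 1 in absolute value, the mean in [avg_abs_zone] serves every [m]: the
    values at 0, which telescope over the scales, control the effect of further smoothing
    everywhere. *)
Lemma walks_diff_le (n1 h k' n0 : nat) (sg : R) (m : int) :
  (0 < n1)%N -> (n1 <= h)%N -> (2 * h <= k')%N -> (k' <= n0)%N -> `|sg| = 1 ->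
  (forall t, (2 * n0%:R)^-1 < hsin t ^+ 2 < (2 * n1%:R)^-1 -> 0 <= sg * tp N c t) ->
  `|walks (2 * h) c m - walks k' c m| <=
    sg * (walks (2 * h) c 0 - walks k' c 0) + 2 * (G * (k'%:R / n0%:R)) + 4 * (G * (n1%:R / h%:R)).
Proof.
move=> n10 n1h hk kn sg1 zone; pose M := (N + n0 + `|m| + 1)%N.
apply: le_trans (avg_abs_zone (M := M) sc ec hC0 hstep n10 n1h hk kn _ _ sg1 zone); [|rewrite /M; lia|rewrite /M; lia].
rewrite -(@walks_avg _ _ _ sc ec (2 * h) m M) -?(@walks_avg _ _ _ sc ec k' m M); [|rewrite /M; lia|rewrite /M; lia].
rewrite -avgB; apply: le_trans (norm_avg_le _ _) _; apply: ler_avg => t.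
rewrite -mulrBr -mulrBl !normrM ler_wpM2l // ger0_norm ?subr_ge0 ?kern_le //.
by rewrite ler_piMr ?subr_ge0 ?kern_le // cos_max.
Qed.

(* The exponents fall into blocks of [I.+3] scales; some block has no sign change. *)
Let step_exp b i := (b * I.+3 + i)%N.

(* Inside the block the values at 0 telescope, so one of the [I] steps is small. *)
Lemma quiet_scale : exists e, (e < k.+1 * I.+3)%N /\
  forall m, `|walks (2 * q ^ e) c m - walks (2 * q ^ e.+1) c m| <= gam / 10.
Proof.
pose P b (z : R) := (2 * (q ^ (step_exp b.+1 0))%:R)^-1 < (2 - z) / 4 < (2 * (q ^ (step_exp b 0))%:R)^-1.
have q1 : (1 < q)%N.
  by rewrite /q /g -expnM -{1}(exp1n 4) ltn_exp2r // -mulnA; move: JK0; lia.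
have qp e : 0 < (q ^ e)%:R :> R by rewrite ltr0n expn_gt0 q0.
have qp2 e : 0 < 2 * (q ^ e)%:R :> R by rewrite mulr_gt0.
have [|b bk free] := @free_block R cs P.
  have mono b b' z : P b z -> P b' z -> (b' <= b)%N.
    move=> /andP[h1 _] /andP[_ h2]; rewrite leqNgt; apply/negP => lt.
    have := lt_trans h1 h2; rewrite ltf_pV2 ?posrE ?qp2 //.
    rewrite ltr_pM2l // ltr_nat ltn_exp2l // /step_exp !addn0 ltn_pmul2r //.
    by rewrite ltnS leqNgt lt.
  by move=> z i j hi hj; apply/eqP; rewrite eqn_leq (mono _ _ _ hi hj) (mono _ _ _ hj hi).
have [sg sg1 zone] := zone_sign sigma1 sgn free.
pose n1 := (q ^ step_exp b 0)%N; pose n0 := (q ^ step_exp b.+1 0)%N.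
(* The scales used keep a margin of one factor [q] to both ends of the block, so the two error terms
   of [walks_diff_le] sum to at most [8 * (G / q%:R)]. *)
pose sc_ i := (2 * q ^ step_exp b i.+1)%N.
have qR : 0 < q%:R :> R by rewrite ltr0n.
have Gq : 8 * (G / q%:R) <= gam / 20.
  rewrite mulrA ler_pdivrMr //; apply: le_trans (_ : 8 * (2 * (K0 * J)%:R * gam) <= _).
    by rewrite ler_pM2l.
  rewrite [X in _ <= X](_ : _ = q%:R / 20 * gam); last by field.
  rewrite mulrA ler_pM2r //.
  have : (320 * (K0 * J) <= q)%N.
    rewrite /q /g -expnM -mulnA [(J * K0)%N]mulnC.
    have m0 : (0 < K0 * J)%N by rewrite mulnC.
    have x80 : (80 <= 80 * (K0 * J))%N by rewrite leq_pmulr.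
    have -> : (320 * (K0 * J) = 4 * (80 * (K0 * J)))%N by clear; lia.
    move: (80 * (K0 * J))%N x80 => x x80; rewrite [(x ^ _)%N](expnSr x 3) leq_mul2r.
    apply/orP; right; apply: leq_trans (_ : x ^ 1 <= _)%N; first by rewrite expn1; lia.
    have x0 : (0 < x)%N by lia.
    by rewrite leq_pexp2l.
  rewrite -(ler_nat R) natrM; set w := (K0 * J)%:R; set v := q%:R; lra.
have bound i m : (i < I)%N ->
  `|walks (sc_ i) c m - walks (sc_ i.+1) c m| <= sg * (walks (sc_ i) c 0 - walks (sc_ i.+1) c 0) + 8 * (G / q%:R).
  move=> iI; apply: le_trans (@walks_diff_le n1 (q ^ step_exp b i.+1)%N (sc_ i.+1) n0 sg m _ _ _ _ sg1 zone) _.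
  - by rewrite expn_gt0 q0.
  - by rewrite leq_pexp2l // /step_exp leq_add2l.
  - by rewrite leq_mul2l leq_pexp2l // /step_exp leq_add2l.
  - apply: leq_trans (_ : q * q ^ step_exp b i.+2 <= _)%N; first by rewrite leq_mul2r q1 orbT.
    by rewrite -expnS leq_pexp2l // /step_exp mulSn addn0; lia.
  rewrite -addrA lerD2l.
  have a1 : (sc_ i.+1)%:R / n0%:R <= 2 / q%:R :> R.
    rewrite ler_pdivrMr ?qp // mulrAC ler_pdivlMr //.
    rewrite -!natrM ler_nat /sc_ /n0 -mulnA leq_mul2l /= -expnSr leq_pexp2l //.
    by rewrite /step_exp mulSn addn0; lia.
  have a2 : n1%:R / (q ^ step_exp b i.+1)%:R <= 1 / q%:R :> R.
    rewrite ler_pdivrMr ?qp // mulrAC ler_pdivlMr // mul1r.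
    by rewrite -!natrM ler_nat /n1 -expnSr leq_pexp2l // /step_exp addn0 addnS ltnS leq_addr.
  have b1 := ler_wpM2l G0 a1; have b2 := ler_wpM2l G0 a2.
  rewrite [X in _ <= X](_ : _ = 2 * (2 * (G / q%:R)) + 4 * (G / q%:R)); last by ring.
  apply: lerD; rewrite ler_pM2l //; [apply: le_trans b1 _ | apply: le_trans b2 _].
    by rewrite mulrCA.
  by rewrite mul1r.
have tele : \sum_(i < I) sg * (walks (sc_ i) c 0 - walks (sc_ i.+1) c 0) <= 2 * C0.
  rewrite -mulr_sumr -(big_mkord xpredT (fun i => walks (sc_ i) c 0 - walks (sc_ i.+1) c 0)).
  rewrite -[\sum_(_ <= _ < _) _]opprK -sumrN.
  rewrite (eq_bigr (fun i => walks (sc_ i.+1) c 0 - walks (sc_ i) c 0)); last by move=> i _; rewrite opprB.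
  rewrite (telescope_sumr (fun i => walks (sc_ i) c 0)) // opprB.
  apply: le_trans (ler_norm _) _; rewrite normrM sg1 mul1r; apply: le_trans (ler_normB _ _) _.
  by rewrite mulr_natl mulr2n lerD // walks_le.
have I0 : (0 < I)%N by rewrite muln_gt0 K00.
have [i iI hi] : exists2 i, (i < I)%N & sg * (walks (sc_ i) c 0 - walks (sc_ i.+1) c 0) <= gam / 20.
  apply: contrapT => no; move: tele; apply/negP; rewrite -ltNge.
  apply: le_lt_trans (_ : \sum_(i < I) gam / 20 < _).
    rewrite sumr_const card_ord.
    have -> : gam / 20 *+ I = 2 * (K0%:R * gam) by rewrite -[_ *+ I]mulr_natl natrM; field.
    by rewrite ler_pM2l.
  rewrite (bigD1 (Ordinal I0)) //= [X in _ < X](bigD1 (Ordinal I0)) //=.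
  have big i : (i < I)%N -> gam / 20 < sg * (walks (sc_ i) c 0 - walks (sc_ i.+1) c 0).
    by move=> iI; rewrite ltNge; apply/negP => h; apply: no; exists i.
  by apply: ltr_leD; [exact: big | apply: ler_sum => j _; apply/ltW/big].
exists (step_exp b i.+1); split.
  rewrite /step_exp mulSn addnC -addSn leq_add //; last by rewrite leq_mul2r bk orbT.
  by rewrite !ltnS ltnW // ltnW.
move=> m; rewrite [X in _ <= X](_ : _ = gam / 20 + gam / 20); last by field.
have -> : (step_exp b i.+1).+1 = step_exp b i.+2 by rewrite /step_exp !addnS.
apply: le_trans (bound i m iI) _; exact: lerD.
Qed.

(* Otherwise some [m0] in [Lam] is far from [Bad]. To the right of it the smoothed
   sequence tends to 0 by small steps, so it crosses the interval between [gam / 5]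
   and [4 * gam / 5], which it avoids far from [Bad], over a stretch too long to be
   covered by the neighbourhoods of [Bad]. *)
Lemma nonzero_coeffs_le (Lam : seq int) : uniq Lam -> (forall n, n \in Lam -> c n != 0) ->
  (size Lam <= 3 * J * D * g ^ (k.+1 * I.+3))%N.
Proof.
move=> uL hL; have [e [he quiet]] := quiet_scale.
have gp (i : nat) : (0 < g ^ i)%N by rewrite expn_gt0 g0.
pose De := (D * g ^ e)%N.
have D0 : (0 < D)%N by rewrite muln_gt0 K00.
have De0 : (0 < De)%N by rewrite muln_gt0 D0 gp.
have J3 : (J * (2 * De + 1) <= 3 * J * D * g ^ e)%N.
  by rewrite -[(3 * J * D * _)%N]mulnA -/De [(3 * J)%N]mulnC -mulnA leq_mul2l; apply/orP; right; clear -De0; lia.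
rewrite leqNgt; apply/negP => big.
pose good (m : int) := all (fun z : int => (De < absz (m - z)%R)%N) Bad.
have bad_small (l : seq int) : uniq l -> (forall m, m \in l -> ~~ good m) ->
    (size l <= J * (2 * De + 1))%N.
  move=> ul hl; apply: leq_trans (_ : size Bad * (2 * De + 1) <= _)%N; last by rewrite leq_mul2r sJ orbT.
  rewrite -(size_iota 0 (2 * De + 1)) -(size_allpairs (fun (z : int) (i : nat) => z + i%:Z - De%:Z)).
  apply: uniq_leq_size => // m /hl /allPn[z zB]; rewrite -leqNgt => hz.
  apply/allpairsP; exists (z, absz (m - z + De%:Z)%R); split=> //.
    by rewrite mem_iota /= add0n; lia.
  by rewrite /=; lia.
have flat m : good m -> forall j : int, (absz (j - m)%R <= De)%N -> c j = c m.
  move=> /allP gm.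
  have up (i : nat) : (i <= De)%N -> c (m + i%:Z) = c m.
    elim: i => [|i IH] hi; first by rewrite addr0.
    rewrite -IH ?(ltnW hi) //.
    rewrite -(@hstep (m + i%:Z)); first by congr c; lia.
    by apply/negP => /gm; lia.
  have down (i : nat) : (i <= De)%N -> c (m - i%:Z) = c m.
    elim: i => [|i IH] hi; first by rewrite subr0.
    rewrite -IH ?(ltnW hi) //.
    have -> : m - i%:Z = (m - i.+1%:Z) + 1 by lia.
    rewrite (@hstep (m - i.+1%:Z)) //.
    by apply/negP => /gm; lia.
  move=> j hj; have [mj|jm] := lerP m j.
    by have -> : j = m + (absz (j - m)%R)%:Z; [lia | apply: up].
  by have -> : j = m - (absz (j - m)%R)%:Z; [lia | apply: down].
have eD : (De ^ 2 = D ^ 2 * q ^ e)%N by rewrite expnMn -!expnM [(e * 2)%N]mulnC.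
have close m : good m -> `|walks (2 * q ^ e) c m - c m| <= gam / 10.
  move=> gm; apply: le_trans (walks_flat hC0 (2 * q ^ e)%N De0 (flat m gm)) _.
  have qe0 : 0 < (q ^ e)%:R :> R by rewrite ltr0n expn_gt0 q0.
  have D20 : 0 < (D ^ 2)%:R :> R by rewrite ltr0n expn_gt0 D0.
  rewrite -natrX eD (natrM _ 2 (q ^ e)) (natrM _ (D ^ 2) (q ^ e)) ler_pdivrMr ?mulr_gt0 // !mulrA ler_pM2r //.
  have DD : D%:R <= (D ^ 2)%:R :> R by rewrite ler_nat -{1}[D]expn1 leq_pexp2l.
  have hD : D%:R = 20 * K0%:R :> R by rewrite /D natrM.
  apply: le_trans (_ : gam / 10 * D%:R <= _); last by rewrite ler_wpM2l // divr_ge0 // ltW.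
  by rewrite hD; have := hK; lra.
have close' m : good m -> `|walks (2 * q ^ e.+1) c m - c m| <= gam / 5.
  move=> gm; have h1 := close m gm; have h2 := quiet m.
  set w := walks (2 * q ^ e) c m in h1 h2; set w' := walks _ c m in h2 *.
  rewrite (_ : w' - c m = (w - c m) - (w - w')); last by ring.
  by apply: le_trans (ler_normB _ _) _; lra.
have lower m : `|c m| <= `|walks (2 * q ^ e.+1) c m| + `|walks (2 * q ^ e.+1) c m - c m|.
  by rewrite -{1}(subKr (walks (2 * q ^ e.+1) c m) (c m)); apply: ler_normB.
have gap m : good m -> c m = 0 \/ gam <= `|c m|.
  move=> gm; apply: hgap; apply/negP => /(allP gm).
  by rewrite subrr.
have dich m : good m -> `|walks (2 * q ^ e.+1) c m| <= gam / 5 \/ gam * 4 / 5 <= `|walks (2 * q ^ e.+1) c m|.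
  move=> gm; have h3 := close' m gm.
  have [e0|ge] := gap m gm; first by left; move: h3; rewrite e0 subr0.
  by right; have := lower m; lra.
have [m0 m0L gm0] : exists2 m, m \in Lam & good m.
  apply: contrapT => no.
  have hb m : m \in Lam -> ~~ good m by move=> mL; apply/negP => gm; apply: no; exists m.
  have le : (3 * J * D * g ^ e <= 3 * J * D * g ^ (k.+1 * I.+3))%N.
    by rewrite leq_mul2l leq_pexp2l ?orbT // ltnW.
  by have := leq_trans (leq_trans (bad_small Lam uL hb) J3) le; rewrite leqNgt big.
pose A (i : nat) : R := `|walks (2 * q ^ e.+1) c (m0 + i%:Z)|.
have A0 : gam / 2 <= A 0%N.
  rewrite /A addr0; have [e0|ge] := gap m0 gm0; first by have := hL m0 m0L; rewrite e0 eqxx.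
  move: (lower m0) (close' m0 gm0); set w := walks _ c m0 => h1 h2; have := gam0; lra.
pose eta := G / (g ^ e.+1)%:R.
have gR i : 0 < (g ^ i)%:R :> R by rewrite ltr0n.
have lip i : `|A i.+1 - A i| <= eta.
  apply: le_trans (ler_dist_dist _ _) _.
  have -> : m0 + i.+1%:Z = m0 + i%:Z + 1 by lia.
  have q2 : (0 < 2 * q ^ e.+1)%N by rewrite muln_gt0 expn_gt0 q0.
  apply: le_trans (walks_lipschitz sc ec hC0 hstep (m0 + i%:Z) q2) _.
  rewrite ler_wpM2l // lef_pV2 ?posrE ?sqrtr_gt0 ?ltr0n //.
  rewrite -[X in X <= _]ger0_norm // -sqrtr_sqr ler_sqrt ?ltr0n //.
  rewrite -natrX ler_nat -expnM mulnC expnM.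
  by rewrite leq_pmull.
have fin : exists i, A i < gam / 2.
  exists (N + 2 * q ^ e.+1 + `|m0| + 1)%N; rewrite /A (supp_walks (k := 2 * q ^ e.+1) sc); last by lia.
  by rewrite normr0 divr_gt0.
case: (ex_minnP fin) => i0 hi0 mini.
have i00 : (0 < i0)%N by case: (i0) hi0 => //; rewrite ltNge A0.
have prev : gam / 2 <= A i0.-1.
  by rewrite leNgt; apply/negP => /mini; rewrite leqNgt prednK // leqnn.
have low0 : gam / 2 - eta <= A i0.
  have := lip i0.-1; rewrite prednK // ler_norml; move/andP => [h _].
  by move: h prev; lra.
have drift (j : nat) : `|A (i0 + j)%N - A i0| <= j%:R * eta.
  elim: j => [|j IH]; first by rewrite addn0 subrr normr0 mul0r.
  rewrite addnS -natr1 mulrDl mul1r.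
  rewrite (_ : A (i0 + j).+1 - A i0 = (A (i0 + j)%N - A i0) + (A (i0 + j).+1 - A (i0 + j)%N)); last by ring.
  by apply: le_trans (ler_normD _ _) _; apply: lerD.
(* At most [l] integers are not good, so [l.+1] consecutive ones at which [A] stays close to
   [gam / 2] give the contradiction. *)
pose l := (J * (2 * De + 1))%N.
have eta0 : 0 <= eta by rewrite divr_ge0.
have small : l.+1%:R * eta <= gam / 40.
  have le4 : (l.+1 <= 4 * (J * De))%N.
    have : (0 < J * De)%N by rewrite muln_gt0 J0.
    have : (J <= J * De)%N by rewrite leq_pmulr.
    by rewrite /l mulnDr muln1 mulnCA; move: (J * De)%N => x; lia.
  apply: le_trans (_ : (4 * (J * De))%:R * eta <= _); first by rewrite ler_wpM2r // ler_nat.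
  rewrite /eta mulrA ler_pdivrMr //.
  apply: le_trans (_ : (4 * (J * De))%:R * (2 * (K0 * J)%:R * gam) <= _); first by rewrite ler_wpM2l.
  have -> : (g ^ e.+1)%:R = 6400 * (J%:R * K0%:R) ^+ 2 * (g ^ e)%:R :> R.
    by rewrite expnS (natrM _ g (g ^ e)) /g (natrX _ (80 * J * K0) 2) !natrM; ring.
  have -> : (4 * (J * De))%:R = 80 * J%:R * K0%:R * (g ^ e)%:R :> R.
    by rewrite /De /D (natrM _ 4 _) (natrM _ J _) (natrM _ (20 * K0) (g ^ e)) natrM; ring.
  by rewrite natrM le_eqVlt; apply/orP; left; apply/eqP; field.
have nogood (j : nat) : (j <= l)%N -> ~~ good (m0 + (i0 + j)%N%:Z).
  move=> jl; apply/negP => /dich; rewrite -/(A (i0 + j)%N).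
  have h1 : j%:R * eta <= l%:R * eta by rewrite ler_wpM2r // ler_nat.
  have := le_trans (drift j) h1; rewrite ler_norml => /andP[h2 h3].
  move: small; rewrite -natr1 mulrDl mul1r => h4.
  by move: hi0 low0 h2 h3 h4; set X := A _; set Y := A _; set Z := l%:R * eta; lra.
pose L := [seq m0 + (i0 + j)%N%:Z | j <- iota 0 l.+1].
have uLL : uniq L.
  by rewrite map_inj_uniq ?iota_uniq // => a b /addrI [] /addnI.
have hb m : m \in L -> ~~ good m.
  by move=> /mapP[j]; rewrite mem_iota add0n ltnS => jl ->; apply: nogood.
by have := bad_small L uLL hb; rewrite size_map size_iota ltnn.
Qed.

End Conclusion.

(** * Sign changes and zeros *)

Section Signs.
Variable R : realType.

Lemma chebyshev (n : nat) : exists p : {poly R}, forall t, p.[cos t] = cos (n%:R * t).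
Proof.
suff [p [q [h _]]] : exists p q : {poly R}, (forall t, p.[cos t] = cos (n%:R * t)) /\
    (forall t, q.[cos t] = cos (n.+1%:R * t)) by exists p.
elim: n => [|n [p [q [hp hq]]]].
  exists 1, 'X; split=> t; rewrite hornerE ?mul0r ?cos0 ?mul1r //.
exists q, (2%:P * 'X * q - p); split=> // t.
rewrite !hornerE hp hq.
have -> : n.+2%:R * t = n.+1%:R * t + t by rewrite -natr1; ring.
have -> : n%:R * t = n.+1%:R * t - t by rewrite -natr1; ring.
by rewrite cosB cosD; ring.
Qed.

Lemma cosine_poly_horner N (a : nat -> int) :
  exists T : {poly R}, forall t, T.[cos t] = cosine_poly N a t.
Proof.
rewrite /cosine_poly; elim: N => [|N [T hT]].
  by exists ((a 0%N)%:~R%:P) => t; rewrite big_nat1 hornerE mul0r cos0 mulr1.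
have [p hp] := chebyshev N.+1.
exists (T + (a N.+1)%:~R%:P * p) => t.
by rewrite !hornerE hT hp [RHS]big_nat_recr.
Qed.

Lemma sign_no_root (T : {poly R}) (x y : R) : x <= y ->
  (forall z, x <= z <= y -> ~~ root T z) -> 0 < T.[x] * T.[y].
Proof.
move=> xy nr.
have nx : T.[x] != 0 by apply: nr; rewrite lexx.
have ny : T.[y] != 0 by apply: nr; rewrite lexx andbT.
rewrite lt_neqAle eq_sym mulf_neq0 //= leNgt; apply/negP => neg.
have [Tx|Tx] := ltrP T.[x] 0.
  have Ty : 0 <= T.[y] by rewrite -(nmulr_rle0 _ Tx) ltW.
  have [|z zz rz] := @poly_ivt _ T x y xy; first by rewrite (ltW Tx) Ty.
  by have := nr z zz; rewrite rz.
have Tx' : 0 < T.[x] by rewrite lt_neqAle eq_sym nx.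
have Ty : T.[y] <= 0 by rewrite -(pmulr_rle0 _ Tx') ltW.
have [|z zz rz] := @poly_ivt _ (- T) x y xy; first by rewrite !hornerN oppr_le0 oppr_ge0 Tx Ty.
by have := nr z zz; rewrite -rootN rz.
Qed.

(** [cs] collects the roots of odd multiplicity in [-1, 1]: each root factored out is added to the
    list if absent and removed if present. *)
Lemma sign_roots (T : {poly R}) : T != 0 -> exists (cs : seq R) (sg : R),
  [/\ uniq cs, forall z, z \in cs -> -1 <= z <= 1 /\ root T z, `|sg| = 1 &
   forall x, -1 <= x <= 1 -> 0 <= sg * T.[x] * \prod_(z <- cs) (x - z)].
Proof.
have [n] := ubnP (size T); elim: n T => // n IH T; rewrite ltnS => sT T0.
have [[z zz rz]|no] := pselect (exists2 z, -1 <= z <= 1 & root T z); last first.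
  have nr z : -1 <= z <= 1 -> ~~ root T z.
    by move=> zz; apply/negP => rz; apply: no; exists z.
  have T1 : T.[1] != 0 by apply: nr; rewrite lexx andbT; lra.
  exists [::], (Num.sg T.[1]); split=> //; first by rewrite normr_sg T1.
  move=> x /andP[x1 x2]; rewrite big_nil mulr1.
  have pos : 0 < T.[x] * T.[1].
    by apply: sign_no_root => // z /andP[h1 h2]; apply: nr; rewrite h2 (le_trans x1).
  have [h|h] := ltrP 0 T.[1].
    by rewrite gtr0_sg // mul1r ltW // -(pmulr_lgt0 _ h).
  have h' : T.[1] < 0 by rewrite lt_neqAle T1.
  by rewrite ltr0_sg // mulN1r oppr_ge0 ltW // -(nmulr_lgt0 _ h').
have /factor_theorem[T1 eT] := rz.
have T10 : T1 != 0 by apply: contraNneq T0 => e; rewrite eT e mul0r.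
have sT1 : (size T1 < n)%N.
  by move: sT; rewrite eT size_Mmonic ?monicXsubC // size_XsubC addn2 /=.
have [cs [sg [ucs hcs sg1 hsg]]] := IH T1 sT1 T10.
have Tx x : T.[x] = T1.[x] * (x - z) by rewrite eT hornerM hornerXsubC.
have sub w : w \in cs -> -1 <= w <= 1 /\ root T w.
  by move=> /hcs[h1 h2]; split=> //; rewrite eT rootM h2.
have [zcs|zcs] := boolP (z \in cs).
  exists (rem z cs), sg; split=> //; first exact: rem_uniq.
    by move=> w /mem_rem; apply: sub.
  move=> x hx; have := hsg x hx; rewrite (big_rem z) //= Tx.
  by move=> h; rewrite -!mulrA in h *.
exists (z :: cs), sg; split=> //=; first by rewrite zcs.
  by move=> w; rewrite inE => /orP[/eqP -> //|]; apply: sub.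
move=> x hx; rewrite big_cons Tx.
rewrite (_ : _ * _ = (sg * T1.[x] * \prod_(j <- cs) (x - j)) * (x - z) ^+ 2); last by ring.
by rewrite mulr_ge0 ?sqr_ge0 // hsg.
Qed.

Lemma sign_changes (F : R -> R) (T : {poly R}) : T != 0 -> (forall t, T.[cos t] = F t) ->
  exists (cs : seq R) (sg : R), [/\ uniq cs, `|sg| = 1,
    forall z, z \in cs -> -2 <= z <= 2 /\ F (acos (z / 2)) = 0 &
    forall t, 0 <= sg * F t * \prod_(z <- cs) (2 * cos t - z)].
Proof.
move=> T0 hT; have [cs [sg [ucs hcs sg1 hsg]]] := sign_roots T0.
exists [seq 2 * z | z <- cs], sg; split=> //.
- by rewrite map_inj_uniq // => u v /mulfI; apply; rewrite pnatr_eq0.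
- move=> _ /mapP[z /hcs[/andP[z1 z2] rz] ->]; split; first lra.
  rewrite mulrAC mulfV ?pnatr_eq0 // mul1r -hT acosK; first exact/rootP.
  by rewrite in_itv /= z1 z2.
move=> t; rewrite big_map.
have -> : \prod_(j <- cs) (2 * cos t - 2 * j) = 2 ^+ size cs * \prod_(j <- cs) (cos t - j).
  elim: (cs) => [|z l IH]; first by rewrite !big_nil mulr1.
  by rewrite !big_cons IH /= exprS; ring.
rewrite -hT mulrCA mulr_ge0 ?exprn_ge0 // hsg // cos_geN1 cos_le1 //.
Qed.

Lemma num_zeros_ge (F : R -> R) (cs : seq R) : uniq cs ->
  (forall z, z \in cs -> -2 <= z <= 2 /\ F (acos (z / 2)) = 0) ->
  ((size cs)%:R%:E <= num_zeros F)%E.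
Proof.
move=> ucs hcs; rewrite /num_zeros /counting; case: asboolP => [fin|_]; last by rewrite leey.
rewrite lee_fin ler_nat.
pose zs := [seq acos (z / 2) | z <- cs].
have itv z : z \in cs -> -1 <= z / 2 <= 1 by move=> /hcs[/andP[h1 h2] _]; lra.
have uzs : uniq zs.
  rewrite map_inj_in_uniq // => u v hu hv e.
  have : cos (acos (u / 2)) = cos (acos (v / 2)) by rewrite e.
  rewrite !acosK ?in_itv /= ?itv // => /(congr1 (fun w => w * 2)).
  by rewrite !divfK ?pnatr_eq0.
rewrite -(size_map (fun z => acos (z / 2))) -/zs.
apply: (uniq_leq_size uzs) => w /mapP[z zc ->].
rewrite -[_ \in _]/(_ \in fset_set _) in_fset_set // inE /=; have [_ F0] := hcs z zc; split=> //.
rewrite acos_ge0 ?itv //=; apply: le_trans (acos_lepi (itv z zc)) _.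
by rewrite mulr_natl mulr2n lerDl pi_ge0.
Qed.

End Signs.

(** * Size of the constants *)

Section Growth.
Local Open Scope nat_scope.

Section PolyBounded.
Variable b : nat -> nat -> nat.
Hypothesis b2 : forall k M, 1 < b k M.
Implicit Types F G : nat -> nat -> nat.

Definition poly_bounded F := exists c, forall k M, 0 < M -> F k M <= b k M ^ c.

Lemma pb_le F G : (forall k M, 0 < M -> F k M <= G k M) -> poly_bounded G -> poly_bounded F.
Proof.
by move=> FG [c hc]; exists c => k M M0; apply: leq_trans (FG k M M0) (hc k M M0).
Qed.

Lemma pb_cst n : poly_bounded (fun _ _ => n).
Proof.
exists n => k M _; apply: leq_trans (ltnW (ltn_expl n (ltnSn 1))) _.
by case: n => // n; rewrite leq_exp2r.
Qed.

Lemma pb_mul F G : poly_bounded F -> poly_bounded G ->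
  poly_bounded (fun k M => F k M * G k M).
Proof.
move=> [c hc] [d hd]; exists (c + d) => k M M0.
by rewrite expnD leq_mul ?hc ?hd.
Qed.

Lemma pb_add F G : poly_bounded F -> poly_bounded G ->
  poly_bounded (fun k M => F k M + G k M).
Proof.
move=> [c hc] [d hd]; exists (c + d).+1 => k M M0.
have b0 : 0 < b k M by rewrite ltnW.
apply: leq_trans (leq_add (hc k M M0) (hd k M M0)) _.
rewrite expnS; apply: leq_trans (_ : 2 * b k M ^ (c + d) <= _); last by rewrite leq_mul2r b2 orbT.
by rewrite mul2n -addnn leq_add // leq_pexp2l ?leq_addr ?leq_addl.
Qed.

Lemma pb_exp F n : poly_bounded F -> poly_bounded (fun k M => F k M ^ n).
Proof.
move=> hF; elim: n => [|n IH].
  by apply: (pb_le _ (pb_cst 1)) => k M _; rewrite expn0.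
by apply: (pb_le _ (pb_mul hF IH)) => k M _; rewrite expnS.
Qed.

Lemma pb_succ F : poly_bounded F -> poly_bounded (fun k M => (F k M).+1).
Proof.
move=> hF; apply: (pb_le _ (pb_add hF (pb_cst 1))) => k M _.
by rewrite addn1.
Qed.

End PolyBounded.

Definition base_growth (k M : nat) := k.+2 * M.+1.
Definition growth (k M : nat) := base_growth k M ^ k.+1.

Lemma base_growth_gt1 k M : 1 < base_growth k M.
Proof. by rewrite /base_growth; lia. Qed.

Lemma growth_gt1 k M : 1 < growth k M.
Proof. by rewrite -(exp1n k.+1) ltn_exp2r // base_growth_gt1. Qed.

Lemma pb_base_k : poly_bounded base_growth (fun k _ => k).
Proof. by exists 1 => k M _; rewrite expn1 /base_growth; nia. Qed.

Lemma pb_base_M : poly_bounded base_growth (fun _ M => M).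
Proof. by exists 1 => k M _; rewrite expn1 /base_growth; nia. Qed.

Lemma pb_base_growth F : poly_bounded base_growth F -> poly_bounded growth F.
Proof.
move=> [c hc]; exists c => k M M0; apply: leq_trans (hc k M M0) _.
case: c {hc} => // c; rewrite leq_exp2r // -{1}[base_growth k M]expn1.
by rewrite leq_pexp2l // ltnW // base_growth_gt1.
Qed.

(** An exponent linear in [k] is absorbed by the power [k.+1] in [growth]; this is why the constants
    are first measured against [base_growth]. *)
Lemma pb_pow F (e : nat -> nat) e1 : (forall k, e k <= e1 * k.+1) ->
  poly_bounded base_growth F -> poly_bounded growth (fun k M => F k M ^ e k).
Proof.
move=> he [c hc]; exists (c * e1) => k M M0.
have b0 : 0 < base_growth k M by rewrite ltnW // base_growth_gt1.
apply: leq_trans (_ : (base_growth k M ^ c) ^ e k <= _).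
  by case: (e k) => // n; rewrite leq_exp2r // hc.
rewrite /growth -!expnM leq_pexp2l //.
by apply: leq_trans (leq_mul (leqnn c) (he k)) _; rewrite mulnA mulnC.
Qed.

Definition exp_bounded (F : nat -> nat -> nat) :=
  exists c, forall k M, 0 < M -> F k M <= 2 ^ (growth k M ^ c).

Lemma eb_poly F : poly_bounded growth F -> exp_bounded F.
Proof.
move=> [c hc]; exists c => k M M0; apply: leq_trans (hc k M M0) _.
exact: ltnW (ltn_expl _ _).
Qed.

Lemma eb_pow F G : exp_bounded F -> poly_bounded growth G ->
  exp_bounded (fun k M => F k M ^ G k M).
Proof.
move=> [c hc] [d hd]; exists (c + d) => k M M0.
apply: leq_trans (_ : (2 ^ (growth k M ^ c)) ^ G k M <= _).
  by case: (G k M) => // n; rewrite leq_exp2r // hc.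
by rewrite -expnM leq_pexp2l // expnD leq_mul2l hd ?orbT.
Qed.

Lemma eb_mul F G : exp_bounded F -> exp_bounded G -> exp_bounded (fun k M => F k M * G k M).
Proof.
move=> [c hc] [d hd].
have [e he] := pb_add growth_gt1 (ex_intro _ c (fun k M (_ : 0 < M) => leqnn (growth k M ^ c)))
   (ex_intro _ d (fun k M (_ : 0 < M) => leqnn (growth k M ^ d))).
exists e => k M M0; apply: leq_trans (leq_mul (hc k M M0) (hd k M M0)) _.
by rewrite -expnD leq_pexp2l // he.
Qed.

Lemma fact_leq_exp n : n`! <= n ^ n.
Proof.
elim: n => // n IH; rewrite factS expnS leq_mul //; apply: leq_trans IH _.
by case: n => // n; rewrite leq_exp2r.
Qed.

End Growth.

Section Constants.
Local Open Scope nat_scope.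
Implicit Types k M : nat.

Definition rho_inv k := 2 * ord_bound k ^ 4.
(** Meets both smallness conditions of [tiny_runs], the 3 being there for [2 * delta < 1]. The
    coefficient bound is [2 * M] because [sym_coeff] doubles the constant term. *)
Definition delta_inv k M := 3 * cramer_const k (2 * M) * rho_inv k ^ (3 * k).
(** Four times the bound on the coefficients of [b], divided by [delta], as [hr0] requires. *)
Definition dav_root k M := 4 * 4 ^ (3 * k) * (2 * M) * delta_inv k M.
Definition spec_bound k M := (run_length k (2 * M)).+1 *
  dav_base (run_length k (2 * M)) (dav_root k M) ^ (dav_root k M ^ 4).+1.
Definition step_bound k M := (run_length k (2 * M)).+2 * (spec_bound k M).+1.
(** The bound on the coefficients of [c] divided by [gap_const]. *)
Definition ratio_bound k M :=
  4 ^ (2 * k) * (2 * M) * (2 * cramer_const k (2 * M) ^ 2 * rho_inv k ^ (2 * k)).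
Definition coeff_bound k M := 3 * step_bound k M * (20 * ratio_bound k M) *
  ((80 * step_bound k M * ratio_bound k M) ^ 2) ^ (k.+1 * (40 * ratio_bound k M).+3).
Definition final_bound k M :=
  4 ^ (2 * k) * (2 * M) * coeff_bound k M * rho_inv k ^ (2 * k).

Local Notation bb := (@poly_bounded base_growth).
Local Notation pb := (@poly_bounded growth).
Let g1 := growth_gt1.
Let c1 := base_growth_gt1.

Lemma bb_rho_inv : bb (fun k _ => rho_inv k).
Proof.
apply: pb_mul; first exact: pb_cst.
apply: pb_exp => //; apply: pb_succ => //.
by apply: pb_mul; [exact: pb_cst | apply: pb_exp => //; exact: pb_base_k].
Qed.

Lemma bb_A : bb (fun _ M => 2 * M).
Proof. by apply: pb_mul; [exact: pb_cst | exact: pb_base_M]. Qed.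

Lemma pb_pow_const n e1 : pb (fun k _ => n ^ (e1 * k)).
Proof. by apply: (@pb_pow (fun _ _ => n) _ e1); [move=> k; rewrite leq_mul | exact: pb_cst]. Qed.

Lemma pb_rho_pow e : pb (fun k _ => rho_inv k ^ (e * k)).
Proof. by apply: (@pb_pow (fun k _ => rho_inv k) _ e); [move=> k; rewrite leq_mul | exact: bb_rho_inv]. Qed.

Lemma pb_A : pb (fun _ M => 2 * M).
Proof. exact/pb_base_growth/bb_A. Qed.

Lemma pb_cramer : pb (fun k M => cramer_const k (2 * M)).
Proof.
apply: pb_mul; first exact: pb_pow_const.
apply: pb_mul.
  apply: (pb_le (G := fun k _ => (6 * k).+1 ^ (6 * k).+1)).
    by move=> k M _; apply: fact_leq_exp.
  apply: (@pb_pow (fun k _ => (6 * k).+1) _ 7); first by move=> k; lia.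
  by apply: pb_succ => //; apply: pb_mul; [exact: pb_cst | exact: pb_base_k].
by apply: (@pb_pow (fun _ M => 2 * M) _ 6); [move=> k; rewrite leq_mul | exact: bb_A].
Qed.

Lemma pb_run : pb (fun k M => run_length k (2 * M)).
Proof.
apply: (@pb_pow (fun _ M => 2 * (2 * M) + 1) _ 6); first by move=> k; rewrite leq_mul.
apply: pb_add => //; last exact: pb_cst.
by apply: pb_mul; [exact: pb_cst | exact: bb_A].
Qed.

Lemma pb_delta_inv : pb delta_inv.
Proof.
apply: pb_mul; last exact: pb_rho_pow.
by apply: pb_mul; [exact: pb_cst | exact: pb_cramer].
Qed.

Lemma pb_dav_root : pb dav_root.
Proof.
apply: pb_mul; last exact: pb_delta_inv.
apply: pb_mul; last exact: pb_A.
by apply: pb_mul; [exact: pb_cst | exact: pb_pow_const].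
Qed.

Lemma eb_dav_base : exp_bounded (fun k M => dav_base (run_length k (2 * M)) (dav_root k M)).
Proof.
have p4 := pb_succ g1 (pb_exp g1 4 pb_dav_root).
have p2 := pb_exp g1 2 pb_dav_root.
apply: eb_mul.
  apply: eb_poly; apply: pb_mul => //; do 2!apply: pb_succ => //; exact: pb_run.
apply: eb_pow => //; apply: eb_poly; apply: pb_add => //; last exact: pb_exp.
by apply: pb_add => //; exact: pb_cst.
Qed.

Lemma eb_succ F : exp_bounded F -> exp_bounded (fun k M => (F k M).+1).
Proof.
move=> [c hc]; exists c.+1 => k M M0.
have g0 : 0 < growth k M ^ c by rewrite expn_gt0 ltnW // g1.
apply: leq_trans (_ : 2 ^ (growth k M ^ c).+1 <= _).
  rewrite expnS mul2n -addnn -addn1 leq_add ?hc // expn_gt0 //.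
rewrite leq_pexp2l // expnS; apply: leq_trans (_ : 2 * growth k M ^ c <= _); first by lia.
by rewrite leq_mul2r g1 orbT.
Qed.

Lemma eb_spec : exp_bounded spec_bound.
Proof.
apply: eb_mul; first by apply: eb_poly; apply: pb_succ => //; exact: pb_run.
apply: eb_pow eb_dav_base _.
by apply: pb_succ => //; apply: pb_exp => //; exact: pb_dav_root.
Qed.

Lemma eb_step : exp_bounded step_bound.
Proof.
apply: eb_mul; last exact/eb_succ/eb_spec.
by apply: eb_poly; do 2!apply: pb_succ => //; exact: pb_run.
Qed.

Lemma pb_ratio : pb ratio_bound.
Proof.
apply: pb_mul; first by apply: pb_mul; [exact: pb_pow_const | exact: pb_A].
apply: pb_mul; last exact: pb_rho_pow.
by apply: pb_mul; [exact: pb_cst | apply: pb_exp => //; exact: pb_cramer].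
Qed.

Lemma eb_coeff : exp_bounded coeff_bound.
Proof.
have p20 := eb_poly (pb_mul (pb_cst g1 20) pb_ratio).
apply: eb_mul.
  by apply: eb_mul p20; apply: eb_mul eb_step; exact: eb_poly (pb_cst g1 3).
have e80 : exp_bounded (fun k M => 80 * step_bound k M * ratio_bound k M).
  apply: eb_mul; last exact: eb_poly pb_ratio.
  by apply: eb_mul eb_step; exact: eb_poly (pb_cst g1 80).
apply: eb_pow; first exact: eb_pow e80 (pb_cst g1 2).
apply: pb_mul.
  by apply: pb_base_growth; apply: pb_succ => //; exact: pb_base_k.
do 3!apply: pb_succ => //; apply: pb_mul; [exact: pb_cst | exact: pb_ratio].
Qed.

Lemma eb_final : exp_bounded final_bound.
Proof.
apply: eb_mul; last by apply: eb_poly; exact: pb_rho_pow.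
apply: eb_mul eb_coeff; apply: eb_poly.
by apply: pb_mul; [exact: pb_pow_const | exact: pb_A].
Qed.

End Constants.

(** * The bound on the value at 0 *)

Section Sops.
Variable V : comNzRingType.
Implicit Types (x : int -> V) (l : seq V).

(** The centred form of the action of [quad c]: unlike the one-sided [act] it preserves evenness and
    is multiplication by [2 * cos t - c]. The two differ by a shift, which [sops_act] and [act_sops]
    record. *)
Definition sop (c : V) x (n : int) : V := x (n + 1) + x (n - 1) - c * x n.
Definition sops l x : int -> V := foldr sop x l.

Lemma quads_cons c l : quads (c :: l) = quad c * quads l.
Proof. exact: big_cons. Qed.

Lemma quads_cat l l' : quads (l ++ l') = quads l * quads l'.
Proof. exact: big_cat. Qed.

Lemma act_quad (c : V) (y : nat -> V) : act (quad c) y 0 = y 2%N + y 0%N - c * y 1%N.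
Proof.
rewrite /quad actD actD act1p actXn -mulNr -polyCN actCM -['X]expr1 actXn.
by rewrite !add0n mulNr addrAC.
Qed.

Lemma sops_act l x (n : int) :
  sops l x n = act (quads l) (fun i : nat => x (n - (size l)%:Z + i%:Z)) 0.
Proof.
elim: l n => [|c l IH] n; first by rewrite /quads big_nil act1p subr0 addr0.
rewrite quads_cons actM act_quad /= /sop !IH.
pose y (i : nat) := x (n - (size l).+1%:Z + i%:Z).
have e j : act (quads l) y j = act (quads l) (fun i : nat => x (n - (size l).+1%:Z + j%:Z + i%:Z)) 0.
  rewrite -[j in LHS]add0n -act_shift; apply: eq_act => i; rewrite /y; congr x; lia.
rewrite -/y !e; congr (_ + _ - c * _); apply: eq_act => i; congr x; lia.
Qed.

Lemma act_sops l x (m : int) (i : nat) :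
  act (quads l) (fun j : nat => x (m + j%:Z)) i = sops l x (m + (size l)%:Z + i%:Z).
Proof.
rewrite sops_act -[i in LHS]add0n -act_shift; apply: eq_act => j; congr x; lia.
Qed.

End Sops.

Lemma sops_map (U V : comNzRingType) (f : {rmorphism U -> V}) (l : seq U) (x : int -> U) n :
  sops (map f l) (f \o x) n = f (sops l x n).
Proof.
by elim: l n => //= c l IH n; rewrite /sop !IH rmorphB rmorphD rmorphM.
Qed.

Section SopsReal.
Variable R : realType.
Implicit Types (x : int -> R) (l : seq R).

Lemma sop_nbsum c x n : sop c x n = nbsum x n - c * x n.
Proof. by []. Qed.

Lemma supp_sops N l x : supp N x -> supp (N + size l) (sops l x).
Proof.
move=> sx; elim: l => [|c l IH] /=; first by rewrite addn0.
move=> n hn; rewrite sop_nbsum addnS in hn *.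
by rewrite (supp_nbsum IH) // IH ?mulr0 ?subr0 //; lia.
Qed.

Lemma even_sops l x : (forall n, x (- n) = x n) -> forall n, sops l x (- n) = sops l x n.
Proof.
by move=> ev; elim: l => //= c l IH n; rewrite !sop_nbsum even_nbsum // IH.
Qed.

Lemma tp_sops N l x t : supp N x ->
  tp (N + size l) (sops l x) t = \prod_(c <- l) (2 * cos t - c) * tp N x t.
Proof.
move=> sx; elim: l => [|c l IH] /=; first by rewrite addn0 big_nil mul1r.
have sl := @supp_sops N l x sx.
rewrite addnS big_cons -mulrA -IH mulrBl -tp_nbsum // -(tp_widen t (leqnSn _) sl).
rewrite /tp /isum mulr_sumr -sumrB; apply: eq_bigr => i _ /=.
by rewrite sop_nbsum; ring.
Qed.

Lemma sops_le l x (A : R) : (forall z, z \in l -> `|z| <= 2) -> (forall n, `|x n| <= A) ->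
  forall n, `|sops l x n| <= 4 ^+ size l * A.
Proof.
move=> hl hx; elim: l hl => [|c l IH] hl n /=; first by rewrite expr0 mul1r.
have IH' := IH (fun z hz => hl z (mem_behead (s := c :: l) hz)).
have A0 : 0 <= 4 ^+ size l * A by apply: le_trans (IH' 0).
apply: le_trans (ler_normB _ _) _; apply: le_trans (lerD (ler_normD _ _) (lexx _)) _.
rewrite normrM exprS -mulrA.
have h1 := IH' (n + 1); have h2 := IH' (n - 1).
have h3 : `|c| * `|sops l x n| <= 2 * (4 ^+ size l * A).
  by apply: ler_pM => //; apply: hl; rewrite mem_head.
by move: h1 h2 h3; rewrite -/(sops l x); set X := 4 ^+ size l * A; lra.
Qed.

End SopsReal.

Section Symmetrise.
Variables (R : realType) (N : nat) (a : nat -> int).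

(* Doubling the constant term makes [tp] twice [cosine_poly]. *)
Definition sym_coeff (n : int) : int :=
  if (`|n| <= N)%N then (if n == 0 then 2 * a 0%N else a `|n|%N) else 0.

Definition symR (n : int) : R := (sym_coeff n)%:~R.

Lemma supp_symR : supp N symR.
Proof. by move=> n hn; rewrite /symR /sym_coeff leqNgt hn. Qed.

Lemma even_symR n : symR (- n) = symR n.
Proof. by rewrite /symR /sym_coeff abszN oppr_eq0. Qed.

Lemma tp_symR t : tp N symR t = 2 * cosine_poly N a t.
Proof.
pose x (n : int) : R := (if n == 0 then 2 * a 0%N else a `|n|%N)%:~R.
have -> : tp N symR t = tp N x t.
  apply: eq_bigr => i _; rewrite /symR /sym_coeff ifT //; have := ltn_ord i; lia.
rewrite /tp /cosine_poly; elim: N => [|n IH].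
  by rewrite /isum big_ord1 big_nat1 /x /= rmorphM /=; ring.
rewrite isumS IH [X in _ = 2 * X]big_nat_recr //= mulrDr; congr (_ + _).
rewrite /x /= rmorphN mulNr cosN; ring.
Qed.

Lemma sym_coeff_le M : (forall n, (n <= N)%N -> (`|a n| <= M)%N) ->
  forall n, (`|sym_coeff n| <= 2 * M)%N.
Proof.
move=> hM n; rewrite /sym_coeff; case: ifP => // hn; case: ifP => _.
  by rewrite abszM leq_mul // hM.
by apply: leq_trans (hM _ hn) _; rewrite leq_pmull.
Qed.

End Symmetrise.

Lemma norm_real_complex (R : rcfType) (r : R) : `|r%:C%C| = `|r|%:C%C :> R[i].
Proof. by rewrite normc_def /= expr0n addr0 sqrtr_sqr. Qed.

Section Structure.
Variables (R : realType) (N M : nat) (a : nat -> int) (cs : seq R).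
Hypotheses (M0 : (0 < M)%N) (aM : forall n, (n <= N)%N -> (`|a n| <= M)%N).
Let k := size cs.
Let x := symR R N a.
Let delta : R := (delta_inv k M)%:R^-1.
Let gam : R := gap_const R k (2 * M).
Local Notation rc := (real_complex R).
Let T := run_length k (2 * M).

Let cramer0 : (0 < cramer_const k (2 * M))%N.
Proof. by rewrite !muln_gt0 fact_gt0 !expn_gt0 !muln_gt0 M0 /=. Qed.

Let rho_inv0 : (0 < rho_inv k)%N.
Proof. by rewrite muln_gt0 expn_gt0. Qed.

Let dinv0 : (0 < delta_inv k M)%N.
Proof. by rewrite /delta_inv 2!muln_gt0 cramer0 expn_gt0 rho_inv0. Qed.

(** [tiny_runs] lives over [R[i]], where the roots of unity are; the numbers [w + 1/w] are real, so
    its lists and its conclusion descend to [R]. The integer [m] places the run on [Z]. *)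
Lemma companion : exists ts r1 : seq R,
  [/\ (size ts <= k)%N, (size r1 <= size ts)%N,
      (forall z, z \in ts -> `|z| <= 2) /\ (forall z, z \in r1 -> z \in ts),
      (rho_inv k)%:R^-1 ^+ k <= `|\prod_(z <- r1) (2 - z)| &
   forall (m : int) L,
    (forall i, (i < L)%N -> `|sops (cs ++ (ts ++ ts)) x (m + (size (cs ++ (ts ++ ts)))%:Z + i%:Z)| <= delta) ->
    exists v : R, (v = 0 \/ gam <= `|v|) /\ forall i, (T <= i < L)%N ->
      sops (cs ++ (ts ++ ts)) x (m + (size (cs ++ (ts ++ ts)))%:Z + i%:Z) = 0 /\
      sops (r1 ++ r1) x (m + (size (r1 ++ r1))%:Z + i%:Z) = v].
Proof.
pose csC := map rc cs.
have sC : size csC = k by rewrite size_map.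
have A0 : (0 < 2 * M)%N by rewrite muln_gt0 M0.
have rhoE (F : fieldType) : rho F (size csC) = (rho_inv k)%:R^-1 by rewrite sC.
have rhoR0 : (0 : R[i]) < (rho_inv k)%:R^-1 by rewrite invr_gt0 ltr0n rho_inv0.
have h1 : (delta_inv k M)%:R^-1 * (cramer_const (size csC) (2 * M))%:R < rho R[i] (size csC) ^+ (3 * size csC).
  rewrite rhoE sC exprVn -natrX mulrC ltr_pdivrMr ?ltr0n ?dinv0 // mulrC.
  rewrite ltr_pdivlMr ?ltr0n ?expn_gt0 ?rho_inv0 // -natrM ltr_nat.
  rewrite /delta_inv -mulnA -{1}[(_ * rho_inv k ^ _)%N]mul1n ltn_pmul2r //.
  by rewrite muln_gt0 cramer0 expn_gt0 rho_inv0.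
have h2 : 2 * ((delta_inv k M)%:R^-1 : R[i]) < 1.
  rewrite ltr_pdivrMr ?ltr0n ?dinv0 // mul1r ltr_nat.
  rewrite /delta_inv -mulnA; have : (0 < cramer_const k (2 * M) * rho_inv k ^ (3 * k))%N.
    by rewrite muln_gt0 cramer0 expn_gt0 rho_inv0.
  by move: (_ * _)%N => w; lia.
have [ts [uts sts hts R1lo runs]] := tiny_runs A0 h1 h2.
pose tsR := map (@complex.Re R) ts.
have tsE : map rc tsR = ts.
  rewrite -map_comp -[RHS]map_id; apply/eq_in_map => t /hts[w [nw ->]] /=.
  by rewrite RRe_real // twoRe_real.
pose r1 := [seq t <- tsR | t != 2].
have r1E : map rc r1 = [seq t <- ts | t != 2].
  rewrite -tsE filter_map; congr map; apply: eq_filter => t /=.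
  by rewrite -(inj_eq (@complexI R)) rmorph_nat.
exists tsR, r1; split.
- by rewrite size_map -sC.
- by rewrite size_filter count_size.
- split; last by move=> z; rewrite mem_filter => /andP[].
  move=> z /mapP[t tt ->]; have [w [nw e]] := hts t tt.
  rewrite -lecR -norm_real_complex RRe_real; last by rewrite e twoRe_real.
  rewrite rmorph_nat e /twoRe; apply: le_trans (ler_normD _ _) _.
  by rewrite normfV nw invr1.
- move: R1lo; rewrite norm_quads ?normr1 // rhoE sC -r1E big_map.
  rewrite normr_prod -lecR rmorphXn fmorphV rmorph_nat /= => h; apply: le_trans h _.
  rewrite rmorph_prod le_eqVlt; apply/orP; left; apply/eqP; apply: eq_bigr => z _.
  by rewrite -[RHS]/((`|2 - z|)%:C%C) -norm_real_complex rmorphB rmorph_nat /twoRe invr1.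
move=> m L small.
pose y (i : nat) := sym_coeff N a (m + i%:Z).
have toC (l : seq R) i : act (quads (map rc l)) (intr \o y) i = rc (sops l x (m + (size l)%:Z + i%:Z)).
  rewrite -(sops_map (real_complex R)) -(size_map rc l) -act_sops; apply: eq_act => j.
  by rewrite /x /symR /= rmorph_int.
have pE : quads csC * quads ts ^+ 2 = quads (map rc (cs ++ (tsR ++ tsR))).
  by rewrite !map_cat !quads_cat tsE expr2.
have r1C : quads [seq t <- ts | t != 2] ^+ 2 = quads (map rc (r1 ++ r1)).
  by rewrite map_cat quads_cat r1E expr2.
have y1 n : (`|y n| <= 2 * M)%N by apply: sym_coeff_le.
have y2 i : (i < L)%N -> `|act (quads csC * quads ts ^+ 2) (intr \o y) i| <= (delta_inv k M)%:R^-1.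
  move=> iL; rewrite pE toC norm_real_complex.
  by have := small i iL; rewrite -lecR /delta fmorphV rmorph_nat.
have [v [gv hv]] := runs y L y1 y2.
rewrite sC -/T in gv hv.
have [LT|TL] := leqP L T.
  exists 0; split; first by left.
  by move=> i /andP[i1 i2]; have := leq_trans (leq_ltn_trans i1 i2) LT; rewrite ltnn.
have hv' i : (T <= i < L)%N ->
    sops (cs ++ (tsR ++ tsR)) x (m + (size (cs ++ (tsR ++ tsR)))%:Z + i%:Z) = 0 /\
    rc (sops (r1 ++ r1) x (m + (size (r1 ++ r1))%:Z + i%:Z)) = v.
  move=> hi; have [e0 e1] := hv i hi; split; last by rewrite -toC -r1C.
  by apply: (@complexI R); rewrite rmorph0 -toC -pE.
have TT : (T <= T < L)%N by rewrite leqnn.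
have [_ ev] := hv' T TT.
exists (sops (r1 ++ r1) x (m + (size (r1 ++ r1))%:Z + T%:Z)); split.
  case: gv => [v0|gv]; [left | right].
    by apply: (@complexI R); rewrite rmorph0 -v0.
  rewrite -lecR -norm_real_complex ev.
  by move: gv; rewrite /gam /gap_const !rmorphM !fmorphV rmorphXn fmorphV /= !rmorph_nat.
move=> i hi; have [e0 e1] := hv' i hi; split=> //.
by apply: (@complexI R); rewrite e1 ev.
Qed.

End Structure.

Definition int_range (N : nat) : seq int := [seq i%:Z - N%:Z | i <- iota 0 (2 * N).+1].

Lemma mem_int_range N (n : int) : (n \in int_range N) = (`|n| <= N)%N.
Proof.
apply/mapP/idP => [ [i hi ->] | hn ]; last first.
  by exists (absz (n + N%:Z)%R); [rewrite mem_iota; lia | lia].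
by move: hi; rewrite mem_iota; lia.
Qed.

Lemma uniq_int_range N : uniq (int_range N).
Proof. by rewrite map_inj_uniq ?iota_uniq // => i j /addIr []. Qed.

Lemma isum_range (V : zmodType) N (h : int -> V) : isum N h = \sum_(n <- int_range N) h n.
Proof. by rewrite /isum big_map -(big_mkord xpredT (fun i => h (i%:Z - N%:Z))) /index_iota subn0. Qed.

Lemma tp0 (R : realType) N (x : int -> R) : tp N x 0 = isum N x.
Proof. by apply: eq_isum => n; rewrite mulr0 cos0 mulr1. Qed.

Lemma sum_range_le (R : realType) N (x : int -> R) (C0 : R) : 0 <= C0 ->
  (forall n, `|x n| <= C0) ->
  `|isum N x| <= C0 * (size [seq n <- int_range N | x n != 0])%:R.
Proof.
move=> C00 hx; rewrite isum_range.
elim: (int_range N) => [|n s IH]; first by rewrite big_nil normr0 mulr0.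
rewrite big_cons /=; case: eqP => [->|_] /=; first by rewrite add0r.
rewrite -[(size _).+1]addn1 natrD mulrDr mulr1 addrC.
by apply: le_trans (ler_normD _ _) (lerD IH (hx n)).
Qed.

Section ValueBound.
Variables (R : realType) (N M : nat) (a : nat -> int) (cs : seq R) (sg : R).
Hypotheses (M0 : (0 < M)%N) (aM : forall n, (n <= N)%N -> (`|a n| <= M)%N).
Hypothesis cs2 : forall z, z \in cs -> -2 <= z <= 2.
Hypothesis sg1 : `|sg| = 1.
Hypothesis hsg : forall t, 0 <= sg * cosine_poly N a t * \prod_(z <- cs) (2 * cos t - z).
Let k := size cs.
Let x := symR R N a.
Let delta : R := (delta_inv k M)%:R^-1.
Let gam : R := gap_const R k (2 * M).
Let T := run_length k (2 * M).

Let cramer0 : (0 < cramer_const k (2 * M))%N.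
Proof. by rewrite !muln_gt0 fact_gt0 !expn_gt0 !muln_gt0 M0 /=. Qed.
Let rho_inv0 : (0 < rho_inv k)%N.
Proof. by rewrite muln_gt0 expn_gt0. Qed.
Let dinv0 : (0 < delta_inv k M)%N.
Proof. by rewrite /delta_inv 2!muln_gt0 cramer0 expn_gt0 rho_inv0. Qed.
Let delta0 : 0 < delta. Proof. by rewrite invr_gt0 ltr0n dinv0. Qed.

Let supp_x : supp N x. Proof. exact: supp_symR. Qed.
Let even_x n : x (- n) = x n. Proof. exact: even_symR. Qed.
Let x_le n : `|x n| <= (2 * M)%:R.
Proof.
rewrite /x /symR -intr_norm -[(2 * M)%:R]/(((2 * M)%N%:Z)%:~R) ler_int.
by have := sym_coeff_le aM n; lia.
Qed.

Lemma value_bound : `|cosine_poly N a 0 : R| <= (final_bound k M)%:R.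
Proof.
have [ts [r1 [sts sr1 [ts2 r1ts] r1lo runs]]] := companion cs M0 aM.
rewrite -/k -/x -/delta -/T -/gam in sts r1lo runs.
set l := cs ++ (ts ++ ts) in runs; set l1 := r1 ++ r1 in runs.
have sl : (size l <= 3 * k)%N by rewrite !size_cat -/k; lia.
have sl1 : (size l1 <= 2 * k)%N by rewrite size_cat; lia.
have sl1l : (size l1 <= size l)%N by rewrite !size_cat; lia.
have l2 z : z \in l -> `|z| <= 2.
  rewrite mem_cat => /orP[/cs2|]; first by rewrite ler_norml.
  by rewrite mem_cat orbb; apply: ts2.
have l12 z : z \in l1 -> `|z| <= 2 by rewrite mem_cat orbb => /r1ts; apply: ts2.
pose c := sops l1 x; pose b0 := sops l x; pose b n := sg * b0 n.
have nb n : `|b n| = `|b0 n| by rewrite normrM sg1 mul1r.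
have evb0 n : b0 (- n) = b0 n by apply: even_sops.
have pow4 (j e : nat) (y : R) : (j <= e)%N -> y <= 4 ^+ j * (2 * M)%:R -> y <= (4 ^ e * (2 * M))%:R.
  move=> je h; apply: le_trans h _; rewrite -natrX -natrM ler_nat.
  by rewrite leq_mul2r leq_pexp2l ?orbT.
have b_le n : `|b n| <= (4 ^ (3 * k) * (2 * M))%:R.
  by rewrite nb; apply: pow4 sl _; apply: sops_le.
have c_le n : `|c n| <= (4 ^ (2 * k) * (2 * M))%:R.
  by apply: pow4 sl1 _; apply: sops_le.
have dense n : b n != 0 -> exists2 j, (j <= T)%N & delta <= `|b (n + j%:Z)|.
  move=> bn; apply: contrapT => no.
  have lt j : (j <= T)%N -> `|b0 (n + j%:Z)| <= delta.
    by move=> jT; rewrite leNgt; apply/negP => h; apply: no; exists j; rewrite // nb ltW.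
  (* [runs] gives exact zeros only from index [T] on, whereas [n] opens its window; evenness
     reflects the window and gives [n] the last index [T]. *)
  have [|v [_ hv]] := runs (- n - T%:Z - (size l)%:Z) T.+1.
    move=> i iT; have := lt (T - i)%N (leq_subr _ _).
    rewrite -evb0 -/b0; congr (`|b0 _| <= _); lia.
  have [|+ _] := hv T; first by rewrite leqnn ltnSn.
  rewrite -/b0 (_ : _ + T%:Z = - n); last by lia.
  by rewrite evb0 => e; move: bn; rewrite /b e mulr0 eqxx.
have sb : supp (N + size l) b by move=> n hn; rewrite /b /b0 (supp_sops supp_x) // mulr0.
have evb n : b (- n) = b n by rewrite /b evb0.
have F0 t : 0 <= tp (N + size l) b t.
  have -> : tp (N + size l) b t = sg * tp (N + size l) b0 t.
    by rewrite /tp /isum mulr_sumr; apply: eq_bigr => i _; rewrite -mulrA.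
  rewrite tp_sops // tp_symR !big_cat /=.
  set P := \prod_(z <- cs) _; set Q := \prod_(z <- ts) _.
  rewrite (_ : _ * _ = 2 * (Q ^+ 2) * (sg * cosine_poly N a t * P)); last by ring.
  by rewrite mulr_ge0 ?hsg // mulr_ge0 ?sqr_ge0.
have r00 : (0 < dav_root k M)%N.
  by rewrite /dav_root 3!muln_gt0 dinv0 expn_gt0 muln_gt0 M0.
have hr0 : 4 * b 0 <= (dav_root k M)%:R * delta.
  have e : (dav_root k M)%:R * delta = 4 * (4 ^ (3 * k) * (2 * M))%:R.
    rewrite /dav_root (natrM R _ (delta_inv k M)) -/delta /delta mulfK ?pnatr_eq0 ?gtn_eqF //.
    by rewrite -(mulnA 4%N) (natrM R 4).
  by rewrite e ler_pM2l //; apply: le_trans (ler_norm _) (b_le 0).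
pose Lam := [seq n <- int_range (N + size l) | b n != 0].
have sLam : (size Lam <= spec_bound k M)%N.
  apply: (sparse_spectrum sb evb F0 dense delta0 r00 hr0).
    by rewrite filter_uniq ?uniq_int_range.
  by move=> n; rewrite mem_filter => /andP[].
have memLam n : b0 n != 0 -> n \in Lam.
  move=> bn; have bn' : b n != 0 by rewrite -normr_eq0 nb normr_eq0.
  rewrite mem_filter bn' mem_int_range leqNgt; apply/negP => /sb e.
  by rewrite e eqxx in bn'.
(* A run of length [T.+2] determines [c] at the indices [T] and [T.+1], that is at [n] and [n + 1].
   So each nonzero value of [b0] spoils [T.+2] positions. *)
pose Bad := [seq (w : int) - (size l)%:Z + (size l1)%:Z + T%:Z - i%:Z | w <- Lam, i <- iota 0 T.+2].
have sBad : (size Bad <= step_bound k M)%N.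
  rewrite (size_allpairs (fun (w : int) (i : nat) => w - (size l)%:Z + (size l1)%:Z + T%:Z - i%:Z)).
  by rewrite size_iota mulnC leq_mul // leqW.
have good n : n \notin Bad -> c (n + 1) = c n /\ (c n = 0 \/ gam <= `|c n|).
  move=> nB; have [|v [gv hv]] := runs (n - (size l1)%:Z - T%:Z) T.+2.
    move=> i iT; rewrite -/b0 (_ : b0 _ = 0) ?normr0 1?ltW //.
    apply/eqP; apply: contraNT nB => /memLam h; apply/allpairsP.
    exists (n - (size l1)%:Z - T%:Z + (size l)%:Z + i%:Z, i); split=> //.
      by rewrite mem_iota.
    by rewrite /=; lia.
  have [|_ e1] := hv T; first by rewrite leqnn /= ltnW.
  have [|_ e2] := hv T.+1; first by rewrite leqnSn /=.
  have -> : c n = v by rewrite -e1 /c; congr (sops _ _ _); lia.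
  by split=> //; rewrite -e2 /c; congr (sops _ _ _); lia.
have ec n : c (- n) = c n by apply: even_sops.
have sc : supp (N + size l1) c by apply: supp_sops.
have sgn t : 0 <= sg * tp (N + size l1) c t * \prod_(z <- cs) (2 * cos t - z).
  rewrite tp_sops // tp_symR big_cat /=.
  set P := \prod_(z <- cs) _; set Q := \prod_(z <- r1) _.
  rewrite (_ : _ * P = 2 * (Q ^+ 2) * (sg * cosine_poly N a t * P)); last by ring.
  by rewrite mulr_ge0 ?hsg // mulr_ge0 ?sqr_ge0.
have rho0 : 0 < (rho_inv k)%:R :> R by rewrite ltr0n.
have rho_inv_eq : rho R k = (rho_inv k)%:R^-1 by [].
have cr0 : 0 < (cramer_const k (2 * M))%:R :> R by rewrite ltr0n.
have den0 : 0 < (2 * cramer_const k (2 * M) ^ 2)%:R :> R.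
  by rewrite ltr0n muln_gt0 expn_gt0 cramer0.
have gam0 : 0 < gam.
  rewrite /gam /gap_const; apply: divr_gt0 den0.
  by rewrite exprn_gt0 // rho_inv_eq invr_gt0.
have hK : (4 ^ (2 * k) * (2 * M))%:R <= (ratio_bound k M)%:R * gam.
  rewrite /ratio_bound (natrM _ (_ * (2 * M))) -mulrA ler_peMr ?ler0n //.
  have e : (2 * cramer_const k (2 * M) ^ 2 * rho_inv k ^ (2 * k))%:R * gam = 1.
    rewrite /gam /gap_const rho_inv_eq exprVn -natrX -invfM.
    rewrite (natrM R _ (rho_inv k ^ (2 * k))) [X in X^-1]mulrC mulfV //.
    by rewrite mulf_neq0 ?gt_eqF // natrX exprn_gt0.
  by rewrite e.
have K00 : (0 < ratio_bound k M)%N.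
  case: (posnP (ratio_bound k M)) => // e; move: hK.
  by rewrite e mul0r leNgt ltr0n muln_gt0 expn_gt0 muln_gt0 M0.
have J0 : (0 < step_bound k M)%N by rewrite muln_gt0.
pose Lc := [seq n <- int_range (N + size l1) | c n != 0].
have sLc : (size Lc <= coeff_bound k M)%N.
  apply: (nonzero_coeffs_le sc ec c_le (fun n h => (good n h).1) (fun n h => (good n h).2)
    sg1 sgn gam0 hK K00 sBad J0).
    by rewrite filter_uniq ?uniq_int_range.
  by move=> n; rewrite mem_filter => /andP[].
(* At [t = 0] the factors from [r1] contribute [Q ^+ 2], bounded below because 2 was excluded from
   [r1]; so the sum of the coefficients of [c] controls the value at 0. *)
set Q := \prod_(z <- r1) (2 - z) in r1lo.
have tp_c : tp (N + size l1) c 0 = Q ^+ 2 * (2 * cosine_poly N a 0).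
  by rewrite tp_sops // tp_symR cos0 mulr1 big_cat.
have C00 : 0 <= (4 ^ (2 * k) * (2 * M))%:R :> R by rewrite ler0n.
have := sum_range_le (N + size l1) C00 c_le.
rewrite -tp0 tp_c normrM normrX normrM normr_nat => up.
have {up} up : `|Q| ^+ 2 * (2 * `|cosine_poly N a 0 : R|) <=
    (4 ^ (2 * k) * (2 * M))%:R * (coeff_bound k M)%:R.
  by apply: le_trans up _; rewrite ler_wpM2l // ler_nat.
have rk0 : 0 < (rho_inv k ^ k)%:R :> R by rewrite ltr0n expn_gt0 rho_inv0.
have Q1 : 1 <= (rho_inv k ^ (2 * k))%:R * `|Q| ^+ 2.
  rewrite mulnC expnM natrX -exprMn; apply: exprn_ege1.
  by move: r1lo; rewrite exprVn -natrX -[X in X <= _]mulr1 ler_pdivrMl.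
rewrite /final_bound (natrM R _ (rho_inv k ^ (2 * k))) (natrM R _ (coeff_bound k M)).
set f0 := `|cosine_poly N a 0|; rewrite -/f0 in up.
have f00 : 0 <= f0 by rewrite normr_ge0.
set P : R := (rho_inv k ^ (2 * k))%:R in Q1 *.
have P0 : 0 <= P by rewrite ler0n.
rewrite -[X in X * P](mulr1); apply: le_trans (_ : (P * `|Q| ^+ 2) * f0 <= _).
  by rewrite ler_peMl.
rewrite mulr1 [X in _ <= X]mulrC -mulrA ler_wpM2l //; apply: le_trans up.
by rewrite ler_wpM2l ?exprn_ge0 // mulr_natl mulr2n lerDl.
Qed.

End ValueBound.

(** * Iterated logarithms *)

Section Logarithms.
Variable R : realType.
Implicit Types x y : R.

Lemma ln_gt0_gt1 x : 0 < ln x -> 1 < x.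
Proof. by rewrite !ltNge; apply: contra; exact: ln_le0. Qed.

Lemma ln_mono x y : 0 < x -> x <= y -> ln x <= ln y.
Proof. by move=> x0 xy; rewrite ler_ln ?posrE // (lt_le_trans x0). Qed.

Lemma ln2_bounds : 1 / 2 <= ln (2 : R) <= 1.
Proof.
apply/andP; split; last by rewrite -[2](_ : 1 + 1 = _) //; apply: le_ln1Dx; lra.
have h : ln (1 + (- (1 / 2)) : R) <= - (1 / 2) by apply: le_ln1Dx; lra.
have e : 2 = (1 + - (1 / 2))^-1 :> R by field.
by rewrite {2}e lnV ?posrE; lra.
Qed.

Lemma ln_succ_le (n : nat) : (0 < n)%N -> ln (n.+1%:R : R) <= 1 + ln n%:R.
Proof.
move=> n0; have /andP[_ l2] := ln2_bounds.
have n0' : 0 < n%:R :> R by rewrite ltr0n.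
apply: le_trans (_ : ln (2 * n%:R : R) <= _); last first.
  by rewrite lnM ?posrE // lerD2r.
apply: ln_mono; first by rewrite ltr0n.
by rewrite -natrM ler_nat; lia.
Qed.

(* The value at 0 is an integer, so its triple logarithm, when positive, is bounded
   away from 0; this disposes of the small values for which the bound of the
   theorem is large only because its denominator is small. *)
Lemma triple_ln_gap : exists2 tau : R, 0 < tau &
  forall n : nat, 0 < ln (ln (ln (n%:R : R))) -> tau <= ln (ln (ln n%:R : R)).
Proof.
have ex : exists n : nat, 0 < ln (ln (ln n%:R : R)).
  pose E : R := expR (expR (expR 1)); exists (Num.truncn E).+1.
  have h := truncnS_gt E.
  have h1 : expR (expR 1) <= ln ((Num.truncn E).+1%:R : R).
    by rewrite -{1}[expR (expR 1)]expRK ln_mono ?expR_gt0 // ltW.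
  have h2 : expR 1 <= ln (ln ((Num.truncn E).+1%:R : R)).
    by rewrite -{1}[expR 1]expRK ln_mono ?expR_gt0.
  by apply: lt_le_trans (ltr01) _; rewrite -{1}[1]expRK ln_mono ?expR_gt0.
have [n [n0 least]] := ex_least ex; exists (ln (ln (ln n%:R))) => // m m0.
have n1 := ln_gt0_gt1 n0; have n2 : 1 < ln (n%:R : R) by apply: ln_gt0_gt1; lra.
have n3 : 1 < n%:R :> R by apply: ln_gt0_gt1; lra.
have nm : n%:R <= m%:R :> R by rewrite ler_nat least.
by do 3![apply: ln_mono; first by lra].
Qed.

(** Two logarithms reduce [2 ^ (growth k M ^ C)] to a multiple of [k.+1] times [ln k.+2 + ln M.+1];
    as [ln k.+2 >= 1 / 2], this sum is at most three times the product [(1 + ln M) * ln k.+2]. *)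
Lemma loglog_value_bound : exists2 C : R, 0 < C & forall (k M : nat) (X : R),
  (0 < M)%N -> 0 < ln (ln X) -> X <= (final_bound k M)%:R ->
  ln (ln X) <= C * k.+1%:R * (1 + ln M%:R) * ln k.+2%:R.
Proof.
have [C hC] := eb_final; exists (3 * C.+1%:R); first by rewrite mulr_gt0.
move=> k M X M0 X2 hX; have X1 := ln_gt0_gt1 X2.
have X0 : 1 < X by apply: ln_gt0_gt1; lra.
have /andP[l2 l2'] := ln2_bounds.
have g0 : (0 < growth k M ^ C)%N by rewrite expn_gt0 ltnW ?growth_gt1.
have u1 : ln X <= (growth k M ^ C)%:R.
  apply: le_trans (_ : ln (2 ^ (growth k M ^ C))%N%:R <= _).
    by apply: ln_mono; [lra | apply: le_trans hX _; rewrite ler_nat hC].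
  by rewrite natrX lnXn // -[X in X <= _]mulr_natr ler_piMl ?ler0n.
apply: le_trans (_ : ln (growth k M ^ C)%:R <= _); first by apply: ln_mono; lra.
have k0 : 0 < k.+2%:R :> R by [].
rewrite /growth /base_growth -expnM natrX lnXn ?ltr0n // (natrM R k.+2 M.+1) lnM ?posrE //.
rewrite -[X in X <= _]mulr_natl (natrM R k.+1).
have hM := ln_succ_le M0.
have M1 : 0 <= ln (M%:R : R) by apply: ln_ge0; rewrite ler1n.
have hk : ln (2 : R) <= ln k.+2%:R by apply: ln_mono; rewrite ?ler_nat.
set L := ln k.+2%:R in hk *; set m := ln M%:R in M1 hM *.
apply: le_trans (_ : k.+1%:R * C.+1%:R * (3 * ((1 + m) * L)) <= _); last first.
  by rewrite le_eqVlt; apply/orP; left; apply/eqP; ring.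
apply: ler_pM.
- by rewrite -natrM ler0n.
- by apply: addr_ge0; [lra | apply: ln_ge0; rewrite ler1n].
- by rewrite ler_pM2l ?ltr0n // ler_nat.
- have : 0 <= m * (L - 1 / 2) by apply: mulr_ge0; lra.
  by move=> h; nra.
Qed.

End Logarithms.

Lemma cosine_poly0 (R : realType) N (a : nat -> int) :
  cosine_poly N a 0 = (\sum_(0 <= n < N.+1) a n)%:~R :> R.
Proof.
by rewrite /cosine_poly raddf_sum /=; apply: eq_bigr => n _; rewrite mulr0 cos0 mulr1.
Qed.

Lemma le_max_abs (S : {fset int}) (s : int) : s \in S -> (`|s| <= max_abs S)%N.
Proof. by move=> sS; apply: (leq_bigmax_seq s). Qed.

(* The hypothesis [1 <= zeros_bound ...] restricts the claim to the range where
   the bound is not trivially small: for zero-free polynomials, e.g. a positive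
   constant g = K with S = {K}, the bound can lie strictly between 0 and 1. *)
Theorem theorem1p3 (R : realType) :
  exists c : R, 0 < c /\
    forall (S : {fset int}) (N : nat) (a : nat -> int),
      (forall n : nat, (n <= N)%N -> a n \in S) ->
      1 <= zeros_bound c S `|cosine_poly N a 0| ->
      ((zeros_bound c S `|cosine_poly N a 0|)%:E
         <= num_zeros (cosine_poly N a : R -> R))%E.
Proof.
have [tau tau0 gap] := triple_ln_gap R; have [C C0 hC] := loglog_value_bound R.
have e0 : 0 < expR 1 / tau by rewrite divr_gt0 ?expR_gt0.
(* The 3 gives [3 * B <= u], [expR 1 / tau] rules out [ln u <= 1], and [2 * C] decides the final
   comparison. *)
pose d : R := 3 + expR 1 / tau + 2 * C.
have d0 : 0 < d by rewrite /d; lra.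
have d1 : 3 <= d by rewrite /d; lra.
have d2 : expR 1 / tau < d by rewrite /d; lra.
have d3 : 2 * C < d by rewrite /d; lra.
exists d^-1; split; first by rewrite invr_gt0.
move=> S N a aS; rewrite /zeros_bound.
set M := max_abs S; set X := `|cosine_poly N a 0|.
set u := ln (ln X); set m : R := 1 + ln M%:R; set B := _ / m * _ => B1.
have aM n : (n <= N)%N -> (`|a n| <= M)%N by move=> /aS; exact: le_max_abs.
have [n eX] : exists n : nat, X = n%:R.
  exists (absz (\sum_(0 <= n < N.+1) a n)).
  by rewrite /X cosine_poly0 -intr_norm -abszE.
have m1 : 1 <= m.
  rewrite /m lerDl; have [->|M0] := posnP M; first by rewrite ln0.
  by apply: ln_ge0; rewrite ler1n.
have w0 : 0 < u / ln u.
  have : 0 < d^-1 / m by rewrite divr_gt0 ?invr_gt0; lra.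
  by move=> h; rewrite -(pmulr_rgt0 _ h) -/B; lra.
(* For [u <= 0] the default values make the quotient [u / ln u] equal to 0. *)
have u0 : 0 < u.
  by rewrite ltNge; apply/negP => u0; move: w0; rewrite (ln0 u0) invr0 mulr0 ltxx.
have lu0 : 0 < ln u by move: w0; rewrite pmulr_rgt0 // invr_gt0.
have Be : B * (d * m * ln u) = u.
  by rewrite /B; field; rewrite !gt_eqF //; lra.
(* Otherwise [u <= expR 1], while [B >= 1] and [ln u >= tau] force [u >= d * tau > expR 1]. *)
have u1 : 1 < ln u.
  rewrite ltNge; apply/negP => lu1.
  have lut : tau <= ln u by rewrite /u eX; apply: gap; rewrite -eX.
  have ue : u <= expR 1 by rewrite -[u]lnK ?posrE // ler_expR.
  have : expR 1 < d * tau by rewrite -ltr_pdivrMr.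
  rewrite ltNge => /negP; apply; apply: le_trans ue; rewrite -Be -[d * tau]mul1r.
  apply: ler_pM => //; first by rewrite mulr_ge0 // ltW.
  by apply: ler_pM; rewrite ?(ltW tau0) ?ler_peMr // ltW.
have M0 : (0 < M)%N.
  rewrite lt0n; apply/eqP => M0; move: u0; rewrite /u /X cosine_poly0 big1_seq ?normr0.
    by rewrite !(ln0 (lexx 0)) ltxx.
  move=> i; rewrite mem_index_iota /= => iN; have := aM i; rewrite M0.
  by move=> h; apply/eqP; rewrite -absz_eq0 -leqn0 h //; lia.
have [T hT] := cosine_poly_horner R N a.
have T0 : T != 0.
  apply/eqP => T0; move: u0; rewrite /u /X -hT T0 horner0 normr0.
  by rewrite !(ln0 (lexx 0)) ltxx.
have [cs [sg [ucs sg1 hcs hsg]]] := sign_changes T0 hT.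
apply: le_trans (num_zeros_ge ucs hcs); rewrite lee_fin leNgt; apply/negP => kB.
have := @value_bound R N M a cs sg M0 aM (fun z h => (hcs z h).1) sg1 hsg.
rewrite -/X => hX; have := hC _ _ _ M0 u0 hX; rewrite -/u -/m.
have mlu : 1 <= m * ln u by rewrite -[1]mulr1 ler_pM // ltW.
have uB : 3 * B <= u.
  rewrite -Be mulrC -mulrA ler_pM2l; last by lra.
  by rewrite -[3]mulr1; apply: ler_pM => //; lra.
have s2 : (size cs).+2%:R <= 3 * B by rewrite -addn2 natrD; lra.
have s1 : (size cs).+1%:R <= 2 * B by rewrite -addn1 natrD; lra.
have ls : ln (size cs).+2%:R <= ln u by apply: ln_mono; [rewrite ltr0n | lra].
(* With fewer than [B] sign changes the bound on [u] is at most [2 * C * B * m * ln u], strictly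
   below [d * B * m * ln u], which is [u] itself. *)
move=> hu; have : C * (size cs).+1%:R * m * ln (size cs).+2%:R < u; last by rewrite ltNge hu.
apply: le_lt_trans (_ : C * (2 * B) * m * ln u < u).
  apply: ler_pM => //.
  - by rewrite !mulr_ge0 //; lra.
  - by apply: ln_ge0; rewrite ler1n.
  - by rewrite ler_pM2r ?ler_pM2l //; lra.
rewrite -{2}Be (_ : _ * ln u = B * (2 * C * (m * ln u))); last by ring.
by rewrite -(mulrA d) ltr_pM2l ?ltr_pM2r //; lra.
Qed.
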